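(* Let $\Bbbk$ be a field of characteristic zero and $S=\Bbbk[x_1,\dots,x_n]$. Let $r\le n$, let $2\le e_1\le\cdots\le e_r$ be integers, and let $F=(f_1,\dots,f_r)$ be a regular sequence of monomials of $S$ with $\deg f_i=e_i$ for all $i$. Set $P=(x_1^{e_1},\dots,x_r^{e_r})$. If $I\subset S$ is any homogeneous ideal containing $F$, then there exists a lex-plus-$P$ ideal $L$ such that $I$ and $L$ have the same Hilbert function and $b_{i,j}(L)\ge b_{i,j}(I)$ for all $i$ and $j$.
   Context: $S$ is standard graded ($\deg x_i=1$). The Hilbert function of a graded module $M$ is $d\mapsto\dim_{\Bbbk}M_d$. The graded Betti numbers are $b_{i,j}(M)=\dim_{\Bbbk}\operatorname{Tor}^S_i(\Bbbk,M)_j$. The (graded) lexicographic order: for monomials of the same degree, $x_1^{p_1}\cdots x_n^{p_n}>_{\mathrm{lex}}x_1^{q_1}\cdots x_n^{q_n}$ if there is an $i$ with $p_i>q_i$ and $p_j=q_j$ for all $j<i$. A monomial ideal $\hat L\subset S$ is lex if, whenever $u,v$ are monomials of the same degree with $u<_{\mathrm{lex}}v$ and $u\in \hat L$, then $v\in \hat L$. An ideal $L\supseteq P$ is lex-plus-$P$ if there is a lex ideal $\hat L$ with $L=\hat L+P$. *)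

(* Defs.v *)
From HB Require Import structures.
From Stdlib Require Import ClassicalEpsilon.
From mathcomp Require Import all_boot all_order all_algebra.
From mathcomp Require Import mpoly.

Set Implicit Arguments.
Unset Strict Implicit.
Unset Printing Implicit Defensive.

Import GRing.Theory.
Local Open Scope ring_scope.

(* An ideal is a Prop-valued predicate and need not be proper; mathcomp's
   [idealr_closed] excludes the unit ideal, which is allowed here. *)
Section Ideals.
Variables (n : nat) (k : fieldType).
Local Notation S := {mpoly k[n]}.
Implicit Types (I J G : S -> Prop) (p q : S) (u v m : 'X_{1..n}).

Definition is_ideal I : Prop :=
  [/\ I 0, forall p q, I p -> I q -> I (p + q)
    & forall a p, I p -> I (a * p)].

Definition ideal_gen G : S -> Prop :=
  fun p => forall J, is_ideal J -> (forall g, G g -> J g) -> J p.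

Definition ideal_add I J : S -> Prop :=
  fun p => exists a b, [/\ I a, J b & p = a + b].

Definition homogeneous_ideal I : Prop :=
  is_ideal I /\ forall p d, I p -> I (pihomog mdeg d p).

Definition monomial_ideal I : Prop :=
  exists M : 'X_{1..n} -> Prop,
    forall p, I p <-> ideal_gen (fun g => exists2 m, M m & g = 'X_[m]) p.

(* The first variable is the one with index 0 and is the largest. *)
Definition lex_lt u v : Prop :=
  exists2 i : 'I_n, (u i < v i)%N & forall j : 'I_n, (j < i)%N -> u j = v j.

Definition lex_ideal I : Prop :=
  monomial_ideal I /\
  forall u v, mdeg u = mdeg v -> lex_lt u v -> I 'X_[u] -> I 'X_[v].

Definition lex_plus (P L : S -> Prop) : Prop :=
  (forall p, P p -> L p) /\
  exists2 Lhat, lex_ideal Lhat & forall p, L p <-> ideal_add Lhat P p.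

Definition regular_sequence r (f : 'I_r -> S) : Prop :=
  (forall (i : 'I_r) p,
     let J := ideal_gen (fun g => exists2 j : 'I_r, (j < i)%N & g = f j) in
     J (f i * p) -> J p) /\
  ~ ideal_gen (fun g => exists j, g = f j) 1.

Definition pure_powers r (ler : (r <= n)%N) (e : 'I_r -> nat) : S -> Prop :=
  ideal_gen (fun g => exists i, g = 'X_(widen_ord ler i) ^+ e i).

End Ideals.

Section Dimension.
Variables (k : fieldType) (V : lmodType k).
Implicit Types Z B : V -> Prop.

(* The classes of u_0, ..., u_(d-1) form a basis of the space Z / B. *)
Definition has_dim_quot Z B (d : nat) : Prop :=
  exists u : 'I_d -> V,
    [/\ forall i, Z (u i),
        forall c : 'I_d -> k, B (\sum_i c i *: u i) -> forall i, c i = 0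
      & forall z, Z z -> exists c : 'I_d -> k, B (z - \sum_i c i *: u i)].

(* Only meaningful when Z / B is finite-dimensional, as are all the spaces to
   which it is applied below. *)
Definition dim_quot Z B : nat := epsilon (inhabits 0%N) (has_dim_quot Z B).

End Dimension.

Definition hilbert n (k : fieldType) (I : {mpoly k[n]} -> Prop) (d : nat) :=
  dim_quot (fun p => I p /\ p \is d.-homog) (fun p => p = 0).

(* The degree-d part of the twist S(-s); it is 0 when d < s. *)
Definition in_twist n (k : fieldType) (s d : nat) (p : {mpoly k[n]}) : bool :=
  if (s <= d)%N then p \is (d - s).-homog else p == 0.

Section Tor.
Variables (n : nat) (k : fieldType).
Local Notation S := {mpoly k[n]}.

(* The S-linear map with matrix D between free modules with bases A and B. *)
Definition mxmap (A B : finType) (D : A -> B -> S) (v : {ffun A -> S}) :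
    {ffun B -> S} :=
  [ffun b => \sum_a v a * D a b].

(* Graded resolutions of k = S / (x_1, ..., x_n) by graded free S-modules of
   finite rank, F_i being the direct sum of the S(-res_deg a) over the basis
   elements a of F_i.  The augmentation F_0 -> k maps v to
   \sum_a v_a(0) * res_aug a. *)
Record free_resolution := FreeResolution {
  res_basis : nat -> finType;
  res_deg : forall i, res_basis i -> nat;
  res_diff : forall i, res_basis i.+1 -> res_basis i -> S;
  res_aug : res_basis 0%N -> k;
  res_diff_homog : forall i a b,
    in_twist (res_deg b) (res_deg a) (@res_diff i a b);
  res_aug_homog : forall a, res_aug a != 0 -> res_deg a = 0%N;
  res_aug_surj : exists a, res_aug a != 0;
  res_exact0 : forall v : {ffun res_basis 0%N -> S},
    \sum_a (v a)@_0%MM * res_aug a = 0 <->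
    exists w, v = mxmap (@res_diff 0%N) w;
  res_exact : forall i (v : {ffun res_basis i.+1 -> S}),
    mxmap (@res_diff i) v = 0 <-> exists w, v = mxmap (@res_diff i.+1) w
}.

Section Homology.
Variables (F : free_resolution) (I : S -> Prop).

(* (F_i (x) I)_j.  As F_i is free, F_i (x) I is the module of the families of
   elements of I indexed by the basis of F_i. *)
Definition tensor_part i j (v : {ffun res_basis F i -> S}) : Prop :=
  forall a, I (v a) /\ in_twist (res_deg a) j (v a).

Definition tor_cycle i j : {ffun res_basis F i -> S} -> Prop :=
  match i with
  | 0%N => fun v => tensor_part j v
  | i'.+1 => fun v => tensor_part j v /\ mxmap (@res_diff F i') v = 0
  end.

Definition tor_boundary i j (v : {ffun res_basis F i -> S}) : Prop :=
  exists2 w : {ffun res_basis F i.+1 -> S},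
    tensor_part j w & v = mxmap (@res_diff F i) w.

Definition tor_dim i j : nat := dim_quot (@tor_cycle i j) (@tor_boundary i j).

End Homology.
End Tor.

Section Koszul.
Variables (n : nat) (k : fieldType).
Local Notation S := {mpoly k[n]}.
Implicit Types (p q f g : S) (i j l : 'I_n) (T : {set 'I_n}) (m : 'X_{1..n}).

Definition koszul_sign j T : nat := #|[set t in T | (t < j)%N]|.

(* The differential sends e_T to the sum over j in T of
   (-1)^#{t in T | t < j} x_j e_{T \ j}. *)
Definition koszul_coef T T' : S :=
  \sum_(j in T | T :\ j == T') (-1) ^+ koszul_sign j T *: 'X_j.

Definition koszul_basis (d : nat) : finType := {T : {set 'I_n} | #|T| == d}.

(* Exactness: with q the least element of T, the k-linear map [kh] below sends
   x^m e_(T \ q) to x^m / x_q e_T if x_q is the first variable of x^m, and to 0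
   otherwise; it is a contracting homotopy. *)
Let below i m := [forall j : 'I_n, (j < i)%N ==> (m j == 0%N)].

Let dlt i f : S :=
  \sum_(m <- msupp f | (0 < m i)%N && below i m) f@_m *: 'X_[(m - U_(i))%MM].

Let mcoeff_dlt i f m : (dlt i f)@_m = if below i m then f@_(m + U_(i))%MM else 0.
Proof.
have bD m' : below i (m' + U_(i))%MM = below i m'.
  apply/forallP/forallP => h j; apply/implyP => lt_ji; have:= h j;
  rewrite lt_ji /= mnmDE mnm1E (_ : (i == j) = false) ?addn0 //;
  by apply/eqP => e; move: lt_ji; rewrite e ltnn.
rewrite /dlt raddf_sum /=.
under eq_bigr => m' _ do rewrite mcoeffZ mcoeffX.
have key m' : (0 < m' i)%N -> ((m' - U_(i))%MM == m) = (m' == (m + U_(i))%MM).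
  move=> m'i; apply/eqP/eqP => [<-|->]; last by rewrite addmK.
  rewrite submK //; apply/mnm_lepP => j; rewrite mnm1E.
  by case: eqP => // <-.
rewrite (eq_bigr (fun m' => if m' == (m + U_(i))%MM then f@_(m + U_(i))%MM else 0)); last first.
  by move=> m' /andP[h _]; rewrite key //; case: eqP => [->|_]; rewrite ?mulr1 ?mulr0.
rewrite -big_mkcondr /=.
have [b|nb] := boolP (below i m); last first.
  rewrite big_pred0 // => m'; case: eqP => [->|_]; last by rewrite andbF.
  by rewrite bD (negbTE nb) andbF.
rewrite (eq_bigl (pred1 (m + U_(i))%MM)); last first.
  move=> m' /=; case: eqP => [->|_]; last by rewrite andbF.
  by rewrite bD b mnmDE mnm1E eqxx addn1.
have [h|h] := boolP ((m + U_(i))%MM \in msupp f).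
  by rewrite -big_filter filter_pred1_uniq ?big_seq1 ?msupp_uniq.
rewrite big1_seq; first by move: h; rewrite -mcoeff_eq0 => /eqP ->.
by move=> m' /andP[/eqP ->]; rewrite (negbTE h).
Qed.

Let mcoeff_X j f m : ('X_j * f)@_m = if (0 < m j)%N then f@_(m - U_(j))%MM else 0.
Proof.
rewrite -commr_mpolyX; case: ifPn => h.
  have {1}-> : m = (U_(j) + (m - U_(j)))%MM.
    rewrite addmC submK //; apply/mnm_lepP => l; rewrite mnm1E.
    by case: eqP => // <-.
  by rewrite mcoeffMX.
apply/eqP; rewrite mcoeff_eq0 (perm_mem (msuppMX _ _)).
apply/mapP => -[m' _ e]; move: h; rewrite e mnmDE mnm1E eqxx.
by rewrite add1n.
Qed.

Let dltZ i c f : dlt i (c *: f) = c *: dlt i f.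
Proof.
apply/mpolyP => m; rewrite mcoeffZ !mcoeff_dlt; case: ifP => _.
  by rewrite mcoeffZ.
by rewrite mulr0.
Qed.

Let dlt_sum (I : finType) (P : pred I) (E : I -> S) i :
  dlt i (\sum_(a | P a) E a) = \sum_(a | P a) dlt i (E a).
Proof.
apply/mpolyP => m; rewrite mcoeff_dlt [RHS]raddf_sum /=; case: ifP => b.
  by rewrite raddf_sum; apply: eq_bigr => a _; rewrite mcoeff_dlt b.
by rewrite big1 // => a _; rewrite mcoeff_dlt b.
Qed.

Let dlt_Xlt i j f : (j < i)%N -> dlt i ('X_j * f) = 0.
Proof.
move=> lt_ji; apply/mpolyP => m; rewrite mcoeff0 mcoeff_dlt mcoeff_X.
case: ifP => // /forallP/(_ j); rewrite lt_ji /= => /eqP mj0.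
rewrite mnmDE mj0 mnm1E; case: (eqVneq i j) => // e.
by move: lt_ji; rewrite e ltnn.
Qed.

Let dlt_Xgt i j f : (i < j)%N -> dlt i ('X_j * f) = 'X_j * dlt i f.
Proof.
move=> lt_ij; apply/mpolyP => m; rewrite mcoeff_X !mcoeff_dlt mcoeff_X.
have ne : (i == j) = false by apply/eqP => e; move: lt_ij; rewrite e ltnn.
rewrite mnmDE mnm1E ne addn0; case: (ltnP 0 (m j)) => mj; last by rewrite if_same.
have -> : below i (m - U_(j))%MM = below i m.
  apply: eq_forallb => l; rewrite mnmBE mnm1E; case: (eqVneq j l) => [<-|_].
    by rewrite ltnNge (ltnW lt_ij).
  by rewrite subn0.
case: ifP => // _; congr (mcoeff _ f); apply/mnmP => l.
rewrite !(mnmBE, mnmDE, mnm1E).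
by case: (eqVneq j l) => [<-|_]; [rewrite ne !addn0|rewrite !subn0].
Qed.

Let sum_dlt (i : nat) f m :
  \sum_(j : 'I_n | (j < i)%N) ('X_j * dlt j f)@_m
  = if [forall j : 'I_n, (j < i)%N ==> (m j == 0%N)] then 0 else f@_m.
Proof.
have E j : ('X_j * dlt j f)@_m = if (0 < m j)%N && below j m then f@_m else 0.
  rewrite mcoeff_X; case: ifP => //= mj; rewrite mcoeff_dlt.
  have -> : below j (m - U_(j))%MM = below j m.
    apply: eq_forallb => l; rewrite mnmBE mnm1E; case: (eqVneq j l) => [<-|_].
      by rewrite ltnn.
    by rewrite subn0.
  rewrite submK //; apply/mnm_lepP => l; rewrite mnm1E.
  by case: eqP => // <-.
under eq_bigr do rewrite E.
case: ifPn => [/forallP b|].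
  rewrite big1 // => j ji; have := b j; rewrite ji /= => /eqP ->.
  by rewrite ltnn.
rewrite negb_forall => /existsP[j0 h0].
case: (@arg_minnP _ j0 (fun j : 'I_n => (j < i)%N && (0 < m j)%N) val).
  by move: h0; rewrite negb_imply lt0n.
move=> j /andP[ji mj] minj; rewrite (bigD1 j) //= mj.
have -> : below j m.
  apply/forallP => l; apply/implyP => lj; case: (posnP (m l)) => [//|ml].
  by have := minj l; rewrite ml (ltn_trans lj ji) => /(_ isT); rewrite leqNgt lj.
rewrite big1 ?addr0 // => l /andP[li /eqP nlj]; case: ifP => // /andP[ml /forallP b].
have := minj l; rewrite li ml => /(_ isT); rewrite leq_eqVlt => /orP[/eqP e|lj].
  by case: nlj; apply: val_inj.
by have := b j; rewrite lj /= eqn0Ngt mj.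
Qed.

Let kd (v : {set 'I_n} -> S) T : S :=
  \sum_(j | j \notin T) (-1) ^+ koszul_sign j T *: ('X_j * v (j |: T)).

Let kh (v : {set 'I_n} -> S) T : S :=
  if [pick j in T | [forall t in T, (j <= t)%N]] is Some j
  then dlt j (v (T :\ j)) else 0.

Let khE v T j : j \in T -> (forall t, t \in T -> (j <= t)%N) ->
  kh v T = dlt j (v (T :\ j)).
Proof.
move=> jT minj; rewrite /kh; case: pickP => [l /andP[lT /forall_inP minl]|/(_ j)].
  suff -> : l = j by [].
  by apply/val_inj/eqP; rewrite eqn_leq minl // minj.
by rewrite jT /= => /forall_inP; case.
Qed.

Let kh0 v : kh v set0 = 0.
Proof. by rewrite /kh; case: pickP => // j; rewrite inE. Qed.

Let sign0 j T : (forall t, t \in T -> (j <= t)%N) -> koszul_sign j T = 0%N.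
Proof.
move=> h; apply/eqP; rewrite cards_eq0; apply/eqP/setP => t; rewrite !inE.
by apply/negP => /andP[/h]; rewrite leqNgt => /negP.
Qed.

Let hom0 v : v set0 = kd (kh v) set0 + ((v set0)@_0%MM)%:MP.
Proof.
apply/mpolyP => m; rewrite mcoeffD mcoeffC /kd raddf_sum /=.
rewrite (eq_big (fun j : 'I_n => (j < n)%N)
  (fun j => ('X_j * dlt j (v set0))@_m)); last first.
- move=> j _; rewrite sign0 ?expr0 ?scale1r; last by move=> t; rewrite inE.
  rewrite setU0 (@khE _ _ j) ?set11 ?setDv //.
  by move=> t /set1P ->.
- by move=> j; rewrite inE ltn_ord.
rewrite sum_dlt; case: ifPn => [/forallP h|].
  suff -> : m = 0%MM by rewrite eqxx mulr1 add0r.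
  by apply/mnmP => j; have := h j; rewrite ltn_ord mnm0E /= => /eqP.
case: (eqVneq 0%MM m) => [<-|_]; last by rewrite mulr0 addr0.
by case/negP; apply/forallP => j; rewrite mnm0E eqxx implybT.
Qed.

Let hom1 v T : T != set0 -> v T = kd (kh v) T + kh (kd v) T.
Proof.
case/set0Pn => q0 q0T.
case: (@arg_minnP _ q0 (mem T) val q0T) => q qT minq {q0 q0T}.
have {}qT : q \in T := qT.
have {}minq t : t \in T -> (q <= t)%N := minq t.
rewrite [kh (kd v) T](@khE _ _ _ qT minq) /kd.
rewrite (bigID (fun j : 'I_n => (j < q)%N)) /=.
rewrite (eq_big (fun j : 'I_n => (j < q)%N) (fun j => 'X_j * dlt j (v T))); last first.
- move=> j /andP[jT jq].
  have minj t : t \in T -> (j <= t)%N by move=> /minq; apply/leq_trans/ltnW.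
  rewrite sign0 // expr0 scale1r (@khE _ _ j) ?setU11 ?setU1K //.
  by move=> t /setU1P[->|/minj].
- move=> j; rewrite andbC; case: (ltnP j q) => //= jq.
  by apply/negP => /minq; rewrite leqNgt jq.
rewrite dlt_sum [X in _ = _ + X](bigD1 q) ?setD11 //= dltZ sign0 ?expr0 ?scale1r; last first.
  by move=> t /setD1P[_ /minq].
rewrite setD1K //.
rewrite [X in _ = _ + _ + (_ + X)](bigID (fun j : 'I_n => (j < q)%N)) /=.
rewrite [X in _ = _ + _ + (_ + (X + _))]big1 ?add0r; last first.
  by move=> j /andP[_ jq]; rewrite dltZ dlt_Xlt ?scaler0.
rewrite addrACA [X in _ = _ + X](_ : _ = 0) ?addr0; last first.
  rewrite [X in _ + X](eq_bigl (fun j => (j \notin T) && ~~ (j < q)%N)); last first.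
    move=> j; rewrite !inE; case: (eqVneq j q) => [->|_] /=; last by rewrite andbT.
    by rewrite qT.
  rewrite -big_split big1 //= => j /andP[jT]; rewrite -leqNgt leq_eqVlt => /orP[/eqP/val_inj e|qj].
    by move: jT; rewrite -e qT.
  have jq : j != q by apply: contraNneq jT => ->.
  rewrite dltZ dlt_Xgt // (@khE _ _ q) ?inE ?qT ?orbT //; last first.
    by move=> t /setU1P[->|/minq //]; apply: ltnW.
  have -> : (j |: T) :\ q = j |: T :\ q.
    by apply/setP => t; rewrite !inE; case: (eqVneq t j) => [->|_]; rewrite ?jq.
  have -> : koszul_sign j T = (koszul_sign j (T :\ q)).+1.
    rewrite /koszul_sign (cardsD1 q) inE qT qj add1n; congr _.+1.
    by apply: eq_card => t; rewrite !inE andbA.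
  by rewrite exprS mulN1r scaleNr addNr.
apply/mpolyP => m; rewrite mcoeffD raddf_sum /= sum_dlt mcoeff_dlt.
rewrite -/(below q m) mcoeff_X mnmDE mnm1E eqxx addn1 /= addmK.
by case: ifP; rewrite ?add0r ?addr0.
Qed.

Let kdd v T : kd (kd v) T = 0.
Proof.
pose F j l : S := (-1) ^+ (koszul_sign j T + koszul_sign l (j |: T)) *:
  ('X_j * ('X_l * v (l |: (j |: T)))).
have -> : kd (kd v) T =
    \sum_(j | j \notin T) \sum_(l | (l \notin T) && (l != j)) F j l.
  apply: eq_bigr => j _; rewrite mulr_sumr scaler_sumr.
  apply: eq_big => [l|l _]; first by rewrite !inE negb_or andbC.
  by rewrite -scalerAr scalerA -exprD.
have -> : \sum_(j | j \notin T) \sum_(l | (l \notin T) && (l != j)) F j l =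
    \sum_(j | j \notin T) \sum_(l | (l \notin T) && (l < j)%N) F j l +
    \sum_(j | j \notin T) \sum_(l | (l \notin T) && (j < l)%N) F j l.
  rewrite -big_split; apply: eq_bigr => j _ /=.
  rewrite (bigID (fun l : 'I_n => (l < j)%N)) /=; congr (_ + _); apply: eq_bigl => l.
    rewrite -andbA; congr (_ && _); case: (eqVneq l j) => [->|//].
    by rewrite ltnn.
  rewrite -andbA -leqNgt leq_eqVlt; congr (_ && _).
  by rewrite -(inj_eq val_inj) /=; case: ltngtP.
rewrite [X in _ + X](exchange_big_dep (fun l => l \notin T)) /=; last first.
  by move=> j l _ /andP[].
rewrite -big_split big1 //= => j jT.
rewrite [X in _ + X](eq_bigl (fun l => (l \notin T) && (l < j)%N)); last first.
  by move=> l; rewrite jT.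
rewrite -big_split big1 //= => l /andP[lT lj]; rewrite /F.
have -> : koszul_sign l (j |: T) = koszul_sign l T.
  apply: eq_card => t; rewrite !inE; case: (eqVneq t j) => [->|//].
  by rewrite ltnNge (ltnW lj) !andbF.
have -> : koszul_sign j (l |: T) = (koszul_sign j T).+1.
  rewrite /koszul_sign (cardsD1 l) !inE eqxx lj add1n; congr _.+1.
  apply: eq_card => t; rewrite !inE; case: (eqVneq t l) => [->|//].
  by rewrite (negbTE lT).
rewrite addnS exprS mulN1r scaleNr addnC setUCA mulrCA.
by rewrite subrr.
Qed.

Let ext d (v : {ffun koszul_basis d -> S}) T : S :=
  if insub T is Some a then v a else 0.

Let extE d v (a : koszul_basis d) : ext v (val a) = v a.
Proof. by rewrite /ext valK. Qed.

Let ext0 d (v : {ffun koszul_basis d -> S}) T : #|T| != d -> ext v T = 0.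
Proof. by move=> h; rewrite /ext insubN. Qed.

Let res d (v : {set 'I_n} -> S) : {ffun koszul_basis d -> S} :=
  [ffun a => v (val a)].

Definition koszul_diff d (a : koszul_basis d.+1) (b : koszul_basis d) : S :=
  koszul_coef (val a) (val b).

Let mxmapE d v b : mxmap (@koszul_diff d) v b = kd (ext v) (val b).
Proof.
rewrite ffunE /kd /koszul_diff /koszul_coef.
under eq_bigr do rewrite mulr_sumr.
rewrite (exchange_big_dep predT) //= [RHS]big_mkcond; apply: eq_bigr => j _.
case: ifPn => jb; last first.
  rewrite big_pred0 // => a; apply/negP => /andP[_ /eqP e].
  by move/negP: jb; apply; rewrite /= in e; rewrite /= -e setD11.
have cb : #|j |: val b| == d.+1 by rewrite cardsU1 jb (eqP (valP b)).
rewrite (big_pred1 (Sub (j |: val b) cb)) /=; last first.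
  move=> a /=; rewrite -[RHS](inj_eq val_inj) /=; apply/andP/eqP => [[ja /eqP e]|->].
    by rewrite /= in e; rewrite -e setD1K.
  by rewrite setU11 setU1K.
have -> : koszul_sign j (j |: val b) = koszul_sign j (val b).
  apply: eq_card => t; rewrite !inE; case: (eqVneq t j) => [->|//].
  by rewrite ltnn !andbF.
by rewrite -[j |: val b]/(val (Sub (j |: val b) cb : koszul_basis d.+1)) extE
  -scalerAr mulrC.
Qed.

Let kd_ext d (v : {ffun koszul_basis d.+1 -> S}) T :
  kd (ext v) T = ext (mxmap (@koszul_diff d) v) T.
Proof.
have [cT|cT] := boolP (#|T| == d).
  by rewrite -[T]/(val (Sub T cT : koszul_basis d)) extE mxmapE.
rewrite [RHS]ext0 // /kd big1 // => j jT.
by rewrite ext0 ?mulr0 ?scaler0 // cardsU1 jT eqSS.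
Qed.

Let kh_ext d (v : {ffun koszul_basis d -> S}) T :
  kh (ext v) T = ext (res d.+1 (kh (ext v))) T.
Proof.
have [cT|cT] := boolP (#|T| == d.+1).
  by rewrite -{2}[T]/(val (Sub T cT : koszul_basis d.+1)) extE ffunE.
rewrite [RHS]ext0 // /kh; case: pickP => // j /andP[jT _].
rewrite ext0; first by apply/mpolyP => m; rewrite mcoeff_dlt !mcoeff0 if_same.
by apply: contraNneq cT => <-; rewrite (cardsD1 j T) jT.
Qed.

Let eq_kd v w T : v =1 w -> kd v T = kd w T.
Proof. by move=> e; apply: eq_bigr => j _; rewrite e. Qed.

Let kdiff_homog d (a : koszul_basis d.+1) (b : koszul_basis d) :
  in_twist #|val b| #|val a| (@koszul_diff d a b).
Proof.
rewrite /in_twist (eqP (valP a)) (eqP (valP b)) leqnSn subSnn.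
by rewrite /koszul_diff rpred_sum // => j _; rewrite rpredZ // dhomogX /= mdeg1.
Qed.

Let kaug_homog (a : koszul_basis 0) : (1 : k) != 0 -> #|val a| = 0%N.
Proof. by move=> _; rewrite (eqP (valP a)). Qed.

Let empty0 : koszul_basis 0 := Sub set0 (introT eqP (cards0 _)).

Let kaug_surj : exists a : koszul_basis 0, (1 : k) != 0.
Proof. by exists empty0; rewrite oner_neq0. Qed.

Let basis0 (a : koszul_basis 0) : a = empty0.
Proof. by apply/val_inj/eqP; rewrite /= -cards_eq0 (eqP (valP a)). Qed.

Let kexact0 (v : {ffun koszul_basis 0 -> S}) :
  \sum_a (v a)@_0%MM * 1 = 0 <-> exists w, v = mxmap (@koszul_diff 0) w.
Proof.
have -> : \sum_a (v a)@_0%MM * 1 = (ext v set0)@_0%MM.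
  rewrite (big_pred1 empty0) ?mulr1 -?extE // => a /=.
  by rewrite [a]basis0 eqxx.
split=> [v0|[w ->]].
  exists (res 1 (kh (ext v))); apply/ffunP => a; rewrite mxmapE [a]basis0.
  rewrite -extE /= hom0 v0 mpolyC0 addr0; apply: eq_kd => T.
  by rewrite kh_ext.
rewrite -kd_ext /kd raddf_sum big1 //= => j _.
by rewrite mcoeffZ mcoeff_X mnm0E mulr0.
Qed.

Let kexact d (v : {ffun koszul_basis d.+1 -> S}) :
  mxmap (@koszul_diff d) v = 0 <-> exists w, v = mxmap (@koszul_diff d.+1) w.
Proof.
split=> [v0|[w ->]]; last first.
  apply/ffunP => b; rewrite mxmapE ffunE -[RHS](kdd (ext w) (val b)).
  by apply: eq_kd => T; rewrite kd_ext.
exists (res d.+2 (kh (ext v))); apply/ffunP => a; rewrite mxmapE -[LHS]extE.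
rewrite hom1; last by rewrite -cards_eq0 (eqP (valP a)).
rewrite [X in _ + X](_ : _ = 0) ?addr0.
  by apply: eq_kd => T; rewrite kh_ext.
rewrite /kh; case: pickP => // j _; apply/mpolyP => m.
rewrite mcoeff_dlt kd_ext v0 /ext.
by case: insub => [b|]; rewrite ?ffunE !mcoeff0 if_same.
Qed.

Definition koszul : free_resolution n k :=
  @FreeResolution n k koszul_basis (fun d a => #|val a|) koszul_diff (fun=> 1)
    kdiff_homog kaug_homog kaug_surj kexact0 kexact.

End Koszul.

(* dim_k Tor^S_i(k, I)_j, computed with the Koszul resolution of k. *)
Definition betti n (k : fieldType) (I : {mpoly k[n]} -> Prop) (i j : nat) : nat :=
  tor_dim (koszul n k) I i j.

(* Main.v *)
(* For an ideal I with initial monomials A, the graded Betti numbers of I plus the ranks of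
   the Koszul differentials on I in homological degrees i and i + 1 add up to a number
   depending on the Hilbert function only.  So it suffices to make these ranks go down while
   keeping the Hilbert function.  They go down when passing to initial ideals, hence along the
   degenerations A -> in(D A) where D is the distraction z^q -> prod_(k < q) (z - lambda^k x),
   which is compatible with the Koszul differential.  For monomial ideals the ranks depend on
   the characteristic only, so we may work over algC and take for lambda a primitive b-th root
   of unity; then D (z^b) = z^b - x^b.  Such degenerations first turn the given monomials,
   which have disjoint supports, into x_1^(e_1), ..., x_r^(e_r), and later make the ideal
   stable in its last variable z without losing these powers.

   For z-stable ideals the ranks are computed slice by slice in the exponent of z: apart from
   terms depending on the Hilbert function, they only involve the slices 0 and e_z - 1, which
   are ideals in fewer variables.  By induction on the number of variables these slices may be
   replaced with lex segments modulo the powers, and comparing the resulting ideal with the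
   lex segments in all variables concludes. *)

From HB Require Import structures.
From Stdlib Require Import ClassicalEpsilon.
From mathcomp Require Import perm.
From mathcomp Require Import all_boot all_order all_algebra.
From mathcomp Require Import algC cyclotomic mpoly ring zify.
Require Import Defs.

Set Implicit Arguments.
Unset Strict Implicit.
Unset Printing Implicit Defensive.

Import GRing.Theory.
Local Open Scope ring_scope.

(** * Dimensions of subspaces given by predicates *)

Section LinearAlgebra.
Variable k : fieldType.
Implicit Types V W : lmodType k.

(** Initial ideals lower ranks because the boundary of a leading strand is, if nonzero, the leading
    strand of a boundary, while boundaries may have further leading strands.

    A primitive b-th root of unity lambda serves two ends. The element z^b = D(z^b + x^b) survives
    as long as x^b is present, which is where e_1 <= ... <= e_r enters. And 1 + lambda + ... +
    lambda^(q-1) is nonzero for q < b, which makes the distraction repair a failure of stability at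
    z-exponent q.

    Stability is reached only up to a chosen degree, so that a weight bounds the number of
    distractions. Restarting for each degree is harmless, because lex segments depend on the Hilbert
    function only.

    In the sum over slices, slice 0 enters through its rank, but slice e_z - 1 through its rank
    minus its size, that is, minus its number of cycles. Hence the lex ideal in all variables must
    be small in slice 0 and large in slice e_z - 1, compared with the lex segments of the slices of
    the stable ideal. Both inclusions come from trading factors z for other variables along the lex
    order. *)

Definition subsp V (Z : V -> Prop) : Prop :=
  Z 0 /\ forall a u v, Z u -> Z v -> Z (a *: u + v).

Definition hd V (Z : V -> Prop) (d : nat) : Prop :=
  has_dim_quot Z (fun v => v = 0) d.

Lemma subspZ V (Z : V -> Prop) a u : subsp Z -> Z u -> Z (a *: u).
Proof. by move=> [Z0 ZL] Zu; rewrite -[_ *: _]addr0; apply: ZL. Qed.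

Lemma subspD V (Z : V -> Prop) u v : subsp Z -> Z u -> Z v -> Z (u + v).
Proof. by move=> [Z0 ZL] Zu Zv; rewrite -[u]scale1r; apply: ZL. Qed.

Lemma subspB V (Z : V -> Prop) u v : subsp Z -> Z u -> Z v -> Z (u - v).
Proof. by move=> [Z0 ZL] Zu Zv; rewrite addrC -scaleN1r; apply: ZL. Qed.

Lemma subsp_sum V (Z : V -> Prop) (J : Type) (r : seq J) (P : pred J) (F : J -> V) :
  subsp Z -> (forall i, P i -> Z (F i)) -> Z (\sum_(i <- r | P i) F i).
Proof.
move=> sZ h; elim/big_ind: _ => //; first by case: sZ.
by move=> x y; apply: subspD.
Qed.

Lemma subsp0 V : subsp (fun v : V => v = 0).
Proof. by split=> // a u v -> ->; rewrite scaler0 addr0. Qed.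

Lemma steinitz V (B : V -> Prop) a b (u : 'I_a -> V) (v : 'I_b -> V) :
    subsp B ->
    (forall c : 'I_a -> k, B (\sum_i c i *: u i) -> forall i, c i = 0) ->
    (forall i, exists c : 'I_b -> k, B (u i - \sum_j c j *: v j)) ->
  (a <= b)%N.
Proof.
move=> sB u_free /fin_all_exists[C uC]; rewrite leqNgt; apply/negP => lt_ba.
pose A := \matrix_(i < a, j < b) C i j.
have /rowV0Pn[w wK w0] : kermx A != 0.
  by rewrite -mxrank_eq0 mxrank_ker subn_eq0 -ltnNge (leq_ltn_trans (rank_leq_col _)).
case/negP: w0; apply/eqP/rowP => i; rewrite mxE.
apply: (u_free (fun i => w 0 i)).
have -> : \sum_i w 0 i *: u i = \sum_i w 0 i *: (u i - \sum_j C i j *: v j).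
  under [RHS]eq_bigr do rewrite scalerBr scaler_sumr.
  rewrite sumrB [X in _ - X]exchange_big /= [X in _ - X]big1 ?subr0 // => j _.
  under eq_bigr do rewrite scalerA.
  rewrite -scaler_suml; move/sub_kermxP/rowP: wK => /(_ j).
  rewrite mxE [RHS]mxE => wK; rewrite [X in X *: _](_ : _ = 0) ?scale0r //.
  by rewrite -[RHS]wK; apply: eq_bigr => l _; rewrite mxE.
by apply: subsp_sum => // l _; apply: subspZ.
Qed.

Lemma has_dim_quot_uniq V (Z B : V -> Prop) a b :
  subsp B -> has_dim_quot Z B a -> has_dim_quot Z B b -> a = b.
Proof.
move=> sB [u [Zu fu gu]] [v [Zv fv gv]]; apply/eqP; rewrite eqn_leq.
rewrite (steinitz sB fu (fun i => gv _ (Zu i))).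
by rewrite (steinitz sB fv (fun i => gu _ (Zv i))).
Qed.

Lemma dim_quotE V (Z B : V -> Prop) d :
  subsp B -> has_dim_quot Z B d -> dim_quot Z B = d.
Proof.
move=> sB hd; apply: (has_dim_quot_uniq sB _ hd).
by apply: (epsilon_spec (inhabits 0%N)); exists d.
Qed.

Lemma has_dim_quot_ext V (Z Z' B B' : V -> Prop) d :
    (forall v, Z v <-> Z' v) -> (forall v, B v <-> B' v) ->
  has_dim_quot Z B d -> has_dim_quot Z' B' d.
Proof.
move=> eZ eB [u [Zu fu gu]]; exists u; split=> [i|c /eB|z /eZ/gu[c h]]; first exact/eZ.
  exact: fu.
by exists c; apply/eB.
Qed.

Lemma hd_uniq V (Z : V -> Prop) a b : hd Z a -> hd Z b -> a = b.
Proof. exact/has_dim_quot_uniq/subsp0. Qed.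

Lemma hd_ext V (Z Z' : V -> Prop) d : (forall v, Z v <-> Z' v) -> hd Z d -> hd Z' d.
Proof. by move=> e; apply: has_dim_quot_ext. Qed.

Lemma hd_leq_inj V W (f : {linear V -> W}) (Z : V -> Prop) (Y : W -> Prop) a b :
    subsp Z -> hd Z a -> hd Y b -> (forall z, Z z -> Y (f z)) ->
    (forall z, Z z -> f z = 0 -> z = 0) ->
  (a <= b)%N.
Proof.
move=> sZ [u [Zu fu gu]] [v [Yv fv gv]] ZY f_inj.
apply: (@steinitz W (fun v => v = 0) a b (fun i => f (u i)) v (subsp0 W)).
  move=> c h; apply: fu; apply: f_inj.
    by apply: subsp_sum => // i _; apply: subspZ.
  by rewrite linear_sum -[RHS]h; apply: eq_bigr => i _; rewrite linearZ.
by move=> i; apply/gv/ZY.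
Qed.

Lemma hd_leq_surj V W (f : {linear V -> W}) (Z : V -> Prop) (Y : W -> Prop) a b :
    hd Z a -> hd Y b -> (forall y, Y y -> exists2 z, Z z & f z = y) ->
  (b <= a)%N.
Proof.
move=> [u [Zu fu gu]] [v [Yv fv gv]] fZY.
apply: (@steinitz W (fun v => v = 0) b a v (fun i => f (u i)) (subsp0 W)) => // i.
have [z /gu[c zE] <-] := fZY _ (Yv i); exists c.
rewrite -(eq_bigr _ (fun j _ => linearZ_LR f (c j) (u j))) -linear_sum.
by rewrite -linearB zE linear0.
Qed.

Lemma hd_image V W (f : {linear V -> W}) (Z : V -> Prop) a :
    subsp Z -> hd Z a -> (forall z, Z z -> f z = 0 -> z = 0) ->
  hd (fun w => exists2 z, Z z & f z = w) a.
Proof.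
move=> sZ [u [Zu fu gu]] f_inj; exists (fun i => f (u i)); split=> [i|c h|w [z Zz <-]].
- by exists (u i).
- apply: fu; apply: f_inj; first by apply: subsp_sum => // i _; apply: subspZ.
  by rewrite linear_sum -[RHS]h; apply: eq_bigr => i _; rewrite linearZ.
have [c zE] := gu z Zz; exists c.
rewrite -(eq_bigr _ (fun j _ => linearZ_LR f (c j) (u j))) -linear_sum.
by rewrite -linearB zE linear0.
Qed.

(** An independent family modulo B of maximal size is a basis, and sizes are bounded by the
    dimension of Y. This supplies dimensions to spaces that are given only by predicates. *)
Lemma has_dim_quot_ex V (Z Y B : V -> Prop) b :
    subsp Z -> subsp B -> hd Y b -> (forall z, Z z -> Y z) ->
  exists d, has_dim_quot Z B d.
Proof.
move=> sZ sB Yb ZY.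
pose indep d := exists u : 'I_d -> V, (forall i, Z (u i)) /\
  forall c : 'I_d -> k, B (\sum_i c i *: u i) -> forall i, c i = 0.
have ub d : indep d -> (d <= b)%N.
  case: Yb => v [Yv fv gv] [u [Zu fu]]; apply: (@steinitz V (fun v => v = 0) d b u v).
  - exact: subsp0.
  - by move=> c h; apply: fu; rewrite h; case: sB.
  by move=> i; apply/gv/ZY.
have [d [[u [Zu fu]] maxd]] : exists d, indep d /\ ~ indep d.+1.
  have : exists d, ~ indep d by exists b.+1 => /ub; rewrite ltnn.
  case=> m; elim: m => [[]|m IH nm].
    by exists (fun=> 0); split=> [[]|c _ []].
  by have [im|/IH//] := classic (indep m); exists m.
exists d; exists u; split=> // z Zz.
have [//|nz] := classic (exists c : 'I_d -> k, B (z - \sum_i c i *: u i)).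
case: maxd; exists (fun i => if unlift ord0 i is Some j then u j else z); split.
  by move=> i; case: unliftP.
move=> c; rewrite big_ord_recl unlift_none.
under eq_bigr do rewrite liftK.
case: (eqVneq (c ord0) 0) => [c0|c0].
  rewrite c0 scale0r add0r => h i; case: (unliftP ord0 i) => [j ->|-> //].
  exact: (fu (fun j => c (lift ord0 j))).
move=> h; case: nz; exists (fun j => - (c ord0)^-1 * c (lift ord0 j)).
under eq_bigr do rewrite -scalerA scaleNr; rewrite sumrN opprK -scaler_sumr.
by have := subspZ (c ord0)^-1 sB h; rewrite scalerDr scalerA mulVf // scale1r.
Qed.

Lemma hd_quotD V (Z B : V -> Prop) b c :
    subsp Z -> subsp B -> (forall v, B v -> Z v) -> hd B b -> has_dim_quot Z B c ->
  hd Z (b + c).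
Proof.
move=> sZ sB BZ [v [Bv fv gv]] [u [Zu fu gu]].
exists (fun i => match split i with inl j => v j | inr j => u j end); split.
- by move=> i; case: split => j //; apply: BZ.
- move=> d; rewrite big_split_ord /=.
  under eq_bigr do rewrite (unsplitK (inl _ _)).
  under [X in _ + X]eq_bigr do rewrite (unsplitK (inr _ _)).
  move=> h.
  have du j : d (rshift b j) = 0.
    apply: (fu (fun j => d (rshift b j))); rewrite -[X in B X](addKr (\sum_(i < b) d (lshift c i) *: v i)).
    rewrite h addr0 -[- _]scaleN1r; apply: subspZ => //; apply: subsp_sum => // i _; exact: subspZ.
  move: h; rewrite [X in _ + X]big1 ?addr0; last by move=> j _; rewrite du scale0r.
  move=> /fv dv i; case: (split_ordP i) => j ->; [exact: (dv j) | exact: du].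
move=> z /gu[d /gv[e h]].
exists (fun i => match split i with inl j => e j | inr j => d j end).
rewrite big_split_ord /=.
under eq_bigr do rewrite !(unsplitK (inl _ _)).
under [X in _ - (_ + X)]eq_bigr do rewrite !(unsplitK (inr _ _)).
by rewrite addrC opprD addrAC -addrA addrC.
Qed.

Lemma hd_split V W (f : {linear V -> W}) (Z : V -> Prop) a b :
    subsp Z -> hd (fun z => Z z /\ f z = 0) a ->
    hd (fun w => exists2 z, Z z & f z = w) b ->
  hd Z (a + b).
Proof.
move=> sZ ha [w [Zw fw gw]].
have /fin_all_exists2[u Zu uE] : forall i, exists2 z, Z z & f z = w i by [].
have sK : subsp (fun z => Z z /\ f z = 0).
  split; first by split; [case: sZ | rewrite linear0].
  move=> c x y [Zx fx] [Zy fy]; split; first by apply: sZ.2.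
  by rewrite linearP fx fy scaler0 addr0.
apply: (hd_quotD sZ sK) => //; first by move=> v [].
have fs (c : 'I_b -> k) : f (\sum_i c i *: u i) = \sum_i c i *: w i.
  by rewrite linear_sum; apply: eq_bigr => i _; rewrite linearZ uE.
exists u; split=> // [c [_]|z Zz]; first by rewrite fs; apply: fw.
have [c h] := gw (f z) (ex_intro2 _ _ z Zz erefl); exists c.
split; last by rewrite linearB fs.
by apply: subspB => //; apply: subsp_sum => // i _; apply: subspZ.
Qed.

Lemma hd_vspace (W : vectType k) (U : {vspace W}) : hd (fun w => w \in U) (\dim U).
Proof.
have /andP[/eqP sU fU] := vbasisP U.
exists (fun i => (vbasis U)`_i); split=> [i|c h i|w wU].
- by apply: vbasis_mem; apply: mem_nth; rewrite size_tuple.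
- by move/freeP: fU => /(_ c h).
exists (fun i => coord (vbasis U) i w).
by rewrite -coord_vbasis // subrr.
Qed.

Lemma vspace_of_subsp (W : vectType k) (Z : W -> Prop) :
  subsp Z -> exists U : {vspace W}, forall w, w \in U <-> Z w.
Proof.
move=> sZ; have [|d [u [Zu fu gu]]] := @has_dim_quot_ex W Z (fun w => w \in fullv) _ _
  sZ (subsp0 W) (hd_vspace fullv); first by move=> w _; apply: memvf.
exists <<[tuple u i | i < d]>>%VS => w; split.
  move=> /coord_span ->; apply: subsp_sum => // i _; apply: subspZ => //.
  by rewrite (nth_map i) ?size_enum_ord // nth_ord_enum.
move=> /gu[c /subr0_eq ->]; apply: rpred_sum => i _; apply: rpredZ.
by apply: memv_span; apply/mapP; exists i; rewrite ?mem_enum.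
Qed.

(** The subspaces on which the first few [f m] vanish filter Z, and [f m] maps the successive
    quotients isomorphically to the [G m]. With [f m] the coefficient at m, or the strand of
    multidegree m, this computes dimensions by leading terms. *)
Lemma hd_filtration V (W : vectType k) (M : eqType) (s : seq M)
    (f : M -> {linear V -> W}) (Z : V -> Prop) (G : M -> {vspace W}) :
    uniq s -> subsp Z ->
    (forall z, Z z -> (forall m, m \in s -> f m z = 0) -> z = 0) ->
    (forall m w, m \in s -> w \in G m <->
       exists2 z, Z z & f m z = w /\ forall l, l \in take (index m s) s -> f l z = 0) ->
  hd Z (\sum_(m <- s) \dim (G m)).
Proof.
move=> us sZ s0 GP.
suff gen s1 s2 : s = s1 ++ s2 ->
    hd (fun z => Z z /\ forall l, l \in s1 -> f l z = 0) (\sum_(m <- s2) \dim (G m)).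
  by apply: hd_ext (gen [::] s erefl) => z; split=> [[]|].
elim: s2 s1 => [|m s2 IH] s1 es.
  rewrite big_nil; exists (fun=> 0); split=> [[]|c _ []|z [Zz z0]] //.
  exists (fun=> 0); rewrite big_ord0 subr0; apply: s0 => // m.
  by rewrite es cats0; apply: z0.
rewrite big_cons addnC.
have ms1 : m \notin s1.
  by move: us; rewrite es cat_uniq /= negb_or => /and3P[_ /andP[]].
have tk : take (index m s) s = s1.
  by rewrite es index_cat (negbTE ms1) /= eqxx addn0 take_size_cat.
apply: (@hd_split _ _ (f m)).
- split; first by split; [case: sZ|move=> l _; rewrite linear0].
  move=> c x y [Zx x0] [Zy y0]; split; first exact: sZ.2.
  by move=> l ls; rewrite linearP x0 // y0 // scaler0 addr0.
- apply: hd_ext (IH (rcons s1 m) _) => [z|]; last by rewrite cat_rcons.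
  split=> [[Zz z0]|[[Zz z0] zm]]; last first.
    by split=> // l; rewrite mem_rcons inE => /orP[/eqP->|/z0].
  by split; [split=> // l ls|]; apply: z0; rewrite mem_rcons inE ?eqxx ?ls ?orbT.
apply: hd_ext (hd_vspace (G m)) => w.
have msm : m \in s by rewrite es mem_cat mem_head orbT.
split=> [/(GP m w msm)[z Zz []]|[z [Zz z0] zw]].
  by rewrite tk => zw z0; exists z.
by apply/(GP m w msm); rewrite tk; exists z.
Qed.

End LinearAlgebra.

(** * Monomials and exterior algebra *)

Section MonomialOrder.
Variables (n : nat) (key : 'I_n -> nat).
Hypothesis key_inj : injective key.
Implicit Types u v w : 'X_{1..n}.

(** [key] fixes the order in which exponents are compared, so that the lexicographic order and the
    one comparing last exponents first are two instances. *)
Definition klt u v : bool :=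
  [exists i, (u i < v i)%N && [forall j, (key j < key i)%N ==> (u j == v j)]].

Lemma kltP u v :
  reflect (exists2 i, (u i < v i)%N & forall j, (key j < key i)%N -> u j = v j)
          (klt u v).
Proof.
apply: (iffP existsP) => [[i /andP[lt_i /forallP h]]|[i lt_i h]]; exists i => //.
  by move=> j ji; apply/eqP; have := h j; rewrite ji.
by rewrite lt_i; apply/forallP => j; apply/implyP => /h/eqP.
Qed.

Lemma klt_irr u : klt u u = false.
Proof. by apply/kltP => -[i]; rewrite ltnn. Qed.

Lemma klt_trans : transitive klt.
Proof.
move=> v u w /kltP[i ui hi] /kltP[j vj hj]; apply/kltP.
have [ij|ji|/key_inj e] := ltngtP (key i) (key j).
- exists i; first by rewrite -hj.
  by move=> l li; rewrite hi // hj // (ltn_trans li).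
- exists j; first by rewrite hi.
  by move=> l lj; rewrite hi ?hj // (ltn_trans lj).
subst j; exists i; first exact: ltn_trans vj.
by move=> l li; rewrite hi ?hj.
Qed.

Lemma klt_total u v : u != v -> klt u v || klt v u.
Proof.
move=> ne; have [i0 ne0] : exists i, u i != v i.
  apply/existsP; apply: contraNT ne; rewrite negb_exists => /forallP h.
  by apply/eqP/mnmP => i; apply/eqP; have := h i; rewrite negbK.
case: (@arg_minnP _ i0 (fun i => u i != v i) key ne0) => i nei mini.
have h j : (key j < key i)%N -> u j = v j.
  by move=> ji; apply/eqP; apply: contraLR ji => /mini; rewrite -leqNgt.
have [lt|gt|e] := ltngtP (u i) (v i); last by rewrite e eqxx in nei.
  by apply/orP; left; apply/kltP; exists i.
by apply/orP; right; apply/kltP; exists i => // j /h.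
Qed.

Lemma klt_asym u v : klt u v -> klt v u = false.
Proof. by move=> uv; apply/negbTE/negP => vu; have := klt_trans uv vu; rewrite klt_irr. Qed.

Lemma kltD2r w u v : klt (u + w)%MM (v + w)%MM = klt u v.
Proof.
apply/kltP/kltP => -[i lti h]; exists i.
- by move: lti; rewrite !mnmDE ltn_add2r.
- by move=> j /h/eqP; rewrite !mnmDE eqn_add2r => /eqP.
- by rewrite !mnmDE ltn_add2r.
- by move=> j /h; rewrite !mnmDE => ->.
Qed.

Definition kle u v := (u == v) || klt u v.

Lemma kle_total : total kle.
Proof. by move=> u v; rewrite /kle; case: eqVneq => //= /klt_total; rewrite orbC. Qed.

Lemma kle_trans : transitive kle.
Proof.
rewrite /kle => v u w /predU1P[->//|uv] /predU1P[<-|vw]; first by rewrite uv orbT.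
by rewrite (klt_trans uv vw) orbT.
Qed.

(** Translates the list prefixes of [hd_filtration] into the order condition in the definition of
    initial monomials. *)
Lemma mem_take_sort_klt (s : seq 'X_{1..n}) u v : uniq s -> v \in s ->
  (u \in take (index v (sort kle s)) (sort kle s)) = (u \in s) && klt u v.
Proof.
move=> us vs; set t := sort kle s.
have ut : uniq t by rewrite sort_uniq.
have vt : v \in t by rewrite mem_sort.
rewrite -[u \in s](mem_sort kle) -/t.
have pt : pairwise kle t.
  by rewrite -sorted_pairwise ?sort_sorted; [|exact: kle_total|exact: kle_trans].
set t1 := take _ t; set t2 := drop (index v t).+1 t.
have et : t = t1 ++ v :: t2.
  by rewrite -{1}(cat_take_drop (index v t) t) (drop_nth v) ?index_mem // nth_index.
move: pt ut; rewrite et pairwise_cat cat_uniq mem_cat inE /=.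
move=> /and3P[/allrelP hl _ /andP[/allP hr _]] /and3P[_].
rewrite negb_or => /andP[nv _] /andP[nv2 _].
apply/idP/andP => [ut1|[/or3P[//|/eqP->|/hr]]].
- rewrite ut1; split=> //; have /orP[/eqP e|//] := hl _ _ ut1 (mem_head _ _).
  by rewrite e (negbTE nv) in ut1.
- by rewrite klt_irr.
by case/orP => [/eqP<-|/klt_asym->]; rewrite ?klt_irr.
Qed.

End MonomialOrder.

Section Monomials.
Variable n : nat.
Implicit Types (u v w m : 'X_{1..n}) (i j l : 'I_n) (T : {set 'I_n}) (p d : nat).

(* [llt] is the lexicographic order; [rlt] compares the last exponents first, and
   initial terms below are the minimal ones for [rlt]. *)
Definition llt : rel 'X_{1..n} := klt val.
Definition rlt : rel 'X_{1..n} := klt (fun i : 'I_n => (n - i)%N).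

Lemma rkey_inj : injective (fun i : 'I_n => (n - i)%N).
Proof.
move=> i j /eqP; rewrite -(eqn_add2r (i + j)) addnA subnK 1?ltnW //.
by rewrite [(i + j)%N]addnC addnA subnK 1?ltnW // eqn_add2l => /eqP/val_inj.
Qed.

Lemma rltP u v :
  reflect (exists2 i, (u i < v i)%N & forall j, (i < j)%N -> u j = v j) (rlt u v).
Proof.
apply: (iffP (kltP _ _ _)) => -[i lti h]; exists i => // j ij; apply: h.
  by rewrite ltn_sub2l // (ltn_trans ij).
by move: ij; rewrite ltnNge => ij; rewrite ltnNge; apply: contra ij => /leq_sub2l->.
Qed.

(* The polynomial ring in the first p variables is not a separate type: p-variable
   notions are obtained by restricting to the monomials satisfying [Mon p]. *)
Definition Mon p u : bool := [forall l : 'I_n, (p <= l)%N ==> (u l == 0%N)].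

Lemma MonP p u : reflect (forall l : 'I_n, (p <= l)%N -> u l = 0%N) (Mon p u).
Proof.
by apply: (iffP forallP) => h l; [move=> pl; apply/eqP; have := h l; rewrite pl|
  apply/implyP => /h/eqP].
Qed.

Lemma MonD p u v : Mon p (u + v)%MM = Mon p u && Mon p v.
Proof.
apply/MonP/andP => [h|[/MonP hu /MonP hv] l pl]; last by rewrite mnmDE hu ?hv.
by split; apply/MonP => l /h/eqP; rewrite mnmDE addn_eq0 => /andP[/eqP? /eqP?].
Qed.

Lemma Mon1 p i : Mon p U_(i)%MM = (i < p)%N.
Proof.
apply/MonP/idP => [h|ip l pl]; last first.
  by rewrite mnm1E; case: eqVneq => // e; move: ip; rewrite e ltnNge pl.
by rewrite ltnNge; apply/negP => /h; rewrite mnm1E eqxx.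
Qed.

Lemma Mon_full u : Mon n u.
Proof. by apply/MonP => l; rewrite leqNgt ltn_ord. Qed.

Definition mons p d : seq 'X_{1..n} :=
  sort (kle (fun i : 'I_n => (n - i)%N))
    [seq m <- map val (enum {: 'X_{1..n < d.+1}}) | (mdeg m == d) && Mon p m].

Lemma mons_uniq p d : uniq (mons p d).
Proof. by rewrite sort_uniq filter_uniq // map_inj_uniq ?enum_uniq //; apply: val_inj. Qed.

Lemma mem_mons p d m : (m \in mons p d) = (mdeg m == d) && Mon p m.
Proof.
rewrite mem_sort mem_filter andb_idr // => /andP[/eqP dm _].
have lt_m : (mdeg m < d.+1)%N by rewrite dm.
by apply/mapP; exists (BMultinom lt_m); rewrite ?mem_enum.
Qed.

Lemma mem_take_mons p d u m : m \in mons p d ->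
  (u \in take (index m (mons p d)) (mons p d)) = (u \in mons p d) && rlt u m.
Proof.
rewrite /mons mem_sort => mp; rewrite [in RHS]mem_sort.
apply: mem_take_sort_klt => //; first exact: rkey_inj.
by rewrite filter_uniq // map_inj_uniq ?enum_uniq //; apply: val_inj.
Qed.

Definition mset T : 'X_{1..n} := [multinom (i \in T : nat) | i < n].

Lemma msetE T i : mset T i = (i \in T).
Proof. by rewrite mnmE. Qed.

Lemma mdeg_mset T : mdeg (mset T) = #|T|.
Proof.
rewrite mdegE -sum1_card [RHS]big_mkcond; apply: eq_bigr => i _.
by rewrite msetE; case: (i \in T).
Qed.

Lemma msetU1 T j : j \notin T -> mset (j |: T) = (U_(j) + mset T)%MM.
Proof.
move=> jT; apply/mnmP => i; rewrite mnmDE !msetE mnm1E !inE eq_sym.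
by case: eqVneq => // <-; rewrite (negbTE jT).
Qed.

Lemma subkU1 m T j : j \notin T -> (m - mset (j |: T) = m - mset T - U_(j))%MM.
Proof. by move=> jT; rewrite msetU1 // addmC submDA. Qed.

Lemma lem_msetP m T : reflect (forall i, i \in T -> (0 < m i)%N) (mset T <= m)%MM.
Proof.
apply: (iffP mnm_lepP) => h i; first by move=> iT; have := h i; rewrite msetE iT.
by rewrite msetE; case: (boolP (i \in T)) => // /h.
Qed.

Lemma lem_msetU1 m T j : j \notin T ->
  (mset (j |: T) <= m)%MM = (mset T <= m)%MM && (0 < (m - mset T)%MM j)%N.
Proof.
move=> jT; rewrite mnmBE msetE (negbTE jT) subn0.
apply/lem_msetP/andP => [h|[/lem_msetP h mj] i /setU1P[->//|/h//]].
by split; [apply/lem_msetP => i iT|]; apply: h; rewrite !inE ?eqxx ?iT ?orbT.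
Qed.

Definition sgn (j : 'I_n) T : nat := koszul_sign j T.

Lemma sgnU1 j l T : l \notin T -> sgn j (l |: T) = ((l < j) + sgn j T)%N.
Proof.
move=> lT; rewrite /sgn /koszul_sign (cardsD1 l) !inE eqxx /=; congr (_ + _)%N.
apply: eq_card => t; rewrite !inE; case: (eqVneq t l) => [->|//].
by rewrite (negbTE lT).
Qed.

Lemma sgnD1 j l T : l \in T -> sgn j T = ((l < j) + sgn j (T :\ l))%N.
Proof. by move=> lT; rewrite -{1}(setD1K lT) sgnU1 // setD11. Qed.

End Monomials.

Section Contractions.
Variables (n : nat) (k : fieldType) (V : lmodType k).
Implicit Types (w : {ffun {set 'I_n} -> V}) (j l : 'I_n) (T : {set 'I_n}).

(* A family indexed by subsets of the variables is an element of an exterior algebra;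
   [pd j] and [ex j] are contraction with and exterior product by its j-th generator. *)
Definition pd j w : {ffun {set 'I_n} -> V} :=
  [ffun T : {set 'I_n} => if j \in T then 0 else (-1) ^+ sgn j T *: w (j |: T)].
Definition ex j w : {ffun {set 'I_n} -> V} :=
  [ffun T : {set 'I_n} => if j \in T then (-1) ^+ sgn j T *: w (T :\ j) else 0].

Lemma pd_is_linear j : linear (pd j).
Proof.
move=> a u v; apply/ffunP => T; rewrite !ffunE; case: ifP => _.
  by rewrite scaler0 addr0.
by rewrite scalerDr !scalerA mulrC.
Qed.
HB.instance Definition _ j := GRing.isLinear.Build k _ _ _ (pd j) (pd_is_linear j).

Lemma ex_is_linear j : linear (ex j).
Proof.
move=> a u v; apply/ffunP => T; rewrite !ffunE; case: ifP => _.
  by rewrite scalerDr !scalerA mulrC.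
by rewrite scaler0 addr0.
Qed.
HB.instance Definition _ j := GRing.isLinear.Build k _ _ _ (ex j) (ex_is_linear j).

Lemma pd_pd_same j w : pd j (pd j w) = 0.
Proof.
apply/ffunP => T; rewrite !ffunE; case: ifP => // _.
by rewrite setU11 scaler0.
Qed.

Lemma ex_ex_same j w : ex j (ex j w) = 0.
Proof.
apply/ffunP => T; rewrite !ffunE; case: ifP => // _.
by rewrite setD11 scaler0.
Qed.

Lemma signC (a b : nat) : odd a != odd b -> (-1) ^+ a = - (-1) ^+ b :> k.
Proof.
by rewrite -[a in LHS]odd_double_half -signr_odd -[(-1) ^+ b]signr_odd odd_double_half;
  case: (odd a); case: (odd b); rewrite //= ?opprK.
Qed.

Lemma ltn_ordC j l : j != l -> (j < l)%N = ~~ (l < j)%N.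
Proof. by rewrite -(inj_eq val_inj) /=; case: ltngtP. Qed.

Lemma pd_pd j l w : j != l -> pd j (pd l w) = - pd l (pd j w).
Proof.
move=> jl; apply/ffunP => T; rewrite !ffunE !inE [l == j]eq_sym (negbTE jl) /=.
case: (boolP (j \in T)) => jT; case: (boolP (l \in T)) => lT; rewrite ?scaler0 ?oppr0 //.
rewrite !scalerA setUCA -scaleNr; congr (_ *: _).
rewrite -!exprD !sgnU1 //; apply: signC.
rewrite (ltn_ordC jl) !oddD; case: (l < j)%N => /=; rewrite ?addTb ?addFb.
  by rewrite addbN addbC; case: (_ (+) _).
by rewrite addbN addbC; case: (_ (+) _).
Qed.

Lemma pd_ex_same j w : pd j (ex j w) + ex j (pd j w) = w.
Proof.
apply/ffunP => T; rewrite !ffunE; case: (boolP (j \in T)) => jT.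
  rewrite !inE eqxx /= setD1K // add0r scalerA (sgnD1 j jT) ltnn add0n.
  by rewrite -expr2 sqrr_sign scale1r.
by rewrite setU11 setU1K // addr0 scalerA sgnU1 // ltnn add0n -expr2 sqrr_sign scale1r.
Qed.

Lemma pd_ex j l w : j != l -> pd j (ex l w) = - ex l (pd j w).
Proof.
move=> jl; apply/ffunP => T; rewrite !ffunE !inE [l == j]eq_sym (negbTE jl) /=.
case: (boolP (j \in T)) => jT; case: (boolP (l \in T)) => lT;
  rewrite ?scaler0 ?oppr0 ?andbF ?jl ?jT ?scaler0 ?oppr0 //=.
have -> : (j |: T) :\ l = j |: (T :\ l).
  by apply/setP => t; rewrite !inE; case: (eqVneq t j) => [->|_]; rewrite ?jl.
rewrite !scalerA -scaleNr; congr (_ *: _).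
rewrite -!exprD sgnU1 // (sgnD1 j lT); apply: signC.
by rewrite (ltn_ordC jl) !oddD; case: (l < j)%N => /=; case: (odd (sgn l T)); case: (odd _).
Qed.

End Contractions.

Definition asb (P : Prop) : bool := if excluded_middle_informative P then true else false.

Lemma asbP (P : Prop) : reflect P (asb P).
Proof. by rewrite /asb; case: excluded_middle_informative => h; constructor. Qed.

(** * Ranks of Koszul differentials *)

Section CoordinateSpaces.
Variables (n : nat) (K : fieldType).
Local Notation W1 := {ffun {set 'I_n} -> K^o}.
Implicit Types (w : W1) (T : {set 'I_n}) (F : {set {set 'I_n}}).

Definition restr F w : W1 := [ffun T => if T \in F then w T else 0].

Lemma restr_is_linear F : linear (restr F).
Proof.
move=> a u v; apply/ffunP => T; rewrite !ffunE; case: ifP => _ //.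
by rewrite scaler0 addr0.
Qed.
HB.instance Definition _ F := GRing.isLinear.Build K _ _ _ (restr F) (restr_is_linear F).

Definition coordsp F : {vspace W1} := lker (linfun (restr (~: F))).

Lemma coordspP F w : reflect (forall T, T \notin F -> w T = 0) (w \in coordsp F).
Proof.
rewrite memv_ker lfunE /=; apply: (iffP eqP) => [/ffunP e T TF|e].
  by have := e T; rewrite !ffunE inE TF.
by apply/ffunP => T; rewrite !ffunE inE; case: ifP => // /e.
Qed.

Definition delta_ffun T : W1 := [ffun T' => (T' == T)%:R].

Lemma ffun_sum_delta F w : w \in coordsp F ->
  w = \sum_(T in F) w T *: delta_ffun T.
Proof.
move=> /coordspP wF; apply/ffunP => T; rewrite sum_ffunE.
have [TF|TF] := boolP (T \in F); last first.
  rewrite wF // big1 // => T' T'F; rewrite !ffunE; case: eqVneq => [e|_].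
    by rewrite e T'F in TF.
  by rewrite scaler0.
rewrite (bigD1 T) //= !ffunE eqxx big1 ?addr0; first by rewrite -[LHS]mulr1.
by move=> T' /andP[_ ne]; rewrite !ffunE eq_sym (negbTE ne) scaler0.
Qed.

Lemma delta_coordsp F T : (delta_ffun T \in coordsp F) = (T \in F).
Proof.
apply/coordspP/idP => [h|TF T' T'F]; last first.
  by rewrite ffunE; case: eqVneq => // e; rewrite e TF in T'F.
by apply: contraT => /h; rewrite ffunE eqxx => /eqP; rewrite oner_eq0.
Qed.

Lemma dim_coordsp F : \dim (coordsp F) = #|F|.
Proof.
apply: (hd_uniq (hd_vspace _)).
exists (fun i : 'I_#|F| => delta_ffun (enum_val i)); split=> [i|c h i|w wF].
- by rewrite delta_coordsp enum_valP.
- move/ffunP: h => /(_ (enum_val i)); rewrite sum_ffunE (bigD1 i) //= !ffunE eqxx.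
  rewrite big1 ?addr0; first by move=> <-; rewrite -[LHS]mulr1.
  by move=> l li; rewrite !ffunE (inj_eq enum_val_inj) eq_sym (negbTE li) scaler0.
exists (fun i => w (enum_val i)); apply/eqP; rewrite subr_eq0; apply/eqP.
by rewrite {1}(ffun_sum_delta wF) big_enum_val.
Qed.

Lemma coordspS F F' : F \subset F' -> (coordsp F <= coordsp F')%VS.
Proof.
move=> /subsetP sF; apply/subvP => w /coordspP wF; apply/coordspP => T TF.
by apply: wF; apply: contra TF => /sF.
Qed.

(** The boundary map of the full simplex on the variables, with the empty face included. In each
    multidegree the Koszul differential takes this form, see [strand_dK]. *)
Definition bd w : W1 := \sum_j pd j w.

Lemma bd_is_linear : linear bd.
Proof.
move=> a u v; rewrite /bd scaler_sumr -big_split /=.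
by refine (eq_bigr _ _) => j _; rewrite linearP.
Qed.
HB.instance Definition _ := GRing.isLinear.Build K _ _ _ bd bd_is_linear.

Lemma bdE w T : bd w T = \sum_(j | j \notin T) (-1) ^+ sgn j T *: w (j |: T).
Proof.
rewrite sum_ffunE [RHS]big_mkcond; apply: eq_bigr => j _.
by rewrite ffunE; case: (j \in T).
Qed.

Definition rho F : nat := \dim (linfun bd @: coordsp F).

Lemma rhoS F F' : F \subset F' -> (rho F <= rho F')%N.
Proof. by move=> sF; apply/dimvS/limgS/coordspS. Qed.

End CoordinateSpaces.

Section Chains.
Variables (n : nat) (K : fieldType).
Local Notation S := {mpoly K[n]}.
Local Notation W1 := {ffun {set 'I_n} -> K^o}.
Local Notation Kz := {ffun {set 'I_n} -> S}.
Implicit Types (c : Kz) (T : {set 'I_n}) (u v m l : 'X_{1..n}) (f g : S)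
  (I : S -> Prop) (A : pred 'X_{1..n}) (p d : nat).

Lemma mcoeff_Xmul (j : 'I_n) f m :
  ('X_j * f)@_m = if (0 < m j)%N then f@_(m - U_(j))%MM else 0.
Proof.
rewrite -commr_mpolyX; case: ifPn => h.
  have {1}-> : m = (U_(j) + (m - U_(j)))%MM.
    by rewrite addmC submK // lep1mP -lt0n.
  by rewrite mcoeffMX.
apply/eqP; rewrite mcoeff_eq0 (perm_mem (msuppMX _ _)).
by apply/mapP => -[m' _ e]; move: h; rewrite e mnmDE mnm1E eqxx add1n.
Qed.

Definition Xmul (j : 'I_n) c : Kz := [ffun T => 'X_j * c T].

Lemma Xmul_is_linear j : linear (Xmul j).
Proof. by move=> a u v; apply/ffunP => T; rewrite !ffunE mulrDr scalerAr. Qed.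
HB.instance Definition _ j := GRing.isLinear.Build K _ _ _ (Xmul j) (Xmul_is_linear j).

Definition dK c : Kz := \sum_j pd j (Xmul j c).

Lemma dK_is_linear : linear dK.
Proof.
move=> a u v; rewrite /dK scaler_sumr -big_split /=.
by refine (eq_bigr _ _) => j _; rewrite !linearP.
Qed.
HB.instance Definition _ := GRing.isLinear.Build K _ _ _ dK dK_is_linear.

Lemma dKE c T : dK c T = \sum_(j | j \notin T) (-1) ^+ sgn j T *: ('X_j * c (j |: T)).
Proof.
rewrite sum_ffunE [RHS]big_mkcond; apply: eq_bigr => j _.
by rewrite !ffunE; case: (j \in T).
Qed.

(** The Koszul complex is graded by monomials, x^u e_T having degree u + T. *)
Definition strand m c : W1 :=
  [ffun T => if (mset T <= m)%MM then (c T)@_(m - mset T) else 0].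

Lemma strand_is_linear m : linear (strand m).
Proof.
move=> a u v; apply/ffunP => T; rewrite !ffunE; case: ifP => _.
  by rewrite mcoeffD mcoeffZ.
by rewrite scaler0 addr0.
Qed.
HB.instance Definition _ m := GRing.isLinear.Build K _ _ _ (strand m) (strand_is_linear m).

Lemma strand_dK m c : strand m (dK c) = bd (strand m c).
Proof.
apply/ffunP => T; rewrite !ffunE bdE dKE; case: ifPn => h; last first.
  rewrite big1 // => j jT; rewrite ffunE lem_msetU1 // (negbTE h) /=.
  by rewrite scaler0.
rewrite raddf_sum; apply: eq_bigr => j jT /=.
by rewrite mcoeffZ mcoeff_Xmul !ffunE lem_msetU1 // h /= subkU1.
Qed.

Definition ch p I i j c : Prop :=
  (forall T, I (c T)) /\
  forall T u, (c T)@_u != 0 -> #|T| = i /\ (u + mset T)%MM \in mons n p j.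

(** Among monomials of one degree, being minimal for [rlt] means being the largest for the reverse
    lexicographic order. So the last variable has the least exponent in an initial monomial, as the
    slicing by the last variable requires. *)
Definition initial p I : pred 'X_{1..n} := fun u => asb (exists2 g, I g /\ g@_u != 0 &
  forall v, g@_v != 0 -> v \in mons n p (mdeg u) /\ (v == u) || rlt u v).

(* The squarefree parts of the degree-m strand of the Koszul complex of a monomial ideal
   with monomials A: the basis vector x^(m - T) e_T is recorded as T. *)
Definition fam i A m : {set {set 'I_n}} :=
  [set T : {set 'I_n} | [&& #|T| == i, (mset T <= m)%MM & A (m - mset T)%MM]].

(** The rank of the Koszul differential on the monomial ideal of A, in homological degree i and
    internal degree j, collected from the multidegrees; see [hd_im_dK_mono]. *)
Definition rk p i A j : nat := (\sum_(m <- mons n p j) rho K (fam i A m))%N.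

Definition cfam p i A j : nat := (\sum_(m <- mons n p j) #|fam i A m|)%N.

Lemma subsp_ch p I i j : subsp I -> subsp (ch p I i j).
Proof.
move=> sI; split.
  by split=> [T|T u]; rewrite ffunE ?mcoeff0 ?eqxx //; case: sI.
move=> a x y [Ix xS] [Iy yS]; split=> T; first by rewrite !ffunE; apply: sI.2.
move=> u; rewrite !ffunE mcoeffD mcoeffZ => h.
have [y0|/yS//] := eqVneq ((y T)@_u) 0; apply: xS.
by apply: contraNneq h => ->; rewrite mulr0 y0 addr0.
Qed.

Lemma strand_inj p j c :
    (forall T u, (c T)@_u != 0 -> (u + mset T)%MM \in mons n p j) ->
    (forall m, m \in mons n p j -> strand m c = 0) ->
  c = 0.
Proof.
move=> cS c0; apply/ffunP => T; rewrite ffunE; apply/mpolyP => u; rewrite mcoeff0.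
apply/eqP/negPn/negP => nz; have /c0/ffunP/(_ T) := cS _ _ nz.
by rewrite !ffunE lem_addl addmK => /eqP; rewrite (negbTE nz).
Qed.

Lemma rltD2r w u v : rlt (u + w)%MM (v + w)%MM = rlt u v.
Proof. exact: kltD2r. Qed.
Lemma rlt_irr u : rlt u u = false. Proof. exact: klt_irr. Qed.
Lemma rlt_asym u v : rlt u v -> rlt v u = false.
Proof. by apply: klt_asym; apply: rkey_inj. Qed.
Lemma rlt_total u v : u != v -> rlt u v || rlt v u.
Proof. by apply: klt_total. Qed.

Lemma mons_addmset p j u T : (u + mset T)%MM \in mons n p j ->
  (u \in mons n p (mdeg u)) /\ (mdeg u + #|T|)%N = j.
Proof.
rewrite !mem_mons mdegD mdeg_mset MonD eqxx => /andP[/eqP -> /andP[-> _]].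
by [].
Qed.

(** A chain with prescribed leading strand w is assembled from one element of I for each T,
    normalised to have leading coefficient 1 and scaled by [w T]. *)
Lemma fam_initialP p I i j m w : subsp I -> m \in mons n p j ->
  w \in coordsp K (fam i (initial p I) m) <->
  exists2 c, ch p I i j c &
    strand m c = w /\ forall l, l \in take (index m (mons n p j)) (mons n p j) -> strand l c = 0.
Proof.
move=> sI mp; have := mp; rewrite mem_mons => /andP[/eqP dm Mm]; split; last first.
  case=> c [Ic cS] [<- c0]; apply/coordspP => T; apply: contraNeq; rewrite !ffunE inE.
  case: ifP => [le_Tm nz|_]; last by rewrite eqxx.
  have [cT _] := cS _ _ nz; rewrite cT eqxx /=; apply/asbP; exists (c T) => // v nv.
  have [_ vp] := cS _ _ nv; have [vm dv] := mons_addmset vp.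
  have [_] := cS _ _ nz; rewrite submK // => _.
  have dmT : (mdeg (m - mset T) + #|T|)%N = mdeg m by rewrite -mdeg_mset -mdegD submK.
  have -> : mdeg (m - mset T) = mdeg v.
    by apply/eqP; rewrite -(eqn_add2r #|T|) dmT dv dm.
  split=> //; rewrite -(eqm_add2r (mset T)) -(rltD2r (mset T)) submK //.
  have [//|ne] := eqVneq (v + mset T)%MM m.
  have /orP[lt|//] := rlt_total ne.
  have := c0 (v + mset T)%MM; rewrite mem_take_mons // vp lt => /(_ isT)/ffunP/(_ T).
  by rewrite !ffunE lem_addl addmK => /eqP; rewrite (negbTE nv).
move=> /coordspP wF.
have /fin_all_exists[g gP] : forall T, exists g : S, T \in fam i (initial p I) m ->
    [/\ I g, g@_(m - mset T) = 1 & forall v, g@_v != 0 ->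
       v \in mons n p (mdeg (m - mset T)) /\ (v == m - mset T)%MM || rlt (m - mset T)%MM v].
  move=> T; case: (boolP (T \in _)) => [|_]; last by exists 0.
  rewrite inE => /and3P[_ _ /asbP[g [Ig nz] gS]].
  exists ((g@_(m - mset T))^-1 *: g) => _; split; first exact: subspZ.
    by rewrite mcoeffZ mulVf.
  by move=> v; rewrite mcoeffZ mulf_eq0 negb_or => /andP[_ /gS].
exists [ffun T => w T *: g T].
  split=> [T|T u]; rewrite ffunE.
    have [/gP[Ig _ _]|/wF ->] := boolP (T \in fam i (initial p I) m); first exact: subspZ.
    by rewrite scale0r; case: sI.
  rewrite mcoeffZ mulf_eq0 negb_or => /andP[wT gu].
  have TF : T \in fam i (initial p I) m by apply: contraNT wT => /wF ->.
  have [_ _ /(_ u gu)[um _]] := gP T TF.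
  move: TF; rewrite inE => /and3P[/eqP cT le_Tm _]; split=> //.
  move: um; rewrite !mem_mons mdegD => /andP[/eqP -> Mu].
  rewrite -mdegD submK // dm eqxx MonD Mu /=.
  by move: Mm; rewrite -(submK le_Tm) MonD => /andP[].
split.
  apply/ffunP => T; rewrite !ffunE mcoeffZ.
  have [TF|/wF ->] := boolP (T \in fam i (initial p I) m); last by rewrite mul0r if_same.
  have [_ -> _] := gP T TF; move: TF; rewrite inE => /and3P[_ -> _]; exact: mulr1.
move=> l; rewrite mem_take_mons // => /andP[_ lm].
apply/ffunP => T; rewrite !ffunE mcoeffZ.
have [TF|/wF ->] := boolP (T \in fam i (initial p I) m); last by rewrite mul0r if_same.
case: ifP => // le_Tl; have [_ _ gS] := gP T TF.
have [->|nz] := eqVneq (g T)@_(l - mset T) 0; first by rewrite mulr0.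
move: TF; rewrite inE => /and3P[_ le_Tm _].
have [_] := gS _ nz; rewrite -(eqm_add2r (mset T)) -(rltD2r (mset T)) !submK //.
by rewrite (rlt_asym lm) orbF => /eqP e; rewrite e rlt_irr in lm.
Qed.

Lemma hd_ch p I i j : subsp I -> hd (ch p I i j) (cfam p i (initial p I) j).
Proof.
move=> sI; rewrite /cfam.
rewrite (eq_bigr (fun m => \dim (coordsp K (fam i (initial p I) m)))); last first.
  by move=> m _; rewrite dim_coordsp.
apply: (@hd_filtration _ _ _ _ _ strand) => [||c [_ cS]|m w mp].
- exact: mons_uniq.
- exact: subsp_ch.
- by apply: strand_inj => T u /cS[].
exact: fam_initialP.
Qed.

Definition im_dK p I i j : Kz -> Prop := fun z => exists2 c, ch p I i j c & dK c = z.

Lemma subsp_im_dK p I i j : subsp I -> subsp (im_dK p I i j).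
Proof.
move=> /(subsp_ch p i j)[Z0 ZL]; split; first by exists 0; rewrite ?linear0.
by move=> a x y [c hc <-] [e he <-]; exists (a *: c + e); [apply: ZL|rewrite linearP].
Qed.

Lemma im_dK_supp p I i j z T u :
  im_dK p I i j z -> (z T)@_u != 0 -> #|T|.+1 = i /\ (u + mset T)%MM \in mons n p j.
Proof.
case=> c [_ cS] <-; rewrite dKE raddf_sum /= => nz.
have [l lT] : exists2 l : 'I_n, l \notin T & ('X_l * c (l |: T))@_u != 0.
  apply/exists_inP; apply: contraNT nz; rewrite negb_exists_in => /forall_inP h.
  by rewrite big1 // => l /h; rewrite negbK mcoeffZ => /eqP ->; rewrite mulr0.
rewrite mcoeff_Xmul; case: ifP => [ul|_]; last by rewrite eqxx.
move=> /cS[]; rewrite cardsU1 lT add1n => ->; split=> //.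
by move: b; rewrite msetU1 // addmA submK // lep1mP -lt0n.
Qed.

(** If the chain c has leading strand w in multidegree m, then [dK c] vanishes before m and has
    strand [bd w] there. So the spaces [G m] of leading strands of boundaries contain the boundaries
    of leading strands, possibly strictly. *)
Lemma hd_im_dK p I i j : subsp I ->
  exists2 r, hd (im_dK p I i j) r & (rk p i (initial p I) j <= r)%N.
Proof.
move=> sI; have sZ := subsp_im_dK p i j sI.
pose t m := take (index m (mons n p j)) (mons n p j).
have h m : exists U : {vspace W1}, forall w, w \in U <-> exists2 z, im_dK p I i j z &
    strand m z = w /\ forall l, l \in t m -> strand l z = 0.
  apply: vspace_of_subsp; split; first by exists 0; [case: sZ | rewrite linear0; split=> // l _; rewrite linear0].
  move=> a x y [z Zz [zx z0]] [z' Zz' [zx' z0']]; exists (a *: z + z'); first exact: sZ.2.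
  split=> [|l lt]; first by rewrite linearP /= zx zx'.
  by rewrite linearP /= z0 // z0' // scaler0 addr0.
have [G GP] : exists G : 'X_{1..n} -> {vspace W1}, forall m w, w \in G m <->
    exists2 z, im_dK p I i j z & strand m z = w /\ forall l, l \in t m -> strand l z = 0.
  exists (fun m => projT1 (constructive_indefinite_description _ (h m))) => m.
  by case: constructive_indefinite_description.
exists (\sum_(m <- mons n p j) \dim (G m))%N.
  apply: (@hd_filtration _ _ _ _ _ strand) => [||z Zz|m w mp]; last exact: GP.
  - exact: mons_uniq.
  - exact: sZ.
  by apply: strand_inj => T u /(im_dK_supp Zz)[].
rewrite /rk big_seq [leqRHS]big_seq; apply: leq_sum => m mp; apply: dimvS.
apply/subvP => _ /memv_imgP[w wF ->]; rewrite lfunE /=.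
have /(_ wF)[c Zc [<- c0]] := (fam_initialP i w sI mp).1.
apply/GP; exists (dK c); first by exists c.
by rewrite strand_dK; split=> // l /c0 cl; rewrite strand_dK cl linear0.
Qed.

Definition mono_sp p A : S -> Prop := fun f => forall u, f@_u != 0 -> Mon p u && A u.

Lemma subsp_mono p A : subsp (mono_sp p A).
Proof.
split=> [u|a f g hf hg u]; first by rewrite mcoeff0 eqxx.
rewrite mcoeffD mcoeffZ; have [-> nz|/hg//] := eqVneq (g@_u) 0.
by apply: hf; apply: contraNneq nz => ->; rewrite mulr0 addr0.
Qed.

Lemma initial_mono p A u : Mon p u -> initial p (mono_sp p A) u = A u.
Proof.
move=> Mu; apply/asbP/idP => [[g [gA /gA/andP[]]] //|Au].
exists 'X_[u].
  split; last by rewrite mcoeffX eqxx oner_neq0.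
  by move=> v; rewrite mcoeffX; case: (eqVneq u v) => [<-|_]; rewrite ?eqxx // Mu.
move=> v; rewrite mcoeffX; case: (eqVneq u v) => [<-|_]; rewrite ?eqxx // => _.
by rewrite mem_mons eqxx.
Qed.

Lemma eq_fam p A A' i m : Mon p m -> (forall u, Mon p u -> (mdeg u + i)%N = mdeg m -> A u = A' u) ->
  fam i A m = fam i A' m.
Proof.
move=> Mm e; apply/setP => T; rewrite !inE; case: eqVneq => //= cT.
case: (boolP (mset T <= m)%MM) => //= le_Tm; apply: e.
  by move: Mm; rewrite -{1}(submK le_Tm) MonD => /andP[].
by rewrite -cT -mdeg_mset -mdegD submK.
Qed.

Lemma eq_rk p A A' i j : (forall u, Mon p u -> (mdeg u + i)%N = j -> A u = A' u) ->
  rk p i A j = rk p i A' j.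
Proof.
move=> e; rewrite /rk big_seq [RHS]big_seq; apply: eq_bigr => m.
rewrite mem_mons => /andP[/eqP dm Mm]; congr rho; apply: (eq_fam Mm) => u Mu du.
by apply: e; rewrite // -dm.
Qed.

Lemma eq_cfam p A A' i j : (forall u, Mon p u -> (mdeg u + i)%N = j -> A u = A' u) ->
  cfam p i A j = cfam p i A' j.
Proof.
move=> e; rewrite /cfam big_seq [RHS]big_seq; apply: eq_bigr => m.
rewrite mem_mons => /andP[/eqP dm Mm]; rewrite (eq_fam Mm (A' := A')) // => u Mu du.
by apply: e; rewrite // -dm.
Qed.

(** Here equality holds: each strand of a chain of a monomial ideal is supported on [fam i A m],
    whether it is leading or not. *)
Lemma hd_im_dK_mono p A i j : hd (im_dK p (mono_sp p A) i j) (rk p i A j).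
Proof.
have sI := subsp_mono p A.
have sZ := subsp_im_dK p i j sI.
apply: (@hd_filtration _ _ _ _ _ strand _ (fun m => linfun (bd (K:=K)) @: coordsp K (fam i A m))%VS)
   => [||z Zz|m w mp].
- exact: mons_uniq.
- exact: sZ.
- by apply: strand_inj => T u /(im_dK_supp Zz)[].
have Mm : Mon p m by move: mp; rewrite mem_mons => /andP[].
split.
  have -> : fam i A m = fam i (initial p (mono_sp p A)) m.
    by apply: (eq_fam Mm) => u Mu _; rewrite initial_mono.
  move=> /memv_imgP[w' wF ->]; rewrite lfunE /=.
  have /(_ wF)[c Zc [<- c0]] := (fam_initialP i w' sI mp).1.
  exists (dK c); first by exists c.
  by rewrite strand_dK; split=> // l /c0 cl; rewrite strand_dK cl linear0.
case=> _ [c [cA cS] <-] [<- _]; rewrite /= strand_dK.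
apply/memv_imgP; exists (strand m c); last by rewrite lfunE.
apply/coordspP => T; apply: contraNeq; rewrite !ffunE inE.
case: ifP => [le_Tm nz|_]; last by rewrite eqxx.
by have [-> _] := cS _ _ nz; have /andP[_ ->] := cA _ _ nz; rewrite eqxx.
Qed.

End Chains.

(** * Betti numbers in terms of ranks of Koszul differentials *)

Section KoszulBetti.
Variables (n : nat) (K : fieldType).
Local Notation S := {mpoly K[n]}.
Local Notation Kz := {ffun {set 'I_n} -> S}.
Implicit Types (c : Kz) (T : {set 'I_n}) (I : S -> Prop).

Definition resK (i : nat) c : {ffun koszul_basis n i -> S} := [ffun a => c (val a)].

Lemma resK_is_linear i : linear (resK i).
Proof. by move=> a u v; apply/ffunP => T; rewrite !ffunE. Qed.
HB.instance Definition _ i := GRing.isLinear.Build K _ _ _ (resK i) (resK_is_linear i).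

Lemma mxmap_is_linear (A B : finType) (D : A -> B -> S) : linear (mxmap D).
Proof.
move=> a u v; apply/ffunP => b; rewrite !ffunE scaler_sumr -big_split /=.
by refine (eq_bigr _ _) => x _; rewrite !ffunE mulrDl scalerAl.
Qed.
HB.instance Definition _ A B D :=
  GRing.isLinear.Build K _ _ _ (@mxmap n K A B D) (mxmap_is_linear D).

Lemma mxmap_koszul i c :
  mxmap (@koszul_diff n K i) (resK i.+1 c) = resK i (dK c).
Proof.
apply/ffunP => b; rewrite !ffunE dKE /koszul_diff /koszul_coef.
under eq_bigr do rewrite mulr_sumr ffunE.
rewrite (exchange_big_dep predT) //= [RHS]big_mkcond; apply: eq_bigr => j _.
case: ifPn => jb; last first.
  rewrite big_pred0 // => a; apply/negP => /andP[_ /eqP e].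
  by move/negP: jb; apply; rewrite -e setD11.
have cb : #|j |: val b| == i.+1 by rewrite cardsU1 jb (eqP (valP b)).
rewrite (big_pred1 (Sub (j |: val b) cb)) /=; last first.
  move=> a /=; rewrite -[RHS](inj_eq val_inj) /=; apply/andP/eqP => [[ja /eqP e]|->].
    by rewrite -e setD1K.
  by rewrite setU11 setU1K.
rewrite /sgn; have -> : koszul_sign j (j |: val b) = koszul_sign j (val b).
  apply: eq_card => t; rewrite !inE; case: (eqVneq t j) => [->|//].
  by rewrite ltnn !andbF.
by rewrite -scalerAr mulrC.
Qed.

Lemma tensor_part_ch I i j (v : {ffun koszul_basis n i -> S}) : subsp I ->
  tensor_part (F := koszul n K) I j v <-> exists2 c, ch n I i j c & resK i c = v.
Proof.
move=> sI; split=> [h|[c [Ic cS] <-] a]; last first.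
  rewrite ffunE /in_twist /=; split=> //; rewrite (eqP (valP a)).
  case: leqP => [ij|ji].
    apply/dhomogP => u; rewrite mcoeff_msupp => /cS[ca].
    by rewrite mem_mons mdegD mdeg_mset ca => /andP[/eqP <- _]; rewrite addnK.
  apply/eqP/mpolyP => u; rewrite mcoeff0; apply/eqP/negPn/negP => /cS[ca].
  rewrite mem_mons mdegD mdeg_mset ca => /andP[/eqP e _].
  by move: ji; rewrite -e ltnNge leq_addl.
exists [ffun T => if insub T is Some a then v a else 0].
  split=> [T|T u]; rewrite ffunE; case: insubP => [a _ aT|_]; rewrite ?mcoeff0 ?eqxx //.
  - by case: (h a).
  - by case: sI.
  move=> nz; have [_] := h a; rewrite -aT (eqP (valP a)); split=> //.
  rewrite mem_mons mdegD mdeg_mset Mon_full andbT (eqP (valP a)).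
  move: b; rewrite /in_twist /= (eqP (valP a)); case: leqP => [ij|ji /eqP v0].
    by move=> /dhomogP/(_ u); rewrite mcoeff_msupp => /(_ nz) ->; rewrite subnK.
  by rewrite v0 mcoeff0 eqxx in nz.
by apply/ffunP => a; rewrite !ffunE valK.
Qed.

Lemma resK_inj (i : nat) c : (forall T u, (c T)@_u != 0 -> #|T| = i) -> resK i c = 0 -> c = 0.
Proof.
move=> cS c0; apply/ffunP => T; rewrite ffunE; apply/mpolyP => u; rewrite mcoeff0.
apply/eqP/negPn/negP => nz; have cT : #|T| == i by rewrite (cS _ _ nz).
move/ffunP: c0 => /(_ (Sub T cT)); rewrite !ffunE /= => e.
by rewrite e mcoeff0 eqxx in nz.
Qed.

Lemma subsp_ideal I : is_ideal I -> subsp I.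
Proof.
by case=> I0 ID IM; split=> // a f g If Ig; apply: ID => //; rewrite -mul_mpolyC; apply: IM.
Qed.

(** Rank and nullity, twice: r is the rank of the differential leaving homological degree i, and r'
    that of the one arriving there. *)
Lemma betti_rank I i j r r' : is_ideal I ->
    hd (im_dK n I i j) r -> hd (im_dK n I i.+1 j) r' ->
  (betti I i j + r + r')%N = cfam n i (initial n I) j.
Proof.
move=> iI hr hr'; have sI := subsp_ideal iI; set a := cfam _ _ _ _.
have sC i' : subsp (ch n I i' j) by exact: subsp_ch.
have ha : hd (tensor_part (F := koszul n K) (i := i) I j) a.
  apply: hd_ext (hd_image (f := resK i) (sC i) (hd_ch n i j sI) _) => [v|c [_ cS]].
    by split=> /tensor_part_ch; apply.
  by apply: resK_inj => T u /cS[].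
have im_tensor i' s : hd (im_dK n I i'.+1 j) s ->
    hd (fun v => exists2 w, tensor_part (F := koszul n K) (i := i'.+1) I j w &
      mxmap (@res_diff n K (koszul n K) i') w = v) s.
  move=> hs; apply: hd_ext (hd_image (f := resK i') (subsp_im_dK n i'.+1 j sI) hs _) => [v|z Zz]; last first.
    by apply: resK_inj => T u /(im_dK_supp Zz)[[]].
  split=> [[_ [c hc <-] <-]|[w /(tensor_part_ch _ _ sI)[c hc <-] <-]].
    exists (resK i'.+1 c); last exact: mxmap_koszul.
    by apply/(tensor_part_ch _ _ sI); exists c.
  by exists (dK c); [exists c | apply/esym/mxmap_koszul].
have hB : hd (tor_boundary (F := koszul n K) (i := i) I j) r'.
  by apply: hd_ext (im_tensor i r' hr') => v; split=> -[w hw e]; exists w.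
have sT i' : subsp (tensor_part (F := koszul n K) (i := i') I j).
  have [Z0 ZL] := sC i'.
  split; first by apply/(tensor_part_ch _ _ sI); exists 0; rewrite ?linear0.
  move=> b x y /(tensor_part_ch _ _ sI)[c hc <-] /(tensor_part_ch _ _ sI)[e he <-].
  by apply/(tensor_part_ch _ _ sI); exists (b *: c + e); [apply: ZL | rewrite linearP].
have sB : subsp (tor_boundary (F := koszul n K) (i := i) I j).
  split; first by exists 0; [case: (sT i.+1) | rewrite linear0].
  move=> b x y [w hw ->] [w' hw' ->]; exists (b *: w + w'); first by apply: (sT i.+1).2.
  by rewrite linearP.
have BT v : tor_boundary (F := koszul n K) (i := i) I j v -> tensor_part (F := koszul n K) I j v.
  move=> [w /(tensor_part_ch _ _ sI)[c hc <-] ->].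
  rewrite (_ : mxmap _ _ = resK i (dK c)); last exact: mxmap_koszul.
  apply/(tensor_part_ch _ _ sI); exists (dK c) => //; split=> [T|T u nz].
    rewrite dKE; apply: subsp_sum => // l _; apply: subspZ => //.
    by case: iI => _ _; apply; case: hc.
  by have [] := im_dK_supp (ex_intro2 _ _ c hc erefl) nz => -[].
have fin (Z : {ffun koszul_basis n i -> S} -> Prop) z : subsp Z -> (forall v, Z v -> tensor_part (F := koszul n K) I j v) ->
    (forall v, tor_boundary (F := koszul n K) (i := i) I j v -> Z v) ->
    hd Z z -> (dim_quot Z (tor_boundary (F := koszul n K) (i := i) I j) + r')%N = z.
  move=> sZ ZT BZ hz; have [d hq] := has_dim_quot_ex sZ sB ha ZT.
  rewrite (dim_quotE sB hq) addnC; apply: (hd_uniq _ hz).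
  exact: (hd_quotD sZ sB BZ hB hq).
(* In homological degree 0 every chain is a cycle. Correspondingly r = 0, since [im_dK_supp] would
   require [#|T|.+1 = 0]. *)
case: i => [|i] in r r' hr hr' a ha hB sB BT fin *.
  have -> : r = 0%N.
    apply: (hd_uniq hr); exists (fun=> 0); split=> [[]//|c _ []//|z Zz].
    exists (fun=> 0); rewrite big_ord0 subr0; apply/ffunP => T; rewrite ffunE.
    apply/mpolyP => u; rewrite mcoeff0; apply/eqP/negPn/negP.
    by case/(im_dK_supp Zz).
  by rewrite addn0; apply: (fin _ a (sT 0%N) _ BT ha).
set f := mxmap (@res_diff n K (koszul n K) i).
have sZ : subsp (fun v => tensor_part (F := koszul n K) I j v /\ f v = 0).
  split; first by split; [case: (sT i.+1) | rewrite /f linear0].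
  move=> b x y [hx fx] [hy fy]; split; first exact: (sT i.+1).2.
  by rewrite /f linearP /= -/f fx fy scaler0 addr0.
have [|z hz] := has_dim_quot_ex sZ (subsp0 _) ha; first by move=> v [].
have -> : a = (z + r)%N.
  apply: (hd_uniq ha); apply: (@hd_split _ _ _ f _ _ _ (sT i.+1)) hz _.
  exact: im_tensor.
rewrite addnAC; congr (_ + _)%N; apply: (fin _ z sZ _ _ hz) => v; first by case.
move=> hv; split; first exact: BT.
by apply/(@res_exact n K (koszul n K) i); case: hv => w _ ->; exists w.
Qed.

End KoszulBetti.

(** * Hilbert functions as counts of initial monomials *)

Section HilbertCount.
Variables (n : nat) (K : fieldType).
Local Notation S := {mpoly K[n]}.
Local Notation Kz := {ffun {set 'I_n} -> S}.
Implicit Types (T : {set 'I_n}) (A : pred 'X_{1..n}) (Z I : S -> Prop).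

Definition cnt p A d : nat := count A (mons n p d).

Definition pol p d : S -> Prop := fun f => forall u, f@_u != 0 -> u \in mons n p d.

(** A version of [initial] for spaces Z that already lie in a single degree. *)
Definition lead Z : pred 'X_{1..n} := fun u => asb (exists2 g : S, Z g & g@_u != 0 /\
  forall v, g@_v != 0 -> (v == u) || rlt u v).

Lemma hd_pol Z p d : subsp Z -> (forall g, Z g -> pol p d g) -> hd Z (cnt p (lead Z) d).
Proof.
move=> sZ Zp; pose G u : {vspace K^o} := if lead Z u then fullv else 0%VS.
have -> : cnt p (lead Z) d = (\sum_(u <- mons n p d) \dim (G u))%N.
  rewrite /cnt -sum1_count big_mkcond; apply: eq_bigr => u _; rewrite /G.
  by case: (lead Z u); rewrite ?dimv0 ?dimvf.
apply: (@hd_filtration _ _ K^o _ _ (@mcoeff n K)) => [||z Zz z0|m w mp].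
- exact: mons_uniq.
- exact: sZ.
- apply/mpolyP => u; rewrite mcoeff0; apply/eqP/negPn/negP => nz.
  by have := z0 u (Zp _ Zz _ nz); apply/eqP.
rewrite /G; split.
  case: ifP => [/asbP[g Zg [nz gS]] _|_]; last first.
    by rewrite memv0 => /eqP ->; exists 0; [case: sZ | split=> [|l _]; exact: mcoeff0].
  exists ((w / g@_m) *: g); first exact: subspZ.
  split=> [|l]; first by rewrite /= mcoeffZ divfK.
  rewrite mem_take_mons // => /andP[_ lm]; rewrite /= mcoeffZ.
  have [-> |/gS] := eqVneq g@_l 0; first by rewrite mulr0.
  by rewrite (rlt_asym lm) orbF => /eqP e; rewrite e rlt_irr in lm.
case=> g Zg [<- g0]; case: ifPn => [_|]; first exact: memvf.
move/asbP => nlead; rewrite memv0 /=; have [//|nz] := eqVneq g@_m 0.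
case: nlead; exists g => //; split=> // v gv; have [//|/= ne] := eqVneq v m.
have /orP[lt|//] := rlt_total ne.
by have := g0 v; rewrite mem_take_mons // lt (Zp g) // => /(_ isT) e; rewrite e eqxx in gv.
Qed.

Lemma perm_mons_shift p j T : (mset T \in mons n p #|T|) -> (#|T| <= j)%N ->
  perm_eq [seq m <- mons n p j | (mset T <= m)%MM]
          [seq (u + mset T)%MM | u <- mons n p (j - #|T|)].
Proof.
rewrite mem_mons => /andP[_ MT] le_Tj; apply: uniq_perm.
- by rewrite filter_uniq ?mons_uniq.
- by rewrite map_inj_uniq ?mons_uniq //; apply: addIm.
move=> m; rewrite mem_filter; apply/andP/mapP => [[le_Tm]|[u]].
  rewrite mem_mons => /andP[/eqP dm Mm]; exists (m - mset T)%MM; last by rewrite submK.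
  move: Mm; rewrite mem_mons -{1}(submK le_Tm) MonD => /andP[-> _].
  by rewrite andbT -dm -{2}(submK le_Tm) mdegD mdeg_mset addnK.
rewrite !mem_mons => /andP[/eqP du Mu] ->; rewrite lem_addl mdegD mdeg_mset du.
by rewrite subnK // eqxx MonD Mu.
Qed.

(** For fixed T the quotients m - T run through all monomials of degree j - i. So the dimensions of
    the chain spaces depend on the Hilbert function only. *)
Lemma cfam_cnt p i A j :
  cfam p i A j = if (i <= j)%N then
    (#|[set T : {set 'I_n} | (#|T| == i) && Mon p (mset T)]| * cnt p A (j - i))%N else 0%N.
Proof.
rewrite /cfam.
have -> : (\sum_(m <- mons n p j) #|fam i A m| =
   \sum_(T : {set 'I_n} | #|T| == i) \sum_(m <- mons n p j | (mset T <= m)%MM) (A (m - mset T)%MM))%N.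
  under eq_bigr => m _.
    rewrite -sum1_card big_mkcond /=.
    rewrite (eq_bigr (fun T : {set 'I_n} => if #|T| == i then
      (if (mset T <= m)%MM then (A (m - mset T)%MM : nat) else 0%N) else 0%N)); last first.
      by move=> T _; rewrite inE; case: (#|T| == i) => //=; case: (mset T <= m)%MM => //=; case: (A _).
    rewrite -big_mkcond; over.
  by rewrite exchange_big /=; apply: eq_bigr => T _; rewrite -big_mkcond.
case: leqP => [ij|ji]; last first.
  rewrite big1 // => T /eqP cT; rewrite big_seq_cond big_pred0 // => m.
  apply/negP => /andP[]; rewrite mem_mons => /andP[/eqP dm _] le_Tm.
  by move: ji; rewrite -dm -(submK le_Tm) mdegD mdeg_mset cT ltnNge leq_addl.
rewrite (bigID (fun T => Mon p (mset T))) /= [X in (_ + X)%N]big1 ?addn0; last first.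
  move=> T /andP[_ nM]; rewrite big_seq_cond big_pred0 // => m.
  apply/negP => /andP[]; rewrite mem_mons => /andP[_ Mm] le_Tm.
  by move: Mm; rewrite -(submK le_Tm) MonD (negbTE nM) andbF.
rewrite -sum_nat_const big_mkcond [RHS]big_mkcond; apply: eq_bigr => T _.
rewrite inE; case: ifP => // /andP[/eqP cT MT].
rewrite -big_filter (perm_big _ (perm_mons_shift _ _)) ?cT //; last first.
  by rewrite mem_mons mdeg_mset cT eqxx.
rewrite big_map /cnt -sum1_count [RHS]big_mkcond; apply: eq_bigr => u _.
by rewrite addmK; case: (A u).
Qed.

Lemma cfam0 p A d : cfam p 0 A d = cnt p A d.
Proof.
rewrite cfam_cnt leq0n subn0 (_ : [set _ | _] = [set set0]) ?cards1 ?mul1n //.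
apply/setP => T; rewrite !inE cards_eq0; case: eqVneq => //= ->.
by apply/MonP => l _; rewrite msetE inE.
Qed.

Lemma eq_cfam_cnt p i A A' j : (forall d, (d <= j)%N -> cnt p A d = cnt p A' d) ->
  cfam p i A j = cfam p i A' j.
Proof. by move=> e; rewrite !cfam_cnt e // leq_subr. Qed.

Definition ev0 (c : Kz) : S := c set0.

Lemma ev0_is_linear : linear ev0.
Proof. by move=> a u v; rewrite /ev0 !ffunE. Qed.
HB.instance Definition _ := GRing.isLinear.Build K _ _ _ ev0 ev0_is_linear.

Lemma hilbert_initial I d : is_ideal I -> hilbert I d = cnt n (initial n I) d.
Proof.
move=> /subsp_ideal sI; apply: (dim_quotE (@subsp0 _ _)); rewrite -cfam0.
apply: hd_ext (hd_image (f := ev0) (subsp_ch n 0 d sI) (hd_ch n 0 d sI) _) => [f|c [_ cS] c0].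
  split=> [[c [Ic cS] <-]|[If /dhomogP hf]].
    split; first exact: Ic.
    apply/dhomogP => u; rewrite mcoeff_msupp => /cS[_].
    by rewrite mem_mons mdegD mdeg_mset cards0 addn0 => /andP[/eqP].
  exists [ffun T => if T == set0 then f else 0]; last by rewrite /= /ev0 ffunE eqxx.
  split=> [T|T u]; rewrite ffunE; case: (eqVneq T set0) => [T0|_] //; rewrite ?mcoeff0 ?eqxx //.
    by case: sI.
  rewrite T0 -mcoeff_msupp cards0 mem_mons Mon_full mdegD mdeg_mset cards0 addn0 => /hf.
  by move=> /= ->; rewrite eqxx.
apply/ffunP => T; rewrite ffunE; apply/mpolyP => u; rewrite mcoeff0.
apply/eqP/negPn/negP => nz; have [/eqP] := cS _ _ nz; rewrite cards_eq0 => /eqP T0 _.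
by move: nz; rewrite T0 -[c set0]/(ev0 c) c0 mcoeff0 eqxx.
Qed.

End HilbertCount.

(** * Distractions *)

Section LinearExtension.
Variables (n : nat) (K : fieldType).
Local Notation S := {mpoly K[n]}.
Implicit Types (f : S).

Definition mlin (g : 'X_{1..n} -> S) f : S := \sum_(u <- msupp f) f@_u *: g u.

Lemma mlinE (s : seq 'X_{1..n}) g f : uniq s -> {subset msupp f <= s} ->
  mlin g f = \sum_(u <- s) f@_u *: g u.
Proof.
move=> us sfs; rewrite /mlin [RHS](bigID (fun u => u \in msupp f)) /=.
rewrite [X in _ + X]big1 ?addr0; last first.
  by move=> u /memN_msupp_eq0 ->; rewrite scale0r.
have pe : perm_eq [seq u <- s | u \in msupp f] (msupp f).
  apply: uniq_perm; rewrite ?filter_uniq ?msupp_uniq // => u.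
  by rewrite mem_filter andb_idr // => /sfs.
by rewrite -[RHS]big_filter (perm_big _ pe).
Qed.

Lemma mlin_is_linear g : linear (mlin g).
Proof.
move=> a f h; set s := undup (msupp f ++ msupp h ++ msupp (a *: f + h)).
have us : uniq s by exact: undup_uniq.
rewrite !(@mlinE s) //; do ?by move=> u uf; rewrite mem_undup !mem_cat uf ?orbT.
rewrite scaler_sumr -big_split /=; refine (eq_bigr _ _) => u _.
by rewrite mcoeffD mcoeffZ scalerDl scalerA.
Qed.
HB.instance Definition _ g := GRing.isLinear.Build K _ _ _ (mlin g) (mlin_is_linear g).

Lemma mlinX g u : mlin g 'X_[u] = g u.
Proof. by rewrite /mlin msuppX big_seq1 mcoeffX eqxx scale1r. Qed.

Lemma mcoeff_mlin g f v : (mlin g f)@_v = \sum_(u <- msupp f) f@_u * (g u)@_v.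
Proof. by rewrite /mlin raddf_sum; refine (eq_bigr _ _) => u _; rewrite /= mcoeffZ. Qed.

End LinearExtension.

Section Distraction.
Variables (n : nat) (K : fieldType) (x z : 'I_n) (lambda : K).
Hypothesis xz : (x < z)%N.
Local Notation S := {mpoly K[n]}.
Local Notation Kz := {ffun {set 'I_n} -> S}.
Implicit Types (u v : 'X_{1..n}) (f g : S) (c : Kz) (T : {set 'I_n}) (A : pred 'X_{1..n}).

(* [dcf q s] is the coefficient of x^s z^(q-s) in prod_(k < q) (z - lambda^k x). *)
Fixpoint dcf (q s : nat) : K :=
  if q is q'.+1 then dcf q' s - (if s is s'.+1 then lambda ^+ q' * dcf q' s' else 0)
  else (s == 0%N)%:R.

Lemma dcfS q s :
  dcf q.+1 s = dcf q s - (if s is s'.+1 then lambda ^+ q * dcf q s' else 0).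
Proof. by []. Qed.

Lemma dcf_gt q s : (q < s)%N -> dcf q s = 0.
Proof.
elim: q s => [|q IH] [|s] //= qs; rewrite (IH s.+1) ?(IH s) ?mulr0 ?subr0 //.
exact: ltn_trans qs.
Qed.

Lemma dcf0 q : dcf q 0 = 1.
Proof. by elim: q => //= q ->; rewrite subr0. Qed.

Lemma dcf1 q : dcf q 1 = - \sum_(i < q) lambda ^+ i.
Proof.
elim: q => [|q IH] /=; first by rewrite big_ord0 oppr0.
by rewrite IH dcf0 mulr1 big_ord_recr opprD.
Qed.

Lemma dcf_diag_neq0 q : lambda != 0 -> dcf q q != 0.
Proof.
move=> nz; elim: q => [|q IH] /=; first exact: oner_neq0.
by rewrite dcf_gt // add0r oppr_eq0 mulf_neq0 // expf_neq0.
Qed.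

Definition xsh u (s : nat) : 'X_{1..n} := ((u - U_(z) *+ s) + U_(x) *+ s)%MM.

Lemma xshE u s i : xsh u s i = (u i - (z == i) * s + (x == i) * s)%N.
Proof. by rewrite mnmDE mnmBE !mulmnE !mnm1E. Qed.

Lemma neq_xz : (x == z) = false.
Proof. by apply/eqP => e; move: xz; rewrite e ltnn. Qed.

Lemma xsh_z u s : xsh u s z = (u z - s)%N.
Proof. by rewrite xshE eqxx neq_xz mul1n addn0. Qed.

Lemma xsh_inj u s t : (s <= u z)%N -> (t <= u z)%N -> xsh u s = xsh u t -> s = t.
Proof.
move=> su tu /(congr1 (fun m : 'X_{1..n} => m z)); rewrite !xsh_z => e.
by apply: (@addIn (u z - s)%N); rewrite subnKC // e subnKC.
Qed.

Lemma xshD u w s : (s <= u z)%N -> xsh (w + u)%MM s = (w + xsh u s)%MM.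
Proof.
move=> su; apply/mnmP => i; rewrite mnmDE !xshE mnmDE addnA addnBA //.
by case: eqVneq => [<-|]; rewrite ?mul1n ?mul0n.
Qed.

Lemma xshS u s : (s <= u z)%N -> xsh (U_(z) + u)%MM s.+1 = (U_(x) + xsh u s)%MM.
Proof.
move=> su; apply/mnmP => i; rewrite mnmDE !xshE mnmDE !mnm1E.
case: (eqVneq z i) => [<-|_]; rewrite ?neq_xz ?mul1n ?mul0n ?addn0 ?add0n ?add1n ?subSS //.
by rewrite !subn0; case: eqP => _; rewrite ?mul1n ?mul0n ?addnS ?add1n.
Qed.

Lemma xsh0 u : xsh u 0 = u.
Proof. by apply/mnmP => i; rewrite xshE !muln0 subn0 addn0. Qed.

Lemma mdeg_xsh u s : (s <= u z)%N -> mdeg (xsh u s) = mdeg u.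
Proof.
move=> su; rewrite mdegD -[in RHS](@submK _ (U_(z) *+ s)%MM u) ?mdegD ?mdegMn ?mdeg1 //.
by apply/mnm_lepP => i; rewrite mulmnE mnm1E; case: eqP => [<-|_]; rewrite ?mul1n.
Qed.

Lemma Mon_xsh p u s : (z < p)%N -> Mon p u -> Mon p (xsh u s).
Proof.
move=> zp /MonP Mu; apply/MonP => l pl; rewrite xshE Mu // sub0n.
by case: eqVneq => // e; move: pl; rewrite -e leqNgt (ltn_trans xz).
Qed.

Definition dmon u : S := \sum_(s < (u z).+1) dcf (u z) s *: 'X_[xsh u s].

Lemma dmon_supp u v : (dmon u)@_v != 0 -> exists2 s, (s <= u z)%N & v = xsh u s.
Proof.
rewrite /dmon raddf_sum /= => nz.
have [s hs] : exists s : 'I_(u z).+1, xsh u s == v.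
  apply/existsP; apply: contraNT nz; rewrite negb_exists => /forallP h.
  by rewrite big1 // => s _; rewrite mcoeffZ mcoeffX (negbTE (h s)) mulr0.
by exists s; [rewrite -ltnS | rewrite (eqP hs)].
Qed.

Lemma dmon_coeff u s : (s <= u z)%N -> (dmon u)@_(xsh u s) = dcf (u z) s.
Proof.
rewrite -ltnS => su; rewrite /dmon raddf_sum /= (bigD1 (Ordinal su)) //=.
rewrite mcoeffZ mcoeffX eqxx mulr1 big1 ?addr0 // => t ts.
rewrite mcoeffZ mcoeffX; case: eqVneq => [e|_]; last by rewrite mulr0.
case/negP: ts; apply/eqP/val_inj; by apply: (xsh_inj _ _ e); rewrite -ltnS.
Qed.

Lemma dmon_coeff_ge u v : (u z <= v z)%N -> (dmon u)@_v = (u == v)%:R.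
Proof.
move=> uv; have [->|ne] := eqVneq u v.
  by rewrite -[X in _@_X]xsh0 dmon_coeff // dcf0.
apply/eqP; apply: contraNT ne => /dmon_supp[s su e].
have /eqP : s = 0%N.
  move: uv; rewrite e xsh_z leq_subRL // -[X in (_ <= X)%N]add0n leq_add2r leqn0.
  by move/eqP.
by move/eqP => s0; rewrite e s0 xsh0.
Qed.

Lemma dmonXj (j : 'I_n) u : j != z -> 'X_j * dmon u = dmon (U_(j) + u)%MM.
Proof.
move=> jz; rewrite /dmon mnmDE mnm1E (negbTE jz) add0n mulr_sumr.
by apply: eq_bigr => s _; rewrite -scalerAr -mpolyXD xshD // -ltnS.
Qed.

(** The product for z^(q+1) is the one for z^q times z - lambda^q x. *)
Lemma dmonXz u :
  'X_z * dmon u = dmon (U_(z) + u)%MM + lambda ^+ u z *: ('X_x * dmon u).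
Proof.
rewrite {2}/dmon mnmDE mnm1E eqxx add1n.
under eq_bigr do rewrite /= scalerBl.
rewrite sumrB big_ord_recr /= dcf_gt // scale0r addr0.
rewrite [X in _ - X + _]big_ord_recl /= scale0r add0r.
rewrite [X in _ - X + _](_ : _ = lambda ^+ u z *: ('X_x * dmon u)) ?subrK.
  rewrite /dmon mulr_sumr; apply: eq_bigr => s _.
  by rewrite -scalerAr -mpolyXD xshD // -ltnS.
rewrite /dmon mulr_sumr scaler_sumr; apply: eq_bigr => s _.
have su : (s <= u z)%N by rewrite -ltnS.
by rewrite -scalerAr -mpolyXD /bump add1n (xshS su) scalerA.
Qed.

Definition dis : S -> S := mlin dmon.
(** The error term in [disXz]. By [dis_twz] it is the distraction after the diagonal map [twz]. *)
Definition dis' : S -> S := mlin (fun u => lambda ^+ u z *: dmon u).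
Definition twz : S -> S := mlin (fun u => lambda ^+ u z *: 'X_[u]).
HB.instance Definition _ := GRing.Linear.on dis.
HB.instance Definition _ := GRing.Linear.on dis'.
HB.instance Definition _ := GRing.Linear.on twz.

Lemma disXj (j : 'I_n) f : j != z -> dis ('X_j * f) = 'X_j * dis f.
Proof.
move=> jz; elim/mpolyind: f => [|a u f _ _ IH]; first by rewrite mulr0 linear0 mulr0.
rewrite mulrDr -scalerAr -mpolyXD !linearP /= IH mulrDr -scalerAr; congr (_ *: _ + _).
by rewrite /dis !mlinX dmonXj.
Qed.

Lemma disXj' (j : 'I_n) f : j != z -> dis' ('X_j * f) = 'X_j * dis' f.
Proof.
move=> jz; elim/mpolyind: f => [|a u f _ _ IH]; first by rewrite mulr0 linear0 mulr0.
rewrite mulrDr -scalerAr -mpolyXD !linearP /= IH mulrDr -scalerAr; congr (_ *: _ + _).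
by rewrite /dis' !mlinX -scalerAr dmonXj // mnmDE mnm1E (negbTE jz).
Qed.

Lemma disXz f : dis ('X_z * f) = 'X_z * dis f - 'X_x * dis' f.
Proof.
elim/mpolyind: f => [|a u f _ _ IH]; first by rewrite mulr0 !linear0 !mulr0 subr0.
rewrite mulrDr -scalerAr -mpolyXD !linearP /= IH !mulrDr -!scalerAr opprD addrACA.
rewrite -scalerBr; congr (_ *: _ + _).
by rewrite /dis /dis' !mlinX dmonXz -scalerAr addrK.
Qed.

Lemma dis_twz f : dis (twz f) = dis' f.
Proof.
elim/mpolyind: f => [|a u f _ _ IH]; first by rewrite !linear0.
by rewrite !linearP /= IH /dis /dis' /twz !mlinX linearZ /= mlinX.
Qed.

Lemma mcoeff_twz f v : (twz f)@_v = lambda ^+ v z * f@_v.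
Proof.
elim/mpolyind: f => [|a u f _ _ IH]; first by rewrite linear0 mcoeff0 mulr0.
rewrite linearP /= !mcoeffD IH mulrDr; congr (_ + _).
rewrite !mcoeffZ /twz mlinX mcoeffZ mcoeffX; case: eqP => [->|_]; first by rewrite !mulr1 mulrC.
by rewrite !mulr0.
Qed.

(** The distraction is unitriangular: [dmon v] is v plus terms of the same degree with smaller
    z-exponent. *)
Lemma dis_top f u : (forall v, f@_v != 0 -> mdeg v = mdeg u -> (v z <= u z)%N) ->
  (dis f)@_u = f@_u.
Proof.
move=> h; rewrite mcoeff_mlin.
have [uf|uf] := boolP (u \in msupp f); last first.
  rewrite big1_seq ?memN_msupp_eq0 // => v /andP[_ vf].
  have [->|nz] := eqVneq (dmon v)@_u 0; first by rewrite mulr0.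
  have [s sv e] := dmon_supp nz; have := h v.
  rewrite -mcoeff_msupp vf => /(_ isT) hv.
  have vu : (v z <= u z)%N by apply: hv; rewrite e mdeg_xsh.
  rewrite dmon_coeff_ge //; case: eqP => [e2|_]; last by rewrite mulr0.
  by rewrite e2 (negbTE uf) in vf.
rewrite (bigD1_seq u) ?msupp_uniq //= dmon_coeff_ge // eqxx mulr1.
rewrite big1_seq ?addr0 // => v /andP[vu vf].
have [->|nz] := eqVneq (dmon v)@_u 0; first by rewrite mulr0.
have [s sv e] := dmon_supp nz; have := h v.
rewrite -mcoeff_msupp vf => /(_ isT) hv.
have le_vu : (v z <= u z)%N by apply: hv; rewrite e mdeg_xsh.
by rewrite dmon_coeff_ge // (negbTE vu) mulr0.
Qed.

(** Among the monomials of f of the same degree as u, one with the largest z-exponent survives in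
    [dis f], by [dis_top]. *)
Lemma dis_deg f d u : (forall w, (dis f)@_w != 0 -> mdeg w = d) ->
  f@_u != 0 -> mdeg u = d.
Proof.
move=> h nz; pose s := [seq v <- msupp f | mdeg v == mdeg u].
have us : u \in s by rewrite mem_filter eqxx mcoeff_msupp.
case: (@arg_maxnP _ (SeqSub us) predT (fun w : seq_sub s => ssval w z) isT) => -[w ws] _ /= wmax.
move: (ws); rewrite mem_filter mcoeff_msupp => /andP[/eqP dw nw].
rewrite -dw; apply: h; rewrite dis_top // => v nv dv.
have vs : v \in s by rewrite mem_filter mcoeff_msupp nv dv dw eqxx.
exact: (wmax (SeqSub vs) isT).
Qed.

Lemma dis_inj f : dis f = 0 -> f = 0.
Proof.
move=> f0; apply/mpolyP => u; rewrite mcoeff0; apply/eqP/negPn/negP => nz.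
have h d : mdeg u = d by apply: dis_deg nz => w; rewrite f0 mcoeff0 eqxx.
by have := h (mdeg u).+1 => /eqP; rewrite eqn_leq ltnn andbF.
Qed.

End Distraction.

Arguments dcf : simpl never.

Section PointwiseMaps.
Variables (n : nat) (K : fieldType).
Local Notation S := {mpoly K[n]}.
Local Notation Kz := {ffun {set 'I_n} -> S}.
Implicit Types (c : Kz) (T : {set 'I_n}) (f : S).

Definition mapK (phi : S -> S) c : Kz := [ffun T => phi (c T)].

Lemma mapK_pd (phi : {linear S -> S}) j c : mapK phi (pd j c) = pd j (mapK phi c).
Proof. by apply/ffunP => T; rewrite !ffunE; case: ifP; rewrite ?linear0 ?linearZ. Qed.

Lemma mapK_ex (phi : {linear S -> S}) j c : mapK phi (ex j c) = ex j (mapK phi c).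
Proof. by apply/ffunP => T; rewrite !ffunE; case: ifP; rewrite ?linear0 ?linearZ. Qed.

Lemma mapK_sum (phi : {linear S -> S}) (J : finType) (F : J -> Kz) :
  mapK phi (\sum_i F i) = \sum_i mapK phi (F i).
Proof.
apply/ffunP => T; rewrite !ffunE !sum_ffunE linear_sum.
by refine (eq_bigr _ _) => i _; rewrite ffunE.
Qed.

Lemma mapKP (phi : {linear S -> S}) a c e :
  mapK phi (a *: c + e) = a *: mapK phi c + mapK phi e.
Proof. by apply/ffunP => T; rewrite !ffunE linearP. Qed.

Lemma mapKD (phi : {linear S -> S}) c e : mapK phi (c + e) = mapK phi c + mapK phi e.
Proof. by apply/ffunP => T; rewrite !ffunE linearD. Qed.

Lemma mapKN (phi : {linear S -> S}) c : mapK phi (- c) = - mapK phi c.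
Proof. by apply/ffunP => T; rewrite !ffunE linearN. Qed.

Lemma Xmul_pd i j c : Xmul i (pd j c) = pd j (Xmul i c).
Proof. by apply/ffunP => T; rewrite !ffunE; case: ifP; rewrite ?mulr0 ?scalerAr. Qed.

Lemma Xmul_ex i j c : Xmul i (ex j c) = ex j (Xmul i c).
Proof. by apply/ffunP => T; rewrite !ffunE; case: ifP; rewrite ?mulr0 ?scalerAr. Qed.

Lemma dK_ex x c : dK (ex x c) = Xmul x c - ex x (dK c).
Proof.
rewrite /dK linear_sum /= (bigD1 x) //= [X in _ = _ - X](bigD1 x) //= opprD addrA.
rewrite Xmul_ex -[X in _ = X - _ - _](pd_ex_same x) addrK; congr (_ + _).
rewrite -sumrN; apply: eq_bigr => j jx.
by rewrite Xmul_ex pd_ex.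
Qed.

Lemma pd_dK z c : pd z (dK c) = - dK (pd z c).
Proof.
rewrite /dK linear_sum -sumrN; refine (eq_bigr _ _) => j _ /=.
rewrite Xmul_pd; have [->|jz] := eqVneq j z; first by rewrite pd_pd_same oppr0.
by rewrite pd_pd // eq_sym.
Qed.

End PointwiseMaps.

Section DistractionChain.
Variables (n : nat) (K : fieldType) (x z : 'I_n) (lambda : K).
Hypothesis xz : (x < z)%N.
Local Notation S := {mpoly K[n]}.
Local Notation Kz := {ffun {set 'I_n} -> S}.
Implicit Types (c : Kz) (T : {set 'I_n}) (A : pred 'X_{1..n}) (p : nat).

Local Notation D := (dis x z lambda).
Local Notation D' := (dis' x z lambda).
Local Notation C := (twz z lambda).

(** Only the summand of [dK] belonging to z fails to commute with the distraction. *)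
Lemma mapK_dis_dK c : mapK D (dK c) = dK (mapK D c) - Xmul x (mapK D' (pd z c)).
Proof.
rewrite /dK mapK_sum (bigD1 z) //= [in RHS](bigD1 z) //= addrAC.
rewrite mapK_pd (_ : mapK D (Xmul z c) = Xmul z (mapK D c) - Xmul x (mapK D' c)); last first.
  by apply/ffunP => T; rewrite !ffunE disXz.
rewrite linearB /= mapK_pd Xmul_pd; congr (_ + _).
refine (eq_bigr _ _) => j jz; rewrite mapK_pd; congr (pd j _).
by apply/ffunP => T; rewrite !ffunE /= disXj.
Qed.

Lemma mapK_dis'_dK c : pd z c = 0 -> mapK D' (dK c) = dK (mapK D' c).
Proof.
move=> zc; rewrite /dK mapK_sum; apply: eq_bigr => j _; rewrite mapK_pd.
have [->|jz] := eqVneq j z.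
  rewrite -(mapK_pd D') -!Xmul_pd -(mapK_pd D') zc.
  by apply/ffunP => T; rewrite !ffunE /= mulr0 linear0 mulr0.
by congr (pd j _); apply/ffunP => T; rewrite !ffunE /= disXj'.
Qed.

(* The distraction sends multiplication by z to z - x C, where C multiplies x^u by
   lambda^(u z); replacing e_z by e_z - C e_x absorbs the difference. *)
Definition theta c : Kz := mapK D c - ex x (mapK D' (pd z c)).

Lemma theta_is_linear : linear theta.
Proof.
by move=> a c e; rewrite /theta (mapKP D) (linearP (pd z)) /= (mapKP D') (linearP (ex x)) /= scalerBr opprD addrACA.
Qed.
HB.instance Definition _ := GRing.isLinear.Build K _ _ _ theta theta_is_linear.

Lemma theta_dK c : theta (dK c) = dK (theta c).
Proof.
rewrite /theta linearB /= mapK_dis_dK dK_ex opprB addrA pd_dK mapKN linearN opprK.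
by rewrite mapK_dis'_dK ?pd_pd_same // addrAC.
Qed.

Definition dis_ideal p A : S -> Prop := fun g => exists2 f, mono_sp p A f & D f = g.

Lemma subsp_dis_ideal p A : subsp (dis_ideal p A).
Proof.
have [Z0 ZL] := subsp_mono K p A; split; first by exists 0; rewrite ?linear0.
by move=> a _ _ [f fA <-] [g gA <-]; exists (a *: f + g); [apply: ZL | rewrite linearP].
Qed.

Lemma theta_surj p A i j c' : (z < p)%N -> ch p (dis_ideal p A) i j c' ->
  exists2 c, ch p (mono_sp p A) i j c & theta c = c'.
Proof.
move=> zp [/fin_all_exists2[f fA fE] cS].
pose c0 : Kz := [ffun T => f T].
have Dc0 : mapK D c0 = c' by apply/ffunP => T; rewrite !ffunE fE.
have xp : (x < p)%N := ltn_trans xz zp.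
have supp T u : (f T)@_u != 0 -> #|T| = i /\ (u + mset T)%MM \in mons n p j.
  move=> nz; have Mu : Mon p u by have /andP[] := fA T u nz.
  have [w nw] : exists w, (c' T)@_w != 0.
    have [e|ne] := eqVneq (c' T) 0.
      by move: nz; rewrite (dis_inj (lambda := lambda) xz (f := f T)) ?mcoeff0 ?eqxx // fE.
    move: ne; rewrite -msupp_eq0; case e: (msupp (c' T)) => [//|w s] _.
    by exists w; rewrite -mcoeff_msupp e mem_head.
  have [cT wp] := cS T w nw; split=> //; move: wp.
  rewrite !mem_mons !MonD Mu !mdegD mdeg_mset cT => /andP[/eqP dw /andP[_ ->]].
  rewrite (dis_deg (lambda := lambda) xz (d := mdeg w) _ nz) ?dw ?eqxx // => v nv.
  rewrite fE in nv; have [_ ] := cS T v nv.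
  rewrite mem_mons mdegD mdeg_mset cT -dw eqn_add2r => /andP[/eqP //].
(* The preimage of c' under D, corrected by the inverse change of generators, e_z -> e_z + C e_x. It
   stays in the monomial space because C is diagonal on monomials. *)
have exists_c : ch p (mono_sp p A) i j (c0 + ex x (mapK C (pd z c0))).
  split=> [T|T u]; rewrite !ffunE; case: (boolP (x \in T)) => xT; rewrite ?addr0 //; last exact: supp.
    case: ifP => zT; first by rewrite linear0 scaler0 addr0.
    have sM := subsp_mono K p A.
    apply: (subspD sM (fA T)); apply: (subspZ _ sM).
    move=> u; rewrite /= mcoeff_twz mcoeffZ !mulf_eq0 !negb_or => /andP[_ /andP[_]].
    by move/fA.
  case: ifP => zT; first by rewrite linear0 scaler0 addr0; apply: supp.
  rewrite mcoeffD mcoeffZ /= mcoeff_twz mcoeffZ => nz.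
  have [e|/supp //] := eqVneq (f T)@_u 0.
  have /supp[] : (f (z |: T :\ x))@_u != 0.
    by apply: contraNneq nz => ->; rewrite e !mulr0 addr0.
  have cT : #|z |: T :\ x| = #|T| by rewrite cardsU1 zT [in RHS](cardsD1 x) xT.
  rewrite cT => -> ; rewrite !mem_mons !MonD !mdegD !mdeg_mset cT => /andP[-> /andP[-> M]].
  split=> //=; have MD : Mon p (mset (T :\ x)).
    by move: M; rewrite msetU1 ?zT // MonD => /andP[].
  by rewrite -(setD1K xT) msetU1 ?setD11 // MonD MD Mon1 xp.
exists (c0 + ex x (mapK C (pd z c0))) => //.
have DC e : mapK D (mapK C e) = mapK D' e.
  by apply/ffunP => T; rewrite !ffunE dis_twz.
have zx : z != x by rewrite eq_sym -(inj_eq val_inj) (ltn_eqF xz).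
rewrite /theta mapKD Dc0 mapK_ex DC linearD /= pd_ex //.
rewrite mapKD mapKN mapK_ex linearD linearN /= ex_ex_same oppr0 addr0 addrK.
by [].
Qed.

(** [theta] commutes with the differentials and maps onto the chains of the distracted space, so the
    ranks cannot go up. Passing to initial monomials cannot raise them either. *)
Lemma rk_dis p A i j : (z < p)%N ->
  (rk K p i (initial p (dis_ideal p A)) j <= rk K p i A j)%N.
Proof.
move=> zp; have [r hr /leq_trans] := hd_im_dK p i j (subsp_dis_ideal p A); apply.
apply: (hd_leq_surj (f := theta) (hd_im_dK_mono K p A i j) hr) => _ [c' /(theta_surj zp)[c hc <-] <-].
by exists (dK c); [exists c | rewrite /= theta_dK].
Qed.

End DistractionChain.

Section DistractionInitial.
Variables (n : nat) (K : fieldType).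
Local Notation S := {mpoly K[n]}.
Implicit Types (T : {set 'I_n}) (A : pred 'X_{1..n}) (p d q : nat) (I : S -> Prop)
  (u v w : 'X_{1..n}) (f g : S).

Definition up p A : Prop := forall u (i : 'I_n), (i < p)%N -> Mon p u -> A u -> A (U_(i) + u)%MM.

Lemma up_initial p I : (forall f (i : 'I_n), (i < p)%N -> I f -> I ('X_i * f)) ->
  up p (initial p I).
Proof.
move=> IX u i ip Mu /asbP[g [Ig nz] gS]; apply/asbP; exists ('X_i * g).
  split; first exact: IX.
  by rewrite mcoeff_Xmul mnmDE mnm1E eqxx add1n /= addmC addmK.
move=> v; rewrite mcoeff_Xmul; case: ifP => [vi /gS[vm vu]|_]; last by rewrite eqxx.
have e : v = (v - U_(i) + U_(i))%MM by rewrite submK // lep1mP -lt0n.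
rewrite {2 3}e [(U_(i) + u)%MM]addmC eqm_add2r rltD2r mdegD mdeg1; split=> //.
move: vm; rewrite !mem_mons => /andP[/eqP dv Mv].
by rewrite {1 2}e mdegD mdeg1 dv eqxx MonD Mv Mon1.
Qed.

Lemma mono_Xmul p A (i : 'I_n) f : (i < p)%N -> up p A -> mono_sp p A f ->
  mono_sp p A ('X_i * f).
Proof.
move=> ip upA fA u; rewrite mcoeff_Xmul; case: ifP => [ui|_]; last by rewrite eqxx.
move=> /fA/andP[M Au].
have -> : u = (U_(i) + (u - U_(i)))%MM by rewrite addmC submK // lep1mP -lt0n.
by rewrite MonD Mon1 ip M upA.
Qed.

Lemma hd_mono_pol p A d : hd (fun f => mono_sp p A f /\ pol p d f) (cnt p A d).
Proof.
have sZ : subsp (fun f => mono_sp (K := K) p A f /\ pol p d f).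
  have [M0 ML] := subsp_mono K p A.
  split; first by split=> // u; rewrite mcoeff0 eqxx.
  move=> a f g [fA fd] [gA gd]; split; first exact: ML.
  move=> u; rewrite mcoeffD mcoeffZ; have [-> nz|/gd//] := eqVneq (g@_u) 0.
  by apply: fd; apply: contraNneq nz => ->; rewrite mulr0 addr0.
have -> : cnt p A d = cnt p (lead (fun f => mono_sp (K := K) p A f /\ pol p d f)) d.
  apply: eq_in_count => u um; have Mu : Mon p u by move: um; rewrite mem_mons => /andP[].
  apply/idP/asbP => [Au|[g [gA _] [/gA/andP[]]] //].
  exists 'X_[u].
    by split=> v; rewrite mcoeffX; case: (eqVneq u v) => [<-|_]; rewrite ?eqxx ?Mu.
  rewrite mcoeffX eqxx oner_neq0; split=> // v.
  by rewrite mcoeffX; case: (eqVneq u v) => [<-|_]; rewrite ?eqxx.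
by apply: hd_pol => // f [].
Qed.

Variables (x z : 'I_n) (lambda : K).
Hypothesis xz : (x < z)%N.
Local Notation D := (dis x z lambda).

Definition dstep p A : pred 'X_{1..n} := initial p (dis_ideal x z lambda p A).

Lemma up_dstep p A : (z < p)%N -> up p A -> up p (dstep p A).
Proof.
move=> zp upA; apply: up_initial => _ i ip [f fA <-].
have [->|iz] := eqVneq i z; last first.
  by exists ('X_i * f); [apply: mono_Xmul | rewrite disXj].
(* By [disXz], z D(f) = D(z f) + x D(C f), and x commutes with D. *)
exists ('X_z * f + 'X_x * twz z lambda f).
  have sM := subsp_mono K p A; apply: (subspD sM); first exact: mono_Xmul.
  apply: mono_Xmul => //; first exact: ltn_trans zp.
  by move=> u; rewrite mcoeff_twz mulf_eq0 negb_or => /andP[_ /fA].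
have xnz : x != z by rewrite -(inj_eq val_inj) /= (ltn_eqF xz).
by rewrite linearD /= disXz // disXj // dis_twz subrK.
Qed.

Lemma dis_pol p A d f : (z < p)%N -> mono_sp p A f -> pol p d (D f) -> pol p d f.
Proof.
move=> zp fA h u nz; rewrite mem_mons; have /andP[-> _] := fA u nz.
rewrite andbT (dis_deg (lambda := lambda) xz (d := d) _ nz) ?eqxx // => w /h.
by rewrite mem_mons => /andP[/eqP].
Qed.

Lemma pol_dis p d f : (z < p)%N -> pol p d f -> pol p d (D f).
Proof.
move=> zp fd v; rewrite mcoeff_mlin => nz.
have [u uf nd] : exists2 u, u \in msupp f & (dmon x z lambda u)@_v != 0.
  apply/hasP; apply: contraNT nz => /hasPn h; rewrite big1_seq // => u /h.
  by rewrite negbK => /eqP ->; rewrite mulr0.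
have [s su ->] := dmon_supp nd; move: (fd u); rewrite -mcoeff_msupp uf => /(_ isT).
by rewrite !mem_mons mdeg_xsh // => /andP[-> /Mon_xsh ->].
Qed.

(** For q > 0 the variable z is the last one, so [rlt] compares its exponents first. An initial
    monomial is then divisible by z^q exactly when its whole polynomial is. *)
Lemma lead_dstep p A d q u : (z < p)%N -> u \in mons n p d ->
    (0 < q -> z.+1 = p)%N ->
  lead (fun g => dis_ideal x z lambda p A g /\ pol p d g /\
    forall v, g@_v != 0 -> (q <= v z)%N) u = dstep p A u && (q <= u z)%N.
Proof.
move=> zp um zq; have /andP[/eqP du Mu] : (mdeg u == d) && Mon p u by rewrite -mem_mons.
apply/asbP/andP => [[g [gI [gd gq]] [nz gS]]|[/asbP[g [gI nz] gS] qu]].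
  split; last exact: gq; apply/asbP; exists g => // v gv; split; last exact: gS.
  by rewrite du; apply: gd.
exists g; split=> //; last by move=> v /gS[].
  split=> [v /gS[]|v /gS[]]; first by rewrite du.
case: (posnP q) => [-> //|/zq zE] vm /predU1P[-> //|/rltP[i ui h]].
apply: (leq_trans qu); have [iz|zi|/val_inj e] := ltngtP i z.
- by rewrite h.
- move: vm; rewrite mem_mons => /andP[_ /MonP Mv].
  by rewrite (Mv i) // -zE in ui.
by rewrite -e ltnW.
Qed.

(** By [lead_dstep] and injectivity of D, the left-hand side is the dimension of the space of those
    f for which z^q divides [D f]. The hypothesis says that the coefficients at V determine such an
    f. *)
Lemma cnt_dstep_ge p A d q (V : pred 'X_{1..n}) : (z < p)%N -> (0 < q -> z.+1 = p)%N ->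
    (forall f, mono_sp p A f -> pol p d f -> (forall v, (D f)@_v != 0 -> (q <= v z)%N) ->
      (forall u, V u -> f@_u = 0) -> f = 0) ->
  (cnt p (fun u => dstep p A u && (q <= u z)%N) d <= cnt p V d)%N.
Proof.
move=> zp zq hV.
pose Z (g : S) := dis_ideal x z lambda p A g /\ pol p d g /\ forall v, g@_v != 0 -> (q <= v z)%N.
have sZ : subsp Z.
  have [M0 ML] := subsp_dis_ideal x z lambda p A.
  split; first by split=> //; split=> u; rewrite mcoeff0 eqxx.
  move=> a f g [fA [fd fq]] [gA [gd gq]]; split; first exact: ML.
  split=> u; rewrite mcoeffD mcoeffZ.
    have [-> nz|/gd//] := eqVneq (g@_u) 0.
    by apply: fd; apply: contraNneq nz => ->; rewrite mulr0 addr0.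
  have [-> nz|/gq//] := eqVneq (g@_u) 0.
  by apply: fq; apply: contraNneq nz => ->; rewrite mulr0 addr0.
have hZ : hd Z (cnt p (fun u => dstep p A u && (q <= u z)%N) d).
  have -> : cnt p (fun u => dstep p A u && (q <= u z)%N) d = cnt p (lead Z) d.
    by apply: eq_in_count => u um; rewrite (lead_dstep A zp um).
  by apply: hd_pol sZ _ => g [_ []].
have sM := subsp_mono K p A.
have sY : subsp (fun f => mono_sp p A f /\ Z (D f)).
  split; first by split; [case: sM | rewrite linear0; case: sZ].
  by move=> a f g [fA fZ] [gA gZ]; split; [apply: sM.2 | rewrite linearP; apply: sZ.2].
have [y hY] : exists y, hd (fun f => mono_sp p A f /\ Z (D f)) y.
  apply: (has_dim_quot_ex sY (subsp0 _) (hd_mono_pol p A d)) => f [fA [_ [fd _]]].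
  by split=> //; apply: (dis_pol zp fA fd).
have <- : y = cnt p (fun u => dstep p A u && (q <= u z)%N) d.
  apply: hd_uniq hZ; apply: hd_ext (hd_image (f := D) sY hY _) => [g|f [_ _]]; last exact: dis_inj.
  by split=> [[f [fA Zf] <- //]|Zg]; case: (Zg) => -[f fA fE] _; exists f; rewrite ?fE.
pose tr := mlin (fun u => if V u then 'X_[u] else 0 : S).
have trE f u : (tr f)@_u = if V u then f@_u else 0.
  rewrite mcoeff_mlin; have [uf|uf] := boolP (u \in msupp f); last first.
    rewrite (memN_msupp_eq0 uf) if_same big1_seq // => v /andP[_ vf].
    case: (V v); rewrite ?mcoeff0 ?mulr0 // mcoeffX; case: eqVneq => [e|_]; rewrite ?mulr0 //.
    by rewrite e (negbTE uf) in vf.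
  rewrite (bigD1_seq u) ?msupp_uniq //= big1_seq => [|v /andP[vu _]].
    by case: (V u); rewrite ?mcoeff0 ?mcoeffX ?eqxx ?mulr1 ?mulr0 addr0.
  by case: (V v); rewrite ?mcoeff0 ?mulr0 // mcoeffX (negbTE vu) mulr0.
apply: (hd_leq_inj (f := tr) sY hY (hd_mono_pol p V d)) => [f [fA [_ [fd _]]]|f [fA [_ [fd fq]]] f0].
  have fd' := dis_pol zp fA fd.
  split=> u; rewrite /= trE; case: ifP => [Vu /fd' //|_]; rewrite ?eqxx // ?Vu.
  by rewrite mem_mons => /andP[_ ->].
apply: hV => // [|u Vu]; first exact: (dis_pol zp fA fd).
by have := trE f u; rewrite Vu (f0 : tr f = 0) mcoeff0.
Qed.

(** Distractions never raise z-exponents, so [D f] is zero. *)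
Lemma dis_zlt f q : (forall u, f@_u != 0 -> (u z < q)%N) -> (forall v, (D f)@_v != 0 -> (q <= v z)%N) ->
  f = 0.
Proof.
move=> fq Dq; apply: (dis_inj (lambda := lambda) xz); apply/mpolyP => v; rewrite mcoeff0.
apply/eqP/negPn/negP => nz; have := Dq v nz; rewrite leqNgt => /negP; apply.
move: nz; rewrite mcoeff_mlin => nz.
have [u uf nd] : exists2 u, u \in msupp f & (dmon x z lambda u)@_v != 0.
  apply/hasP; apply: contraNT nz => /hasPn h; rewrite big1_seq // => u /h.
  by rewrite negbK => /eqP ->; rewrite mulr0.
have [s su ->] := dmon_supp nd; rewrite xsh_z //.
by apply: leq_ltn_trans (leq_subr _ _) _; apply: fq; rewrite -mcoeff_msupp.
Qed.

Lemma cnt_dstep_leq p A d q : (z < p)%N -> (0 < q -> z.+1 = p)%N ->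
  (cnt p (fun u => dstep p A u && (q <= u z)%N) d <= cnt p (fun u => A u && (q <= u z)%N) d)%N.
Proof.
move=> zp zq; apply: cnt_dstep_ge => // f fA _ Dq f0; apply: (@dis_zlt f q) => // u nz.
rewrite ltnNge; apply/negP => qu; move: (nz); rewrite f0 ?eqxx //=.
by have /andP[_ ->] := fA u nz.
Qed.

Lemma cnt_dstep p A d : (z < p)%N -> cnt p (dstep p A) d = cnt p A d.
Proof.
move=> zp; apply/eqP; rewrite eqn_leq; apply/andP; split.
  have := @cnt_dstep_leq p A d 0 zp (fun h => False_ind _ (notF h)).
  by rewrite /cnt !(eq_count (fun u => andbT _)).
pose Z (g : S) := dis_ideal x z lambda p A g /\ pol p d g /\ forall v, g@_v != 0 -> (0 <= v z)%N.
have sM := subsp_mono K p A.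
have sY : subsp (fun f => mono_sp (K := K) p A f /\ pol p d f).
  split; first by split; [case: sM | move=> u; rewrite mcoeff0 eqxx].
  move=> a f g [fA fd] [gA gd]; split; first exact: sM.2.
  move=> u; rewrite mcoeffD mcoeffZ; have [-> nz|/gd//] := eqVneq (g@_u) 0.
  by apply: fd; apply: contraNneq nz => ->; rewrite mulr0 addr0.
have sZ : subsp Z.
  have [M0 ML] := subsp_dis_ideal x z lambda p A.
  split; first by split=> //; split=> u; rewrite mcoeff0 eqxx.
  move=> a f g [fA [fd fq]] [gA [gd gq]]; split; first exact: ML.
  split=> u //; rewrite mcoeffD mcoeffZ.
  have [-> nz|/gd//] := eqVneq (g@_u) 0.
  by apply: fd; apply: contraNneq nz => ->; rewrite mulr0 addr0.
have hZ : hd Z (cnt p (dstep p A) d).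
  have -> : cnt p (dstep p A) d = cnt p (lead Z) d.
    by apply: eq_in_count => u um; rewrite (lead_dstep A zp um) // andbT.
  by apply: hd_pol sZ _ => g [_ []].
apply: (hd_leq_inj (f := D) sY (hd_mono_pol p A d) hZ) => [f [fA fd]|f _]; last exact: dis_inj.
by split; [exists f | split=> //; apply: pol_dis].
Qed.

(** The coordinate m can be left out. If all other coefficients of f with z-exponent at least q
    vanish, then the coefficient of [D f] at m x / z is that of f at m times minus the sum of the
    powers of lambda: the only other possible contribution is from m x / z itself, which is not in
    A. As z^q divides [D f], that coefficient is zero. *)
Lemma cnt_dstep_lt p A d q m : (z < p)%N -> (z.+1 = p)%N -> m \in mons n p d -> A m ->
    (m z = q)%N -> (0 < q)%N -> \sum_(i < q) lambda ^+ i != 0 ->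
    ~~ A (m - U_(z) + U_(x))%MM ->
  (cnt p (fun u => dstep p A u && (q <= u z)%N) d < cnt p (fun u => A u && (q <= u z)%N) d)%N.
Proof.
move=> zp zE mm Am mq q0 lq nA.
pose P := fun u => A u && (q <= u z)%N; pose V := predD1 P m.
have cP : cnt p P d = (cnt p V d).+1.
  have /permP pe := perm_to_rem mm; rewrite /cnt !pe /= eqxx add0n.
  rewrite /P Am mq leqnn add1n; congr _.+1; apply: eq_in_count => u.
  by rewrite mem_rem_uniq ?mons_uniq // inE => /andP[um _]; rewrite /V /= um.
rewrite -/P cP ltnS; apply: cnt_dstep_ge => // f fA fd Dq f0.
have fm u : f@_u != 0 -> u != m -> (u z < q)%N.
  move=> nz um; rewrite ltnNge; apply/negP => qu; move: (nz); rewrite f0 ?eqxx //=.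
  by rewrite um /P qu andbT; have /andP[_ ->] := fA u nz.
have fm0 : f@_m = 0.
  apply/eqP/negPn/negP => nm; have mx : (m - U_(z) + U_(x))%MM = xsh x z m 1 by [].
  have /eqP : (D f)@_(xsh x z m 1) = 0.
    by apply/eqP/negPn/negP => /Dq; rewrite xsh_z // mq subn1 leqNgt prednK // leqnn.
  rewrite mcoeff_mlin (bigD1_seq m) ?msupp_uniq ?mcoeff_msupp //= big1_seq ?addr0.
    rewrite dmon_coeff // ?mq // dcf1 mulf_eq0 oppr_eq0 (negbTE lq) orbF.
    by rewrite (negbTE nm).
  move=> u /andP[um]; rewrite mcoeff_msupp => nz.
  rewrite dmon_coeff_ge //; last first.
    by rewrite xsh_z // mq subn1 -ltnS prednK // fm.
  case: eqP => [e|_]; last by rewrite mulr0.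
  by case/negP: nA; rewrite mx -e; have /andP[_ ->] := fA u nz.
apply: (@dis_zlt f q) => // u nz; apply: fm => //.
by apply: contraNneq nz => ->; rewrite fm0.
Qed.

End DistractionInitial.

Section DistractionMonomials.
Variables (n : nat) (K : fieldType) (x z : 'I_n) (lambda : K) (p : nat).
Hypotheses (xz : (x < z)%N) (zp : (z < p)%N).
Implicit Types (A : pred 'X_{1..n}) (u v : 'X_{1..n}).

(** The term of [dmon u] in which every z has become x has the least z-exponent, and its coefficient
    is a power of lambda up to sign. *)
Lemma dstep_move A u : lambda != 0 -> Mon p u -> A u ->
  dstep x z lambda p A (xsh x z u (u z)).
Proof.
move=> nz Mu Au; apply/asbP; exists (dmon x z lambda u).
  split; last by rewrite dmon_coeff // dcf_diag_neq0.
  exists 'X_[u]; last by rewrite /dis mlinX.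
  by move=> v; rewrite mcoeffX; case: (eqVneq u v) => [<-|_]; rewrite ?eqxx // Mu.
move=> v /dmon_supp[s su ->]; rewrite mem_mons !mdeg_xsh // eqxx Mon_xsh //; split=> //.
move: su; rewrite leq_eqVlt => /predU1P[->|su]; first by rewrite eqxx.
apply/orP; right; apply/rltP; exists z; first by rewrite !xsh_z // subnn subn_gt0.
move=> j zj; have jx : (x == j) = false.
  by apply/eqP => e; move: zj; rewrite -e ltnNge (ltnW xz).
have jz : (z == j) = false by apply/eqP => e; move: zj; rewrite e ltnn.
by rewrite !xshE jx jz !mul0n.
Qed.

Lemma dstep_fix A u : lambda != 0 -> Mon p u -> A u -> u z = 0%N -> dstep x z lambda p A u.
Proof. by move=> nz Mu Au uz; have := dstep_move nz Mu Au; rewrite uz xsh0. Qed.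

Lemma dmon_fix u : u z = 0%N -> dmon x z lambda u = 'X_[u].
Proof. by move=> uz; rewrite /dmon uz big_ord1 dcf0 scale1r xsh0. Qed.

Lemma Mon_pow (i : 'I_n) b : (i < p)%N -> Mon p (U_(i) *+ b)%MM.
Proof.
move=> ip; apply/MonP => l pl; rewrite mulmnE mnm1E; case: eqP => // e.
by move: pl; rewrite -e leqNgt ip.
Qed.

(** When the middle coefficients vanish, the distraction of z^b is z^b + c x^b with c =
    [dcf lambda b b]. Since x^b is fixed, z^b - c x^b is sent to z^b. *)
Lemma dstep_pow A b : (0 < b)%N -> A (U_(z) *+ b)%MM -> A (U_(x) *+ b)%MM ->
  (forall s, (0 < s < b)%N -> dcf lambda b s = 0) -> dstep x z lambda p A (U_(z) *+ b)%MM.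
Proof.
move=> b0 Az Ax cs; have xp := ltn_trans xz zp.
have xz' : (x == z) = false by apply: neq_xz.
apply/asbP; exists 'X_[U_(z) *+ b]; last first.
  by move=> v; rewrite mcoeffX; case: (eqVneq _ v) => [<-|_]; rewrite ?eqxx // mem_mons eqxx Mon_pow.
split; last by rewrite mcoeffX eqxx oner_neq0.
exists ('X_[U_(z) *+ b] - dcf lambda b b *: 'X_[U_(x) *+ b]).
  have sM := subsp_mono K p A.
  apply: (subspB sM); last apply: (subspZ _ sM).
    by move=> v; rewrite mcoeffX; case: (eqVneq _ v) => [<-|_]; rewrite ?eqxx // Mon_pow.
  by move=> v; rewrite mcoeffX; case: (eqVneq _ v) => [<-|_]; rewrite ?eqxx // Mon_pow.
rewrite linearB linearZ /= /dis !mlinX [X in _ - _ *: X]dmon_fix; last first.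
  by rewrite mulmnE mnm1E xz'.
have zz : (U_(z) *+ b)%MM z = b by rewrite mulmnE mnm1E eqxx mul1n.
rewrite /dmon zz; case: b b0 cs {Az Ax} zz => // b _ cs zz.
rewrite big_ord_recl big_ord_recr big1 => [|s _] /=; last first.
  by have := ltn_ord s; rewrite -ltnS => hs; rewrite cs ?scale0r.
rewrite -/(dcf lambda b.+1 0) dcf0 scale1r xsh0 add0r /bump add1n.
rewrite (_ : xsh x z _ b.+1 = (U_(x) *+ b.+1)%MM) ?addrK //.
by apply/mnmP => i; rewrite xshE !mulmnE !mnm1E subnn add0n.
Qed.

(** The product defining the distraction of z^q, at x = 1. *)
Lemma dcf_poly q :
  \sum_(s < q.+1) dcf lambda q s *: 'X^(q - s) = \prod_(i < q) ('X - (lambda ^+ i)%:P).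
Proof.
elim: q => [|q IH]; first by rewrite big_ord1 big_ord0 dcf0 subnn expr0 scale1r.
rewrite [RHS]big_ord_recr /= -IH mulrBr [X in _ = X - _]mulr_suml [X in _ = _ - X]mulr_suml.
under eq_bigr do rewrite dcfS scalerBl.
rewrite sumrB big_ord_recr /= dcf_gt // scale0r addr0; congr (_ - _).
  apply: eq_bigr => s _; rewrite -scalerAl -exprSr subSn // -ltnS.
  exact: ltn_ord.
rewrite big_ord_recl /= scale0r add0r; apply: eq_bigr => s _.
by rewrite /bump add1n subSS [RHS]mulrC mul_polyC scalerA.
Qed.

Lemma dcf_prim b s : b.-primitive_root lambda -> (0 < s < b)%N -> dcf lambda b s = 0.
Proof.
move=> prim /andP[s0 sb]; have := dcf_poly b.
rewrite -(big_mkord xpredT (fun i => 'X - (lambda ^+ i)%:P)) factor_Xn_sub_1 //.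
move/(congr1 (fun P : {poly K} => P`_(b - s))); rewrite coefB coefXn coef1.
rewrite subn_eq0 leqNgt sb subr0 coef_sum.
have lt_sb : (s < b.+1)%N by apply: ltnW.
rewrite (bigD1 (Ordinal lt_sb)) //= coefZ coefXn eqxx mulr1 big1 ?addr0 => [->|t ts].
  by rewrite ltn_eqF // ltn_subrL s0 (leq_ltn_trans _ sb).
rewrite coefZ coefXn; case: eqP => [e|_]; last by rewrite mulr0.
case/eqP: ts; apply: val_inj => /=.
have tb : (t <= b)%N by rewrite -ltnS.
by rewrite -(subKn tb) -e subKn // ltnW.
Qed.

(** Multiplied by lambda - 1 the sum becomes lambda^q - 1, and b does not divide q. *)
Lemma sum_prim b q : b.-primitive_root lambda -> (0 < q < b)%N -> \sum_(i < q) lambda ^+ i != 0.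
Proof.
move=> prim /andP[q0 qb]; apply: contraTneq qb => e; rewrite -leqNgt dvdn_leq //.
by rewrite (prim_order_dvd prim) -subr_eq0 subrX1 e mulr0.
Qed.

End DistractionMonomials.

Lemma ltn_sum_one (J : finType) (F G : J -> nat) j0 :
  (forall j, (F j <= G j)%N) -> (F j0 < G j0)%N -> (\sum_j F j < \sum_j G j)%N.
Proof.
move=> le lt; rewrite (bigD1 j0) // [X in (_ < X)%N](bigD1 j0) //= -addSn.
by apply: leq_add => //; apply: leq_sum.
Qed.

(** * Stability in the last variable *)

Section Stabilization.
Variables (n : nat) (K : fieldType).
Hypothesis K_char0 : [pchar K] =i pred0.
Hypothesis K_roots : forall b, (0 < b)%N -> exists lambda : K, b.-primitive_root lambda.
Variables (E : 'I_n -> nat).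
Hypothesis E_mono : forall i j : 'I_n, (i <= j)%N -> (0 < E j)%N -> (0 < E i <= E j)%N.
Implicit Types (A : pred 'X_{1..n}) (u v : 'X_{1..n}).

(* E i = 0 stands for an infinite exponent. *)
Definition PE u : bool := [exists i : 'I_n, (0 < E i)%N && (E i <= u i)%N].

Definition contains_PE p A : Prop := forall u, Mon p u -> PE u -> A u.

(** Stability is demanded only below z^(E z), whose multiples belong to the ideal for another
    reason. The bound d on degrees makes the weight in [stabilize] a finite sum. *)
Definition zstable p (z : 'I_n) d A : Prop := forall u (j : 'I_n), Mon p u -> (mdeg u <= d)%N ->
  A u -> (0 < u z)%N -> (0 < E z -> u z < E z)%N -> (j < z)%N -> A (u - U_(z) + U_(j))%MM.

Lemma up_mulm p A u v : up p A -> Mon p u -> Mon p v -> A u -> A (u + v)%MM.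
Proof.
move=> upA Mu; elim: {v}(mdeg v) {-2}v (erefl (mdeg v)) => [|d IH] v dv Mv Au.
  by move/eqP: dv; rewrite mdeg_eq0 => /eqP ->; rewrite addm0.
have [i vi] : exists i, (0 < v i)%N.
  apply/existsP; apply: contraT; rewrite negb_exists => /forallP h.
  by move: dv; rewrite mdegE big1 // => i _; apply/eqP; rewrite -leqn0 leqNgt h.
have e : v = (U_(i) + (v - U_(i)))%MM by rewrite addmC submK // lep1mP -lt0n.
move: (Mv); rewrite {1}e MonD Mon1 => /andP[ip Mv'].
rewrite e addmA (addmC u) -addmA; apply: upA => //; first by rewrite MonD Mu.
apply: IH => //; apply/eqP; rewrite -eqSS -dv {2}e mdegD mdeg1 add1n.
by [].
Qed.

Lemma contains_PEP p A : up p A -> (forall i : 'I_n, (i < p)%N -> (0 < E i)%N -> A (U_(i) *+ E i)%MM) ->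
  contains_PE p A.
Proof.
move=> upA h u Mu /existsP[i /andP[Ei ui]].
have ip : (i < p)%N.
  by rewrite ltnNge; apply/negP => pi; move: ui; rewrite (elimT (MonP p u) Mu) // leqNgt Ei.
have le : (U_(i) *+ E i <= u)%MM.
  by apply/mnm_lepP => j; rewrite mulmnE mnm1E; case: eqP => [<-|_]; rewrite ?mul1n.
rewrite -(submK le) addmC; apply: (up_mulm upA); [exact: Mon_pow| |exact: h].
by move: Mu; rewrite -{1}(submK le) MonD => /andP[].
Qed.

Lemma PE_pow (i : 'I_n) b : (0 < E i <= b)%N -> PE (U_(i) *+ b)%MM.
Proof. by move=> h; apply/existsP; exists i; rewrite mulmnE mnm1E eqxx mul1n. Qed.

(** A violation (u, j) is attacked by distracting z into the variable j. The Hilbert function stays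
    the same and [wt], the sum of all [u z + 1] over the members u of degree at most d, drops. *)
Lemma stabilize p (z : 'I_n) d A : z.+1 = p -> up p A -> contains_PE p A ->
  exists A', [/\ up p A', contains_PE p A', zstable p z d A',
    forall e, cnt p A' e = cnt p A e & forall i j, (rk K p i A' j <= rk K p i A j)%N].
Proof.
move=> zE; have zp : (z < p)%N by rewrite -zE.
pose wt B := (\sum_(e < d.+1) \sum_(q < d.+1) cnt p (fun u => B u && (q <= u z)%N) e)%N.
elim: {A}(wt A).+1 {-2}A (ltnSn (wt A)) => [//|w IH] A; rewrite ltnS => wtA upA PA.
have [st|nst] := classic (zstable p z d A); first by exists A; split.
have [u [j [[Mu du Au u0] uE jz nA]]] : exists u (j : 'I_n),
    [/\ [/\ Mon p u, (mdeg u <= d)%N, A u & (0 < u z)%N], (0 < E z -> u z < E z)%N, (j < z)%N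
      & ~~ A (u - U_(z) + U_(j))%MM].
  apply: NNPP => no; apply: nst => u j Mu du Au u0 uE jz; apply: contraT => nA.
  by case: no; exists u, j; split.
(* Without a power of z to preserve, lambda = 1 works: the sum is [u z], nonzero in characteristic
   zero. Otherwise a primitive root of order [E z] is taken, and [u z < E z] keeps the sum
   nonzero. *)
have [lambda [l0 lu lE]] : exists lambda : K, [/\ lambda != 0, \sum_(i < u z) lambda ^+ i != 0
    & (0 < E z)%N -> forall s, (0 < s < E z)%N -> dcf lambda (E z) s = 0].
  case: (posnP (E z)) uE => [->|E0] uE.
    exists 1; split=> //; first exact: oner_neq0.
    under eq_bigr do rewrite expr1n.
    by rewrite sumr_const card_ord; move/pcharf0P: K_char0 => ->; rewrite -lt0n.
  have [lambda prim] := K_roots E0; exists lambda; split=> [||_ s]; last exact: dcf_prim.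
    apply/eqP => l0; have := prim_expr_order prim; rewrite l0 expr0n gtn_eqF //.
    by move/eqP; rewrite eq_sym oner_eq0.
  by apply: (sum_prim prim); rewrite u0 uE.
pose A1 := dstep j z lambda p A.
have upA1 : up p A1 by exact: up_dstep.
have PA1 : contains_PE p A1.
  apply: contains_PEP => // i ip Ei; have [iz|iz] := eqVneq i z.
    (* To keep z^(E z), the same power of the variable j must be in A. It is, because
       [E j <= E z]. *)
    rewrite iz in Ei *; apply: dstep_pow => //; last exact: lE.
      by apply: PA; [apply: Mon_pow | apply: PE_pow; rewrite Ei leqnn].
    apply: PA; first by apply: Mon_pow; apply: ltn_trans zp.
    by apply: PE_pow; apply: E_mono => //; apply: ltnW.
  apply: dstep_fix => //; first exact: Mon_pow.
    by apply: PA; [apply: Mon_pow | apply: PE_pow; rewrite Ei leqnn].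
  by rewrite mulmnE mnm1E (negbTE iz).
have cA1 e : cnt p A1 e = cnt p A e by exact: cnt_dstep.
have [||//|A' [upA' PA' stA' cA' rA']] := IH A1.
- apply: leq_trans wtA; rewrite /wt.
  have lt_du : (mdeg u < d.+1)%N by [].
  have lt_uz : (u z < d.+1)%N.
    by rewrite ltnS (leq_trans _ du) // mdegE (bigD1 z) //= leq_addr.
  apply: (@ltn_sum_one _ _ _ (Ordinal lt_du)) => [e|].
    by apply: leq_sum => q _; apply: cnt_dstep_leq.
  apply: (@ltn_sum_one _ _ _ (Ordinal lt_uz)) => [q|] /=; first exact: cnt_dstep_leq.
  by apply: (cnt_dstep_lt jz zp zE _ Au erefl u0 lu nA); rewrite mem_mons eqxx.
- exact: upA1.
exists A'; split=> // [e|i l]; first by rewrite cA'.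
by apply: leq_trans (rA' i l) _; apply: rk_dis.
Qed.

End Stabilization.

(** * Independence of the ranks from the field in characteristic zero *)

Section FieldIndependence.
Variable n : nat.
Implicit Types (F : {set {set 'I_n}}) (T : {set 'I_n}).

Lemma ratr_frac (K : fieldType) (a : rat) (m d : int) : [pchar K] =i pred0 -> d != 0 ->
  a * d%:~R = m%:~R -> @ratr K a = m%:~R / d%:~R.
Proof.
move=> K0 d0 e.
have nz (l : int) : l != 0 -> l%:~R != 0 :> K.
  case: l => l; last by rewrite -[(Negz l)%:~R]/(- l.+1%:R) oppr_eq0; move/pcharf0P: K0 => ->.
  by rewrite -pmulrn; move/pcharf0P: K0 => ->.
rewrite /ratr; apply/eqP; rewrite eqr_div ?nz ?denq_eq0 // -!intrM; apply/eqP.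
congr _%:~R; apply: (@intr_inj rat); rewrite !intrM numqE -e.
by rewrite mulrAC.
Qed.

Lemma ratr_morphism (K : fieldType) : [pchar K] =i pred0 -> exists f : {rmorphism rat -> K}, True.
Proof.
move=> K0.
have fE (a : rat) : a * (denq a)%:~R = (numq a)%:~R by rewrite numqE.
have nz (a : rat) : (denq a)%:~R != 0 :> K.
  case: (ratP a) => m d _; rewrite -pmulrn; move/pcharf0P: K0 => ->.
  by [].
have add : zmod_morphism (@ratr K).
  move=> a b; rewrite (@ratr_frac K (a - b) (numq a * denq b - numq b * denq a) (denq a * denq b)) //.
  - by rewrite rmorphB !rmorphM /ratr /=; field; rewrite !nz.
  - by rewrite mulf_neq0 ?denq_eq0.
  by rewrite rmorphB !rmorphM /= -!fE; ring.
have mul : monoid_morphism (@ratr K).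
  split=> [|a b]; first by rewrite /ratr divr1.
  rewrite (@ratr_frac K (a * b) (numq a * numq b) (denq a * denq b)) //.
  - by rewrite !rmorphM -mulf_div.
  - by rewrite mulf_neq0 ?denq_eq0.
  by rewrite !rmorphM /= -!fE; ring.
pose f := HB.pack_for {rmorphism rat -> K} (@ratr K)
  (GRing.isZmodMorphism.Build rat K (@ratr K) add)
  (GRing.isMonoidMorphism.Build rat K (@ratr K) mul).
by exists f.
Qed.

Definition bdmx (K : fieldType) F : 'M[K]_(#|F|, #|{set 'I_n}|) :=
  \matrix_(i, j) bd (delta_ffun K (enum_val i)) (enum_val j).

Lemma rho_rank (K : fieldType) F : rho K F = \rank (bdmx K F).
Proof.
pose W1 : vectType K := {ffun {set 'I_n} -> K^o}.
apply: (hd_uniq (hd_vspace (linfun (bd (K := K)) @: coordsp K F))).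
pose M := bdmx K F; pose tau (v : 'rV[K]_#|{set 'I_n}|) : W1 := [ffun T => v 0 (enum_rank T)].
have tau_inj v : tau v = 0 -> v = 0.
  move/ffunP => v0; apply/rowP => j; have := v0 (enum_val j).
  by rewrite !ffunE enum_valK mxE.
have tauB v w : tau (v - w) = tau v - tau w.
  by apply/ffunP => T; rewrite !ffunE !mxE.
have tau_sum m (c : 'I_m -> K) (v : 'I_m -> 'rV_#|{set 'I_n}|) :
    tau (\sum_i c i *: v i) = \sum_i c i *: tau (v i).
  apply/ffunP => T; rewrite ffunE sum_ffunE summxE; refine (eq_bigr _ _) => i _.
  by rewrite !ffunE mxE.
have imP w : w \in (linfun (bd (K := K)) @: coordsp K F)%VS <-> exists c : 'rV_#|F|, w = tau (c *m M).
  have bdM (c : 'rV[K]_#|F|) : tau (c *m M) = bd (\sum_i c 0 i *: delta_ffun K (enum_val i)).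
    rewrite linear_sum; apply/ffunP => T; rewrite ffunE mxE sum_ffunE.
    by refine (eq_bigr _ _) => i _; rewrite linearZ ffunE mxE enum_rankK.
  split=> [/memv_imgP[v vF ->]|[c ->]].
    exists (\row_i v (enum_val i)); rewrite bdM lfunE /= {1}(ffun_sum_delta vF) big_enum_val /=.
    by congr bd; apply: eq_bigr => i _; rewrite mxE.
  apply/memv_imgP; exists (\sum_i c 0 i *: delta_ffun K (enum_val i)); last by rewrite lfunE bdM.
  by apply: rpred_sum => i _; apply: rpredZ; rewrite delta_coordsp enum_valP.
exists (fun i => tau (row i (row_base M))); split=> [i|c h|w /imP[c ->]].
- have /submxP[D De] : (row_base M <= M)%MS by rewrite eq_row_base.
  by apply/imP; exists (row i D); rewrite De row_mul.
- move: h; rewrite -tau_sum => /tau_inj h.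
  have /row_free_inj inj := row_base_free M.
  have /rowP e : \row_i c i = 0 :> 'rV_(\rank M).
    apply: inj; rewrite mul0mx mulmx_sum_row -[RHS]h; apply: eq_bigr => i _.
    by rewrite mxE.
  by move=> i; have := e i; rewrite !mxE.
have /submxP[D De] : (c *m M <= row_base M)%MS by rewrite eq_row_base submxMl.
exists (fun i => D 0 i); rewrite De -tau_sum -tauB.
rewrite mulmx_sum_row subrr; apply/ffunP => T; by rewrite !ffunE mxE.
Qed.

(* The boundary matrix has integer entries. *)
Lemma rho_char0 (K K' : fieldType) F :
  [pchar K] =i pred0 -> [pchar K'] =i pred0 -> rho K F = rho K' F.
Proof.
suff rhoQ (L : fieldType) : [pchar L] =i pred0 -> rho L F = rho rat F.
  by move=> /rhoQ -> /rhoQ ->.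
case/ratr_morphism => f _; rewrite !rho_rank -(mxrank_map f); congr (\rank _).
apply/matrixP => i j; rewrite !mxE !bdE rmorph_sum; refine (eq_bigr _ _) => l _.
by rewrite !ffunE /GRing.scale /= rmorphM rmorphXn rmorphN1 rmorph_nat.
Qed.

Lemma rk_char0 (K K' : fieldType) p i A j :
  [pchar K] =i pred0 -> [pchar K'] =i pred0 -> rk (n := n) K p i A j = rk K' p i A j.
Proof. by move=> K0 K0'; apply: eq_bigr => m _; apply: rho_char0. Qed.

End FieldIndependence.

(** * Slices in the last variable *)

Section Cones.
Variables (n : nat) (K : fieldType).
Local Notation W1 := {ffun {set 'I_n} -> K^o}.
Implicit Types (F : {set {set 'I_n}}) (T : {set 'I_n}) (A : pred 'X_{1..n}) (u m : 'X_{1..n}).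
Local Notation bdf := (linfun (bd (n := n) (K := K))).
Local Notation coords F := (coordsp K F).

Lemma bd_bd (w : W1) : bd (bd w) = 0.
Proof.
have -> : bd (bd w) = \sum_(j < n) \sum_(l < n) pd j (pd l w).
  by rewrite {1}/bd; apply: eq_bigr => j _; rewrite /bd linear_sum.
pose a (j l : 'I_n) : W1 := pd j (pd l w).
have -> : \sum_(j < n) \sum_(l < n) pd j (pd l w) =
    \sum_(j < n) \sum_(l < n | (l < j)%N) a j l + \sum_(j < n) \sum_(l < n | (j < l)%N) a j l.
  rewrite -big_split; refine (eq_bigr _ _) => j _ /=.
  rewrite (bigID (fun l : 'I_n => (l < j)%N)) /=; congr (_ + _).
  rewrite (bigD1 j) ?ltnn //= /a pd_pd_same add0r; apply: eq_bigl => l.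
  by rewrite -leqNgt -(inj_eq val_inj) /= andbC eq_sym -ltn_neqAle.
rewrite [X in _ + X](exchange_big_dep xpredT) //= -big_split big1 //= => j _.
rewrite -big_split big1 //= => l lj; rewrite /a pd_pd ?addNr //.
by rewrite -(inj_eq val_inj) /= (gtn_eqF lj).
Qed.

Lemma bd_ex v (w : W1) : bd (ex v w) = w - ex v (bd w).
Proof.
rewrite /bd linear_sum /= (bigD1 v) //= [X in _ = _ - X](bigD1 v) //= opprD addrA.
rewrite -[X in _ = X - _ - _](pd_ex_same v) addrK; congr (_ + _).
by rewrite -sumrN; apply: eq_bigr => j jx; rewrite pd_ex.
Qed.

(** A mapping cone: a + e_z b has boundary (bd a + b) - e_z (bd b). The part free of z determines
    the rest, since b = - bd a implies bd b = 0. *)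
Lemma rho_cone (z : 'I_n) F0 F1 F :
    (forall T, T \in F0 -> z \notin T) -> (forall T, T \in F1 -> z \notin T) ->
    (forall T, z \notin T -> (T \in F) = (T \in F0)) ->
    (forall T, z \notin T -> (z |: T \in F) = (T \in F1)) ->
  rho K F = \dim (bdf @: coords F0 + coords F1).
Proof.
move=> z0 z1 FF0 FF1.
pose pi := linfun (@restr n K [set T : {set 'I_n} | z \notin T]).
have coordz (G : {set {set 'I_n}}) (w : W1) : (forall T, T \in G -> z \notin T) -> w \in coords G ->
    forall T, z \in T -> w T = 0.
  by move=> Gz /coordspP wG T zT; apply: wG; apply: contraL zT => /Gz.
have bdz (a : W1) : (forall T, z \in T -> a T = 0) -> forall T, z \in T -> bd a T = 0.
  move=> az T zT; rewrite bdE big1 // => j _.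
  by rewrite az ?scaler0 // inE zT orbT.
have dec (w : W1) : w \in coords F -> exists a b, [/\ a \in coords F0, b \in coords F1 & w = a + ex z b].
  move=> /coordspP wF; exists (w - ex z (pd z w)), (pd z w); split; last by rewrite subrK.
    apply/coordspP => T TF; rewrite !ffunE; case: (boolP (z \in T)) => zT; last first.
      by rewrite subr0 wF // FF0.
    rewrite !inE eqxx /= setD1K // scalerA -exprD (sgnD1 z zT) ltnn add0n.
    by rewrite -signr_odd oddD addbb scale1r subrr.
  apply/coordspP => T TF; rewrite ffunE; case: ifPn => // zT.
  by rewrite wF ?scaler0 // FF1.
have piE (a b : W1) : (forall T, z \in T -> a T = 0) -> (forall T, z \in T -> b T = 0) ->
    pi (bdf (a + ex z b)) = bd a + b.
  move=> az bz; rewrite [bdf _]lfunE /pi lfunE linearD /= linearD /= bd_ex; apply/ffunP => T; rewrite !ffunE inE.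
  case: (boolP (z \in T)) => zT /=; last by rewrite subr0.
  by rewrite bz // bdz // addr0.
have pi_im : (pi @: (bdf @: coords F) = bdf @: coords F0 + coords F1)%VS.
  apply/eqP; rewrite eqEsubv; apply/andP; split; apply/subvP => v.
    move=> /memv_imgP[_ /memv_imgP[w wF ->] ->]; have [a [b [aF bF ->]]] := dec w wF.
    rewrite piE; [|exact: coordz aF|exact: coordz bF].
    by apply: memv_add => //; apply/memv_imgP; exists a; rewrite ?lfunE.
  move=> /memv_addP[_ /memv_imgP[a aF ->] [b bF ->]].
  have az := coordz _ _ z0 aF; have bz := coordz _ _ z1 bF.
  apply/memv_imgP; exists (bdf (a + ex z b)); last by rewrite piE // lfunE.
  apply: memv_img; apply/coordspP => T TF; rewrite !ffunE.
  case: (boolP (z \in T)) => zT.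
    rewrite az // add0r; have /coordspP -> := bF; rewrite ?scaler0 //.
    by rewrite -FF1 ?setD1K // setD11.
  by rewrite addr0; have /coordspP -> := aF; rewrite // -FF0.
rewrite -pi_im limg_dim_eq //; apply/eqP; rewrite -subv0; apply/subvP => v.
rewrite memv_cap memv_ker => /andP[/memv_imgP[w wF ->] /eqP].
have [a [b [aF bF ->]]] := dec w wF; rewrite piE; last first.
- exact: coordz bF.
- exact: coordz aF.
rewrite memv0 lfunE /= linearD /= bd_ex addrA => ab; rewrite ab add0r.
have -> : b = - bd a by apply/eqP; rewrite -addr_eq0 addrC ab.
by rewrite (raddfN (bd (K := K))) /= bd_bd !oppr0 linear0 oppr0.
Qed.

(** The simplex on the nonempty support of m is acyclic. So the boundaries meet the span of J
    exactly in its cycles, and modulo these the span of J has dimension [rho K J]. *)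
Lemma dim_cycle_sum i m (J : {set {set 'I_n}}) : m != 0%MM -> J \subset fam i predT m ->
  \dim (bdf @: coords (fam i.+1 predT m) + coords J) = (rho K (fam i.+1 predT m) + rho K J)%N.
Proof.
move=> m0 /subsetP JF; set X := (bdf @: _)%VS; set Y := coords J.
have XY : (X :&: Y = Y :&: lker bdf)%VS.
  apply/eqP; rewrite eqEsubv; apply/andP; split; apply/subvP => w; rewrite !memv_cap [w \in lker _]memv_ker.
    by move=> /andP[/memv_imgP[v _ ->] ->]; rewrite !lfunE /= bd_bd eqxx.
  case/andP => wJ; rewrite wJ lfunE andbT /= => /eqP w0.
  have [v mv] : exists v, (0 < m v)%N.
    apply/existsP; apply: contraNT m0; rewrite negb_exists => /forallP h.
    by apply/eqP/mnmP => v; rewrite mnm0E; apply/eqP; rewrite -leqn0 leqNgt h.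
  apply/memv_imgP; exists (ex v w); last by rewrite lfunE /= bd_ex w0 linear0 subr0.
  apply/coordspP => T TF; rewrite ffunE; case: ifPn => // vT.
  have /coordspP -> := wJ; rewrite ?scaler0 //; apply: contra TF => /JF; rewrite !inE !andbT.
  rewrite (cardsD1 v T) vT add1n eqSS => /andP[-> /= le].
  by rewrite -(setD1K vT) lem_msetU1 ?setD11 // le mnmBE msetE setD11 subn0.
have := limg_ker_dim bdf Y; rewrite -XY => h.
by apply: (@addIn (\dim (X :&: Y))); rewrite dimv_sum_cap -h addnA addnAC.
Qed.

Definition slice (z : 'I_n) A t : pred 'X_{1..n} := fun u => A (u + U_(z) *+ t)%MM.

Lemma slice0 z A : slice z A 0 =1 A.
Proof. by move=> u; rewrite /slice mulm0n addm0. Qed.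

Section Slices.
Variable z : 'I_n.
Implicit Type t : nat.

Lemma Mon_z u : Mon z u -> u z = 0%N.
Proof. by move/MonP; apply. Qed.

Lemma Mon_shift u t : Mon z.+1 (u + U_(z) *+ t)%MM = Mon z.+1 u.
Proof. by rewrite MonD Mon_pow // andbT. Qed.

Lemma MonW p q u : (p <= q)%N -> Mon p u -> Mon q u.
Proof. by move=> pq /MonP h; apply/MonP => l ql; apply: h; apply: leq_trans ql. Qed.

Lemma perm_mons_slices j :
  perm_eq (mons n z.+1 j)
    (flatten [seq [seq (m + U_(z) *+ t)%MM | m <- mons n z (j - t)] | t <- iota 0 j.+1]).
Proof.
apply: uniq_perm; first exact: mons_uniq.
  apply: allpairs_uniq_dep; [exact: iota_uniq | by move=> t _; apply: mons_uniq |].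
  move=> _ _ /allpairsPdep[t [m [_ mm ->]]] /allpairsPdep[s [l [_ ll ->]]] /= e.
  have mz : m z = 0%N by move: mm; rewrite mem_mons => /andP[_ /Mon_z].
  have lz : l z = 0%N by move: ll; rewrite mem_mons => /andP[_ /Mon_z].
  have ts : t = s.
    have := congr1 (fun u : 'X_{1..n} => u z) e.
    by rewrite /= !mnmDE !mulmnE mnm1E eqxx !mul1n mz lz.
  by move: e; rewrite ts => /addIm ->.
move=> m; apply/idP/allpairsPdep => [|[t [u [tj]]]]; last first.
  move: tj; rewrite mem_iota add0n ltnS /= => tj; rewrite !mem_mons => /andP[/eqP du Mu] ->.
  rewrite Mon_shift mdegD mdegMn mdeg1 mul1n du subnK // eqxx.
  by apply: MonW Mu.
rewrite mem_mons => /andP[/eqP dm Mm].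
have le : (U_(z) *+ m z <= m)%MM.
  by apply/mnm_lepP => l; rewrite mulmnE mnm1E; case: eqP => [<-|_]; rewrite ?mul1n.
have dm' : (mdeg (m - U_(z) *+ m z) + m z)%N = j.
  by rewrite -dm -[in RHS](submK le) mdegD mdegMn mdeg1 mul1n.
exists (m z), (m - U_(z) *+ m z)%MM; split; last by rewrite submK.
  by rewrite mem_iota add0n ltnS -dm' leq_addl.
rewrite mem_mons -dm' addnK eqxx; apply/MonP => l; rewrite leq_eqVlt => /orP[/eqP/val_inj <-|zl].
  by rewrite mnmBE mulmnE mnm1E eqxx mul1n subnn.
by rewrite mnmBE (MonP _ _ Mm).
Qed.

Lemma sum_slices (f : 'X_{1..n} -> nat) j :
  (\sum_(m <- mons n z.+1 j) f m =
   \sum_(t < j.+1) \sum_(m <- mons n z (j - t)) f (m + U_(z) *+ t)%MM)%N.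
Proof.
rewrite (perm_big _ (perm_mons_slices j)) big_allpairs_dep.
by rewrite -[iota 0 j.+1]/(index_iota 0 j.+1) big_mkord.
Qed.

Lemma cnt_slices A j : cnt z.+1 A j = (\sum_(t < j.+1) cnt z (slice z A t) (j - t))%N.
Proof.
rewrite /cnt -sum1_count big_mkcond sum_slices; apply: eq_bigr => t _.
by rewrite -sum1_count [RHS]big_mkcond.
Qed.

Lemma mset_le_shift m T t : z \notin T ->
  (mset T <= m + U_(z) *+ t)%MM = (mset T <= m)%MM.
Proof.
move=> zT; apply/lem_msetP/lem_msetP => h i iT; have := h i iT;
  rewrite mnmDE mulmnE mnm1E; case: eqVneq iT => [<-|_ _]; rewrite ?mul0n ?addn0 //.
- by rewrite (negbTE zT).
- by rewrite (negbTE zT).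
Qed.

Lemma sub_shift m T t : (mset T <= m)%MM ->
  (m + U_(z) *+ t - mset T = m - mset T + U_(z) *+ t)%MM.
Proof.
move=> le; apply/mnmP => i; rewrite !(mnmDE, mnmBE) addnBAC //.
by move/mnm_lepP: le; apply.
Qed.

(** Sets without z see slice t + 1. Sets with z use up one factor z and see slice t. *)
Lemma rho_slice i A m t : Mon z m ->
  rho K (fam i.+1 A (m + U_(z) *+ t.+1)%MM) =
  \dim (bdf @: coords (fam i.+1 (slice z A t.+1) m) + coords (fam i (slice z A t) m)).
Proof.
move=> Mm; have mz := Mon_z Mm.
have zfam i' B T : T \in fam i' B m -> z \notin T.
  by rewrite inE => /and3P[_ /lem_msetP h _]; apply/negP => /h; rewrite mz.
apply: (rho_cone (z := z)) => [T|T|T zT|T zT]; [exact: zfam|exact: zfam| |].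
  rewrite !inE mset_le_shift //; case: (#|T| == i.+1) => //=.
  by case: (boolP (mset T <= m)%MM) => //= le; rewrite sub_shift.
rewrite !inE cardsU1 zT add1n eqSS; case: (#|T| == i) => //=.
rewrite lem_msetU1 // mset_le_shift //; case: (boolP (mset T <= m)%MM) => //= le.
rewrite sub_shift // mnmDE mulmnE mnm1E eqxx mul1n addnS /=.
rewrite /slice subkU1 // sub_shift // mulmSr addmA.
by rewrite addmK.
Qed.

End Slices.

End Cones.

Section RankStep.
Variables (n : nat) (K : fieldType) (E : 'I_n -> nat) (z : 'I_n).
Implicit Types (F : {set {set 'I_n}}) (T : {set 'I_n}) (A L B : pred 'X_{1..n}) (u m : 'X_{1..n}).
Local Notation bdf := (linfun (bd (n := n) (K := K))).
Local Notation coords F := (coordsp K F).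

(** Each added basis vector raises the rank by at most one. In other words, the number of cycles
    grows with the family. *)
Lemma rho_le_card F F' : F \subset F' -> (rho K F' + #|F| <= rho K F + #|F'|)%N.
Proof.
move=> sF; have le : (coords F' <= coords F + coords (F' :\: F))%VS.
  apply/subvP => w /coordspP wF; rewrite -[w](subrK (restr F w)) addrC.
  apply: memv_add; apply/coordspP => T TF; rewrite !ffunE; first by rewrite (negbTE TF).
  move: TF; rewrite inE negb_and negbK => /orP[->|/wF ->]; first by rewrite subrr.
  by rewrite if_same subr0.
have : (rho K F' <= rho K F + #|F' :\: F|)%N.
  apply: leq_trans (dimvS (limgS bdf le)) _; rewrite limgD.
  apply: leq_trans (dimv_add_leqif _ _) _; rewrite leq_add2l.
  by rewrite -(dim_coordsp K (F' :\: F)) -[leqRHS](limg_ker_dim bdf) leq_addl.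
rewrite -(cardsID F F') (setIidPr sF) => h.
by rewrite [X in (_ <= _ + X)%N]addnC addnA leq_add2r.
Qed.

Lemma famS i A B m p : Mon p m -> (forall u, Mon p u -> (mdeg u + i)%N = mdeg m -> A u -> B u) ->
  fam i A m \subset fam i B m.
Proof.
move=> Mm AB; apply/subsetP => T; rewrite !inE => /and3P[/eqP cT le Au].
rewrite cT eqxx le /=; apply: AB => //.
  by move: Mm; rewrite -{1}(submK le) MonD => /andP[].
by rewrite -cT -mdeg_mset -mdegD submK.
Qed.

Lemma rk_mono p i A B j : (forall u, Mon p u -> (mdeg u + i)%N = j -> A u -> B u) ->
  (rk K p i A j <= rk K p i B j)%N.
Proof.
move=> AB; rewrite /rk big_seq [leqRHS]big_seq; apply: leq_sum => m.
rewrite mem_mons => /andP[/eqP dm Mm]; apply/rhoS/(famS Mm) => u Mu du.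
by apply: AB; rewrite // -dm.
Qed.

Lemma rk_le_card p i A B j : (forall u, Mon p u -> (mdeg u + i)%N = j -> A u -> B u) ->
  (rk K p i B j + cfam p i A j <= rk K p i A j + cfam p i B j)%N.
Proof.
move=> AB; rewrite /rk /cfam -!big_split big_seq [leqRHS]big_seq; apply: leq_sum => m.
rewrite mem_mons => /andP[/eqP dm Mm]; apply/rho_le_card/(famS Mm) => u Mu du.
by apply: AB; rewrite // -dm.
Qed.

Lemma rk0 p A j : rk K p 0 A j = 0%N.
Proof.
rewrite /rk big1 // => m _; apply/eqP; rewrite dimv_eq0 -subv0; apply/subvP => v.
case/memv_imgP => w /coordspP wF ->; rewrite lfunE memv0; apply/eqP/ffunP => T.
rewrite /= bdE ffunE big1 // => j' jT.
by rewrite wF ?scaler0 // inE cardsU1 jT.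
Qed.

(** A term of the boundary multiplies the monomial by some x_l with l < z. Together with the drop of
    the slice index this is the move allowed by [zstable]. *)
Lemma bd_slice_sub i A m t d : zstable E z.+1 z d A -> Mon z m ->
    (0 < E z -> t.+1 < E z)%N -> (mdeg m + t.+1 <= d)%N ->
  (bdf @: coords (fam i.+1 (slice z A t.+1) m) <= coords (fam i (slice z A t) m))%VS.
Proof.
move=> stA Mm tE dm; apply/subvP => _ /memv_imgP[w /coordspP wF ->]; rewrite lfunE /=.
apply/coordspP => T TF; rewrite bdE big1 // => l lT; rewrite wF ?scaler0 //.
apply: contra TF; rewrite !inE cardsU1 lT add1n eqSS lem_msetU1 //.
move=> /and3P[-> /andP[le ml]]; rewrite le /= subkU1 // => Au.
have lz : (l < z)%N.
  rewrite ltnNge; apply: contraL ml => zl; rewrite mnmBE (elimT (MonP z m) Mm) //.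
have lm : (U_(l) <= m - mset T)%MM by rewrite lep1mP -lt0n.
have MT : Mon z (m - mset T)%MM by move: Mm; rewrite -{1}(submK le) MonD => /andP[].
have := stA ((m - mset T - U_(l)) + U_(z) *+ t.+1)%MM l _ _ Au _ _ lz.
rewrite mnmDE mulmnE mnm1E eqxx mul1n mnmBE (Mon_z MT) sub0n add0n.
have -> : (m - mset T - U_(l) + U_(z) *+ t.+1 - U_(z) + U_(l) = m - mset T + U_(z) *+ t)%MM.
  by rewrite mulmSr addmA addmK addmC addmA [(U_(l) + _)%MM]addmC submK.
apply=> //.
  rewrite Mon_shift; apply: (@MonW _ z) => //.
  by move: MT; rewrite -{1}(submK lm) MonD => /andP[].
apply: leq_trans dm; rewrite mdegD mdegMn mdeg1 mul1n leq_add2r.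
by apply: leq_trans (mdegB _ _) (mdegB _ _).
Qed.

Lemma contains_slice A s u : contains_PE E z.+1 A -> (0 < E z)%N -> (E z <= s)%N -> Mon z u ->
  slice z A s u.
Proof.
move=> PA E0 Es Mu; apply: PA; first by rewrite Mon_shift; apply: MonW Mu.
by apply/existsP; exists z; rewrite E0 mnmDE mulmnE mnm1E eqxx mul1n (Mon_z Mu).
Qed.

(* In the strands with z-exponent t in ]0, E z[, stability puts the boundaries of the t-th
   slice inside the slice t - 1, so that their ranks depend on the Hilbert function only.
   The slices t >= E z are everything, and only t = 0 and t = E z have to be compared. *)
Lemma rank_step A L i j :
    zstable E z.+1 z j A -> zstable E z.+1 z j L ->
    contains_PE E z.+1 A -> contains_PE E z.+1 L ->
    (forall d, cnt z.+1 L d = cnt z.+1 A d) ->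
    (rk K z i.+1 L j <= rk K z i.+1 A j)%N ->
    (0 < E z -> exists B, [/\ (rk K z i B (j - E z) <= rk K z i (slice z A (E z).-1) (j - E z))%N,
      forall d, cnt z B d = cnt z (slice z A (E z).-1) d
      & forall u, Mon z u -> (mdeg u + (E z).-1 <= j)%N -> B u -> slice z L (E z).-1 u])%N ->
  (rk K z.+1 i.+1 L j <= rk K z.+1 i.+1 A j)%N.
Proof.
move=> stA stL PA PL cAL r0 rE.
(* [c s] holds for the slices that the power of z does not force to be everything. *)
pose c s := (E z == 0%N) || (s < E z)%N.
pose g X t := (\sum_(m <- mons n z (j - t)) rho K (fam i.+1 X (m + U_(z) *+ t)%MM))%N.
(* A correction term whose sum over t is fixed by the Hilbert function. Relative to it, the ranks
   [g] can be compared for each t separately. *)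
pose h X t := if t is s.+1 then if c s then cfam z i (slice z X s) (j - t) else 0%N else 0%N.
have step t : (t <= j)%N -> (g L t + h A t <= g A t + h L t)%N.
  case: t => [_|s sj].
    have g0 X : g X 0%N = rk K z i.+1 X j.
      by rewrite /g subn0; apply: eq_bigr => m _; rewrite mulm0n addm0.
    by rewrite /h !g0 !addn0.
  have mid X : zstable E z.+1 z j X -> (0 < E z -> s.+1 < E z)%N -> g X s.+1 = h X s.+1.
    move=> stX sE; rewrite /h /g (_ : c s); last first.
      by rewrite /c; case: posnP sE => //= _ /(_ isT)/ltnW.
    rewrite /cfam big_seq [RHS]big_seq; apply: eq_bigr => m.
    rewrite mem_mons => /andP[/eqP dm Mm]; rewrite rho_slice //.
    have dm' : (mdeg m + s.+1 <= j)%N by rewrite dm subnK.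
    by rewrite (addv_idPr (bd_slice_sub i stX Mm sE dm')) dim_coordsp.
  have [Ez|E0] := posnP (E z); first by rewrite !mid // ?Ez // addnC.
  have [sE|Es|sE] := ltngtP s.+1 (E z); first by rewrite !mid // addnC.
    rewrite /h (_ : c s = false); last by rewrite /c gtn_eqF // ltnNge -ltnS Es.
    rewrite !addn0 /g big_seq [leqRHS]big_seq; apply: leq_sum => m.
    rewrite mem_mons => /andP[_ Mm]; rewrite !rho_slice //.
    rewrite (eq_fam (A := slice z L s.+1) (A' := slice z A s.+1) (i := i.+1) Mm) ?(eq_fam (A := slice z L s) (A' := slice z A s) (i := i) Mm) // => u Mu _.
      by rewrite !(contains_slice _ E0).
    by rewrite !(contains_slice _ E0) // ltnW.
  rewrite /h (_ : c s); last by rewrite /c -sE leqnn orbT.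
  (* For j = s + 1 the only m is 0, where the full simplex consists of the empty face and is not
     acyclic. The boundaries vanish there and only the slice itself counts. *)
  have gE X : contains_PE E z.+1 X -> g X s.+1 = (if j == s.+1 then cfam z i (slice z X s) (j - s.+1) else
      \sum_(m <- mons n z (j - s.+1)) rho K (fam i.+1 predT m) + rk K z i (slice z X s) (j - s.+1))%N.
    move=> PX.
    have full m : Mon z m -> fam i.+1 (slice z X s.+1) m = fam i.+1 predT m.
      move=> Mm; apply: (eq_fam Mm) => u Mu _; rewrite (contains_slice _ E0) // -sE.
      exact: leqnn.
    case: eqP => [js|js]; rewrite /g /rk /cfam -?big_split /= big_seq [RHS]big_seq;
      apply: eq_bigr => m; rewrite mem_mons => /andP[/eqP dm Mm]; rewrite rho_slice // full //.
      have m0 : m = 0%MM by apply/eqP; rewrite -mdeg_eq0 dm js subnn.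
      rewrite (_ : fam i.+1 predT m = set0) ?(addv_idPr _) ?dim_coordsp //.
        apply/subvP => _ /memv_imgP[w /coordspP wF ->].
        rewrite (_ : w = 0) ?linear0 ?mem0v //.
        by apply/ffunP => T; rewrite wF ?inE // ffunE.
      apply/setP => T; rewrite !inE andbT; apply/negP => /andP[cT /lem_msetP h'].
      have : (0 < #|T|)%N by rewrite (eqP cT).
      by case/card_gt0P => l /h'; rewrite m0 mnm0E.
    rewrite dim_cycle_sum //.
      apply/eqP => m0; move/eqP: dm; rewrite m0 mdeg0 eq_sym subn_eq0 => js'.
      by apply: js; apply/eqP; rewrite eqn_leq js' sj.
    by apply/subsetP => T; rewrite !inE => /and3P[-> ->].
  rewrite !gE //; case: eqP => [_|js]; first by rewrite addnC.
  (* The rank of slice s = E z - 1 is now weighed against its size. B has the size of the slice of A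
     and at most its rank, and enlarging B to the slice of L adds no more to the rank than to the
     size. *)
  have [B [rB cB BL]] := rE E0; rewrite -!addnA leq_add2l.
  move: rB cB BL; rewrite -sE /= => rB cB BL.
  have <- : cfam z i B (j - s.+1) = cfam z i (slice z A s) (j - s.+1).
    by apply: eq_cfam_cnt => d _; apply: cB.
  apply: leq_trans (leq_add rB (leqnn _)); apply: rk_le_card => u Mu du; apply: BL => //.
  by rewrite -(subnK sj) -du leq_add // ?leq_addr.
have hsum : (\sum_(t < j.+1) h A t = \sum_(t < j.+1) h L t)%N.
  rewrite !big_ord_recl /= !add0n.
  have [ji|ij] := leqP j i.
    rewrite !big1 // => t _; rewrite /bump add1n /h cfam_cnt (_ : (i <= j - t.+1)%N = false) ?if_same //;
    by apply/negbTE; rewrite -ltnNge (leq_trans _ ji) // ltn_subrL (leq_trans _ (ltn_ord t)).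
  (* By [cfam_cnt] the term for t + 1 counts slice t in degree (j - (t + 1)) - i = e - t. So the sum
     is N times the Hilbert function in degree e, less the slices that are everything. *)
  pose e := (j - i.+1)%N; pose N := #|[set T : {set 'I_n} | (#|T| == i) && Mon z (mset T)]|.
  have hE X : (\sum_(t < j) h X (bump 0 t) =
      N * \sum_(t < e.+1 | c t) cnt z (slice z X t) (e - t))%N.
    have le_ej : (e.+1 <= j)%N by rewrite /e subnSK // leq_subr.
    rewrite big_distrr /= (big_ord_widen_cond j c (fun t => N * cnt z (slice z X t) (e - t))%N) //.
    rewrite [RHS]big_mkcond; apply: eq_bigr => t _; rewrite /bump add1n /h cfam_cnt.
    case: (c t) => //=.
    have -> : (i <= j - t.+1)%N = (t < e.+1)%N.
      by rewrite /e ltnS leq_subRL ?leq_subRL // addnC addSnnS.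
    case: ifP => // _; congr (_ * cnt _ _ _)%N.
    by rewrite /e -!subnDA addSnnS addnC.
  rewrite !hE; congr (_ * _)%N.
  have := cAL e; rewrite !cnt_slices (bigID (fun t : 'I_e.+1 => c t)) [RHS](bigID (fun t : 'I_e.+1 => c t)) /=.
  rewrite [X in (_ + X = _)%N](eq_bigr (fun t : 'I_e.+1 => cnt z (slice z A t) (e - t))).
    by move/addIn.
  move=> t; rewrite negb_or -lt0n -leqNgt => /andP[E0 Et].
  apply: eq_in_count => u; rewrite mem_mons => /andP[_ Mu].
  by rewrite !(contains_slice _ E0).
rewrite /rk !sum_slices -!/(g _ _).
rewrite -(leq_add2r (\sum_(t < j.+1) h A t)) {2}hsum -!big_split /=.
by apply: leq_sum => t _; apply: step; rewrite -ltnS.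
Qed.

End RankStep.

(** * Lex segments *)

Section LexSegments.
Variables (n : nat) (E : 'I_n -> nat).
Implicit Types (A B L : pred 'X_{1..n}) (u v w m : 'X_{1..n}) (p d : nat).
Local Notation PE := (PE E).

Definition cntN p A d : nat := count (fun v => A v && ~~ PE v) (mons n p d).

Definition above p u : nat := count (fun v => ~~ PE v && llt u v) (mons n p (mdeg u)).

(** Membership is decided by the rank of u among the monomials outside the powers. Of A only the
    number of such monomials in each degree matters. *)
Definition lexseg p A : pred 'X_{1..n} := fun u => PE u || (above p u < cntN p A (mdeg u))%N.

Lemma llt_irr u : llt u u = false. Proof. exact: klt_irr. Qed.
Lemma llt_trans : transitive (@llt n). Proof. exact/klt_trans/val_inj. Qed.
Lemma llt_total u v : u != v -> llt u v || llt v u. Proof. exact: klt_total. Qed.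
Lemma lltP u v :
  reflect (exists2 i, (u i < v i)%N & forall j : 'I_n, (j < i)%N -> u j = v j) (llt u v).
Proof. exact: kltP. Qed.

Lemma lexseg_PE p A u : PE u -> lexseg p A u.
Proof. by rewrite /lexseg => ->. Qed.

Lemma lexseg_mono p A B u : (cntN p A (mdeg u) <= cntN p B (mdeg u))%N -> lexseg p A u -> lexseg p B u.
Proof. by move=> AB; rewrite /lexseg => /orP[->//|h]; rewrite (leq_trans h) ?orbT. Qed.

Lemma above_lt p u v : v \in mons n p (mdeg u) -> ~~ PE v -> llt u v -> (above p v < above p u)%N.
Proof.
move=> vm nP uv; have dv : mdeg v = mdeg u by move: vm; rewrite mem_mons => /andP[/eqP].
rewrite /above dv; set s := mons n p _.
have /permP pe := perm_to_rem vm; rewrite !pe /= llt_irr andbF nP uv add0n add1n ltnS.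
by apply: sub_count => w /andP[-> vw]; apply: llt_trans vw.
Qed.

Lemma lexseg_up p A u v : Mon p v -> mdeg u = mdeg v -> ~~ PE u -> llt u v -> lexseg p A u ->
  lexseg p A v.
Proof.
move=> Mv duv nPu uv; rewrite /lexseg (negbTE nPu) /= => h.
have [//|nPv] := boolP (PE v); rewrite -duv (ltn_trans _ h) //.
by apply: above_lt => //; rewrite mem_mons -duv eqxx.
Qed.

Lemma count_lt_iota k N : count (fun i => i < k)%N (iota 0 N) = minn k N.
Proof.
elim: N => [|N IH]; first by rewrite minn0.
by rewrite -addn1 iotaD count_cat IH /= add0n addn0; lia.
Qed.

(** On the monomials of degree d outside the powers, [above] is a bijection onto an initial interval
    of integers. *)
Lemma cntN_lexseg p A d : cntN p (lexseg p A) d = cntN p A d.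
Proof.
pose s := [seq v <- mons n p d | ~~ PE v].
have us : uniq s by rewrite filter_uniq ?mons_uniq.
have ds v : v \in s -> mdeg v = d by rewrite mem_filter mem_mons => /and3P[_ /eqP].
have ms v : v \in s -> v \in mons n p d /\ ~~ PE v by rewrite mem_filter => /andP[].
have aE v : v \in s -> above p v = count (llt v) s.
  by move=> /ds dv; rewrite /above dv /s count_filter; apply: eq_count => w; rewrite /= andbC.
have cE X : cntN p X d = count X s by rewrite /s count_filter.
have lt_as v : v \in s -> (above p v < size s)%N.
  move=> vs; rewrite aE // -(count_predC (llt v) s) -[X in (X < _)%N]addn0 ltn_add2l.
  by rewrite -has_count; apply/hasP; exists v => //=; rewrite llt_irr.
have inj : {in s &, injective (above p)}.
  move=> u v us' vs e; apply/eqP/negPn/negP => /llt_total/orP[lt|lt].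
    have [vm nP] := ms v vs; have := @above_lt p u v; rewrite (ds u) // => /(_ vm nP lt).
    by rewrite e ltnn.
  have [um nP] := ms u us'; have := @above_lt p v u; rewrite (ds v) // => /(_ um nP lt).
  by rewrite e ltnn.
have pe : perm_eq (map (above p) s) (iota 0 (size s)).
  apply: uniq_perm; rewrite ?map_inj_in_uniq ?iota_uniq //.
  have [|||_ //] := @uniq_min_size _ (map (above p) s) (iota 0 (size s)).
  - by rewrite map_inj_in_uniq.
  - by move=> _ /mapP[v vs ->]; rewrite mem_iota add0n lt_as.
  by rewrite size_map size_iota.
have -> : cntN p (lexseg p A) d = count (fun i => i < cntN p A d)%N (map (above p) s).
  rewrite cE count_map; apply: eq_in_count => v vs; rewrite /lexseg /=.
  by have [_ /negbTE ->] := ms v vs; rewrite (ds v).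
rewrite (permP pe) count_lt_iota; apply/minn_idPl.
by rewrite cE count_size.
Qed.

Lemma cnt_cntN p A d : contains_PE E p A ->
  cnt p A d = (cntN p A d + count PE (mons n p d))%N.
Proof.
move=> PA; rewrite /cnt /cntN -!sum1_count (bigID PE) /= addnC; congr (_ + _)%N.
rewrite big_seq_cond [RHS]big_seq_cond; apply: eq_bigl => u; rewrite mem_mons.
by case: (boolP (Mon p u)) => [/PA Au|]; rewrite ?andbF // andbT; case: (boolP (PE u)) => [/Au ->|]; rewrite ?andbF.
Qed.

(** Replacing z by an earlier variable makes a monomial larger for lex. A power dividing u persists,
    as [u z < E z] excludes the power of z. *)
Lemma lexseg_zstable p (z : 'I_n) d A : z.+1 = p -> zstable E p z d (lexseg p A).
Proof.
move=> zp u j Mu _ Lu u0 uE jz; set v := (u - U_(z) + U_(j))%MM.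
have zj : (z == j) = false by rewrite -(inj_eq val_inj) /= (gtn_eqF jz).
have vz : v z = (u z).-1 by rewrite mnmDE mnmBE !mnm1E eqxx eq_sym zj addn0 subn1.
have vj : v j = (u j).+1 by rewrite mnmDE mnmBE !mnm1E zj eqxx subn0 addn1.
have vl (l : 'I_n) : l != z -> l != j -> v l = u l.
  by move=> lz lj; rewrite mnmDE mnmBE !mnm1E ![_ == l]eq_sym (negbTE lz) (negbTE lj) subn0 addn0.
have le : (U_(z) <= u)%MM by rewrite lep1mP -lt0n.
have Mv : Mon p v.
  rewrite MonD Mon1 -zp (ltn_trans jz) // andbT zp.
  by move: Mu; rewrite -{1}(submK le) MonD => /andP[].
have [/existsP[l /andP[El ul]]|nPu] := boolP (PE u).
  apply: lexseg_PE; apply/existsP; exists l; rewrite El /=.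
  have [e|lz] := eqVneq l z; first by move: ul; rewrite e leqNgt uE // -e.
  have [e|lj] := eqVneq l j; first by rewrite e vj ltnW // ltnS -e.
  by rewrite vl.
apply: (lexseg_up _ _ nPu _ Lu) => //.
  by rewrite mdegD mdeg1 -{1}(submK le) mdegD mdeg1.
apply/lltP; exists j; first by rewrite vj.
move=> l lj; rewrite vl //; first by rewrite -(inj_eq val_inj) /= (ltn_eqF (ltn_trans lj jz)).
by rewrite -(inj_eq val_inj) /= (ltn_eqF lj).
Qed.

Lemma le_mdeg_eq u v : (u <= v)%MM -> mdeg u = mdeg v -> u = v.
Proof.
move=> le d; rewrite -(submK le); suff /eqP -> : (v - u)%MM == 0%MM by rewrite add0m.
by rewrite -mdeg_eq0 -(eqn_add2r (mdeg u)) -mdegD submK // d.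
Qed.

(** It suffices to remove from v a variable after the first difference a, which leaves the
    comparison decided. If v has none, removing x_a works, with equality as the extreme case. *)
Lemma llt_remove u v (i : 'I_n) : mdeg u = mdeg v -> llt u v -> (0 < u i)%N ->
  exists2 l : 'I_n, (0 < v l)%N & (v - U_(l))%MM = (u - U_(i))%MM \/ llt (u - U_(i))%MM (v - U_(l))%MM.
Proof.
move=> duv /lltP[a ua h] ui.
have va : (0 < v a)%N by apply: leq_ltn_trans ua.
have sub1 w (l j : 'I_n) : l != j -> (w - U_(l))%MM j = w j.
  by move=> lj; rewrite mnmBE mnm1E (negbTE lj) subn0.
have neqlt (l j : 'I_n) : (l < j)%N -> l != j by move=> lj; rewrite -(inj_eq val_inj) /= ltn_eqF.
have neqgt (l j : 'I_n) : (j < l)%N -> l != j by move=> lj; rewrite -(inj_eq val_inj) /= gtn_eqF.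
have [/existsP[l /andP[al vl]]|/existsPn no] := boolP [exists l : 'I_n, (a < l)%N && (0 < v l)%N].
  exists l => //; right; apply/lltP; have [ia|ai] := ltnP i a.
    exists i; first by rewrite [X in (_ < X)%N]sub1 ?neqgt ?(ltn_trans ia) // mnmBE mnm1E eqxx -(h i) // subn1 prednK.
    move=> j ji; have ja := ltn_trans ji ia; have jl := ltn_trans ja al.
    by rewrite !sub1 ?neqgt // h.
  exists a; first by rewrite [X in (_ < X)%N]sub1 ?neqgt // (leq_ltn_trans _ ua) // mnmBE leq_subr.
  by move=> j ja; have jl := ltn_trans ja al; have ji := leq_trans ja ai; rewrite !sub1 ?neqgt // h.
exists a => //; have [ia|ai] := ltnP i a.
  right; apply/lltP; exists i.
    by rewrite [X in (_ < X)%N]sub1 ?neqgt // mnmBE mnm1E eqxx -(h i) // subn1 prednK.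
  by move=> j ji; have ja := ltn_trans ji ia; rewrite !sub1 ?neqgt // h.
have [lt|le] := ltnP ((u - U_(i))%MM a) (v a).-1.
  right; apply/lltP; exists a; first by rewrite [X in (_ < X)%N]mnmBE mnm1E eqxx subn1.
  by move=> j ja; have ji := leq_trans ja ai; rewrite !sub1 ?neqgt // h.
left; apply: le_mdeg_eq; last first.
  apply/eqP; rewrite -(eqn_add2r 1) -{1}(mdeg1 a) -(mdeg1 i) -!mdegD !submK ?lep1mP -?lt0n //.
  by rewrite duv.
apply/mnm_lepP => j; have [ja|ja|/val_inj ->] := ltngtP j a.
- by have ji := leq_trans ja ai; rewrite !sub1 ?neqgt // h.
- by have := no j; rewrite ja /= -eqn0Ngt => /eqP vj; rewrite mnmBE vj sub0n.
by rewrite [X in (X <= _)%N]mnmBE mnm1E eqxx subn1.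
Qed.

End LexSegments.

Lemma lltD2r n (w u v : 'X_{1..n}) : llt (u + w)%MM (v + w)%MM = llt u v.
Proof. exact: kltD2r. Qed.

Lemma count_leq_in (T : eqType) (s : seq T) (a b : pred T) :
  {in s, forall y, a y -> b y} -> (count a s <= count b s)%N.
Proof.
move=> h; rewrite -(@eq_in_count _ (predI a b) a); first by apply: sub_count => y /andP[].
by move=> y /h ab /=; apply: andb_idr.
Qed.

(** * Compression: lex segments slice by slice *)

Section Compression.
Variables (n : nat) (E : 'I_n -> nat) (z : 'I_n) (A : pred 'X_{1..n}) (D : nat).
Implicit Types (B L : pred 'X_{1..n}) (u v w m : 'X_{1..n}) (p d s t : nat).
Local Notation PE := (PE E).
Local Notation lexseg := (lexseg E).
Local Notation cntN := (cntN E).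

Hypotheses (upA : up z.+1 A) (PA : contains_PE E z.+1 A) (stA : zstable E z.+1 z D A).
Hypothesis IHup : forall B, up z B -> contains_PE E z B -> up z (lexseg z B).

Lemma PE_shift u t : Mon z u -> PE (u + U_(z) *+ t)%MM = PE u || (0 < E z <= t)%N.
Proof.
move=> Mu; apply/existsP/orP => [[l /andP[El]]|[/existsP[l /andP[El ul]]|/andP[E0 Et]]].
- rewrite mnmDE mulmnE mnm1E; case: (eqVneq z l) El => [<-|_] El.
    by rewrite (Mon_z Mu) mul1n add0n => h; right; rewrite El.
  by rewrite mul0n addn0 => ul; left; apply/existsP; exists l; rewrite El.
- by exists l; rewrite El mnmDE (leq_trans ul) // leq_addr.
by exists z; rewrite E0 mnmDE mulmnE mnm1E eqxx mul1n (leq_trans Et) // leq_addl.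
Qed.

Lemma PE_leq u v : (u <= v)%MM -> PE u -> PE v.
Proof.
move=> /mnm_lepP le /existsP[l /andP[El ul]]; apply/existsP; exists l.
by rewrite El (leq_trans ul).
Qed.

Lemma up_slice t : up z (slice z A t).
Proof.
move=> u i iz Mu; rewrite /slice -addmA => Au; apply: upA => //; first exact: ltnW.
by rewrite Mon_shift; apply: MonW Mu.
Qed.

Lemma contains_PE_slice t : contains_PE E z (slice z A t).
Proof.
move=> u Mu Pu; apply: PA; first by rewrite Mon_shift; apply: MonW Mu.
by rewrite PE_shift // Pu.
Qed.

Lemma slice_incr t u : Mon z u -> slice z A t u -> slice z A t.+1 u.
Proof.
rewrite /slice => Mu Au; rewrite mulmS addmA [(u + _)%MM]addmC -addmA; apply: upA => //.
by rewrite Mon_shift; apply: MonW Mu.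
Qed.

Definition cut u : 'X_{1..n} := (u - U_(z) *+ u z)%MM.

Lemma cutK u : (cut u + U_(z) *+ u z)%MM = u.
Proof.
apply: submK; apply/mnm_lepP => l; rewrite mulmnE mnm1E.
by case: eqP => [<-|_]; rewrite ?mul1n.
Qed.

Lemma cut_shift u t : Mon z u -> cut (u + U_(z) *+ t)%MM = u.
Proof. by move=> Mu; rewrite /cut mnmDE mulmnE mnm1E eqxx mul1n (Mon_z Mu) add0n addmK. Qed.

Lemma Mon_cut u : Mon z.+1 u -> Mon z (cut u).
Proof.
move=> Mu; apply/MonP => l; rewrite leq_eqVlt => /orP[/eqP/val_inj <-|zl].
  by rewrite mnmBE mulmnE mnm1E eqxx mul1n subnn.
by rewrite mnmBE (elimT (MonP _ _) Mu).
Qed.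

Lemma mdeg_cut u : (mdeg (cut u) + u z)%N = mdeg u.
Proof. by rewrite -{3}(cutK u) mdegD mdegMn mdeg1 mul1n. Qed.

Lemma PE_cut u : ~~ PE u -> ~~ PE (cut u).
Proof. by apply: contra; apply: PE_leq; rewrite -{2}(cutK u) lem_addr. Qed.

Lemma nPE_lt u i : ~~ PE u -> (0 < E i)%N -> (u i < E i)%N.
Proof.
by move=> nP Ei; rewrite ltnNge; apply: contra nP => h; apply/existsP; exists i; rewrite Ei.
Qed.

(** The compression of A known from proofs of the Clements-Lindström theorem. It has the Hilbert
    function of A, but is easier to compare with the lex segment in all variables. *)
Definition cmp : pred 'X_{1..n} := fun u => PE u || lexseg z (slice z A (u z)) (cut u).

Lemma cmpE u : ~~ PE u -> cmp u = lexseg z (slice z A (u z)) (cut u).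
Proof. by rewrite /cmp => /negbTE ->. Qed.

Lemma cmp_lex u v : Mon z.+1 v -> mdeg u = mdeg v -> ~~ PE u -> u z = v z -> llt u v ->
  cmp u -> cmp v.
Proof.
move=> Mv duv nPu uvz lt; rewrite cmpE // => Lu.
have [Pv|nPv] := boolP (PE v); first by rewrite /cmp Pv.
rewrite cmpE // -uvz; apply: lexseg_up Lu; first exact: Mon_cut.
- by apply/eqP; rewrite -(eqn_add2r (u z)) mdeg_cut uvz mdeg_cut duv.
- exact: PE_cut.
by rewrite -(lltD2r (U_(z) *+ u z)%MM) cutK uvz cutK.
Qed.

Lemma cmp_stable u (j : 'I_n) : Mon z.+1 u -> (mdeg u <= D)%N -> ~~ PE u -> (0 < u z)%N ->
  (j < z)%N -> cmp u -> cmp (u - U_(z) + U_(j))%MM.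
Proof.
move=> Mu du nPu u0 jz; rewrite cmpE // => Lu.
set v := (_ + _)%MM; have [Pv|nPv] := boolP (PE v); first by rewrite /cmp Pv.
have zj : (z == j) = false by rewrite -(inj_eq val_inj) /= (gtn_eqF jz).
have vz : v z = (u z).-1 by rewrite mnmDE mnmBE !mnm1E eqxx eq_sym zj addn0 subn1.
have Mc := Mon_cut Mu.
have vE : v = (U_(j) + cut u + U_(z) *+ (u z).-1)%MM.
  rewrite /v -{1}(cutK u) -{1}(prednK u0) mulmSr addmA addmK addmC addmA.
  by [].
have cv : cut v = (U_(j) + cut u)%MM by rewrite vE cut_shift // MonD Mon1 jz.
rewrite cmpE // cv vz; set s := (u z).-1; set c := cut u.
have us : u z = s.+1 by rewrite /s prednK.
(* Two slices spliced at the degree of c. Stability makes the result closed under multiplication, so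
   [IHup] across the seam compares the lex segments of the two slices. *)
pose B w := if (mdeg w <= mdeg c)%N then slice z A s.+1 w else slice z A s w.
have upB : up z B.
  move=> w i iz Mw; rewrite /B mdegD mdeg1 add1n.
  case: (ltngtP (mdeg w) (mdeg c)) => [lt|gt|e].
  - exact: up_slice.
  - exact: up_slice.
  rewrite /slice => Aw.
  have := @stA (w + U_(z) *+ s.+1)%MM i _ _ Aw _ _ iz.
  have -> : (w + U_(z) *+ s.+1 - U_(z) + U_(i) = U_(i) + w + U_(z) *+ s)%MM.
    by rewrite mulmSr addmA addmK addmC addmA.
  apply; first by rewrite Mon_shift; apply: MonW Mw.
  - by rewrite mdegD mdegMn mdeg1 mul1n e -us mdeg_cut.
  - by rewrite mnmDE mulmnE mnm1E eqxx mul1n addnS.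
  by move=> E0; rewrite mnmDE mulmnE mnm1E eqxx mul1n (Mon_z Mw) add0n -us nPE_lt.
have PB : contains_PE E z B.
  by move=> w Mw Pw; rewrite /B; case: ifP => _; apply: contains_PE_slice.
have eqB (C : pred 'X_{1..n}) w : (forall x, mdeg x = mdeg w -> B x = C x) -> lexseg z B w = lexseg z C w.
  move=> BC; rewrite /lexseg; congr (_ || (_ < _)%N); apply: eq_in_count => x.
  by rewrite mem_mons => /andP[/eqP dx _]; rewrite BC.
have := IHup upB PB jz Mc.
rewrite (eqB (slice z A s.+1)) => [|x dx]; last by rewrite /B dx leqnn.
rewrite (eqB (slice z A s)) => [|x dx]; last by rewrite /B dx mdegD mdeg1 add1n ltnn.
by apply; rewrite -us.
Qed.

Lemma cntN_slices B d :
  cntN z.+1 B d = (\sum_(t < d.+1) if (0 < E z <= t)%N then 0 else cntN z (slice z B t) (d - t))%N.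
Proof.
rewrite /cntN -sum1_count big_mkcond sum_slices; apply: eq_bigr => t _ /=.
case: ifP => Et.
  rewrite big_seq big1 // => m; rewrite mem_mons => /andP[_ Mm].
  by rewrite PE_shift // Et orbT andbF.
rewrite -sum1_count [RHS]big_mkcond big_seq [RHS]big_seq; apply: eq_bigr => m.
by rewrite mem_mons => /andP[_ Mm]; rewrite PE_shift // Et orbF.
Qed.

Lemma cntN_cmp d : cntN z.+1 cmp d = cntN z.+1 A d.
Proof.
rewrite !cntN_slices; apply: eq_bigr => t _; case: ifP => // Et.
rewrite -(cntN_lexseg E z (slice z A t)) /cntN; apply: eq_in_count => m.
rewrite mem_mons => /andP[_ Mm] /=; rewrite /slice /cmp PE_shift // Et orbF cut_shift //.
rewrite mnmDE mulmnE mnm1E eqxx mul1n (Mon_z Mm) add0n.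
by case: (boolP (PE m)) => // _; rewrite !andbF.
Qed.

(** The slices of A increase with t, hence so do their lex segments. *)
Lemma cmp_incr u : Mon z.+1 u -> cmp u -> cmp (u + U_(z))%MM.
Proof.
move=> Mu; have [Pu _|nPu] := boolP (PE u).
  by rewrite /cmp (PE_leq _ Pu) // lem_addr.
rewrite /cmp (negbTE nPu) /= => Lu; apply/orP; right.
have e : (u + U_(z) = cut u + U_(z) *+ (u z).+1)%MM by rewrite mulmSr addmA cutK.
have Mc := Mon_cut Mu.
have -> : cut (u + U_(z))%MM = cut u by rewrite e cut_shift.
rewrite mnmDE mnm1E eqxx addn1.
apply: lexseg_mono Lu; rewrite /cntN.
rewrite -!sum1_count big_seq_cond [leqRHS]big_seq_cond.
rewrite big_mkcond [leqRHS]big_mkcond; apply: leq_sum => w _; rewrite mem_mons.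
case: (boolP (Mon z w)) => Mw; rewrite ?andbF //.
case: (boolP (slice z A (u z) w)) => [Aw|]; last by rewrite andbF.
by rewrite slice_incr.
Qed.

(* Moves z-exponent of v to the other variables while staying below u. *)
Lemma cmp_down u v : Mon z u -> ~~ PE u -> (mdeg u <= D)%N -> Mon z.+1 v -> mdeg v = mdeg u ->
  ~~ PE v -> cmp v -> (v == u) || llt v u -> cmp u.
Proof.
move=> Mu nPu du; elim: {v}(v z) {-2}v (erefl (v z)) => [|t IH] v vt Mv dv nPv cv vu.
  have [<- //|ne] := eqVneq v u; move: vu; rewrite (negbTE ne) /= => lt.
  by apply: (cmp_lex (u := v)) => //; [apply: MonW Mu|rewrite vt (Mon_z Mu)].
have {vu} /lltP[a va h] : llt v u.
  by case/orP: vu => // /eqP e; move: vt; rewrite e (Mon_z Mu).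
have az : (a < z)%N by rewrite ltnNge; apply/negP => za; move: va; rewrite (elimT (MonP _ _) Mu).
pose mv (j : 'I_n) := (v - U_(z) + U_(j))%MM.
have v0 : (0 < v z)%N by rewrite vt.
have mvE (j l : 'I_n) : (j < z)%N -> mv j l = if l == z then t else (v l + (l == j))%N.
  move=> jz; rewrite mnmDE mnmBE !mnm1E ![_ == l]eq_sym; case: (eqVneq l z) => [->|_].
    by rewrite vt subn1 -(inj_eq val_inj) /= (gtn_eqF jz) addn0.
  by rewrite subn0.
suff [j [jz nPj lej]] : exists j : 'I_n, [/\ (j < z)%N, ~~ PE (mv j) & (mv j == u) || llt (mv j) u].
  have le : (U_(z) <= v)%MM by rewrite lep1mP -lt0n.
  apply: (IH (mv j)) => //.
  - by rewrite mvE // eqxx.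
  - rewrite MonD Mon1 (ltn_trans jz) // andbT.
    by move: Mv; rewrite -{1}(submK le) MonD => /andP[].
  - by rewrite mdegD mdeg1 -dv -{2}(submK le) mdegD mdeg1.
  by apply: cmp_stable => //; rewrite dv.
have nPmv (j : 'I_n) : (j < z)%N -> (0 < E j -> v j < (E j).-1)%N -> ~~ PE (mv j).
  move=> jz vj; apply/existsPn => l; rewrite negb_and -[~~ (E l <= _)%N]ltnNge mvE //.
  case: (posnP (E l)) => //= El; case: eqVneq => [e|lz].
    by have := nPE_lt nPv El; rewrite e vt; apply: ltnW.
  case: eqVneq => [e|_]; last by rewrite addn0 nPE_lt.
  by rewrite e in El *; rewrite addn1 -ltn_predRL vj.
(* A factor z is given to a variable after the first difference a, if one has room below its power;
   the comparison is then still decided at a. Otherwise v is at least u in all variables after a,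
   because u avoids the powers, and the factor can go to a without passing u. *)
have [/existsP[j /and3P[aj jz jE]]|/existsPn no] :=
    boolP [exists j : 'I_n, [&& (a < j)%N, (j < z)%N & (E j == 0%N) || (v j < (E j).-1)%N]].
  exists j; split=> //; first by apply: nPmv => //; case: posnP jE.
  apply/orP; right; apply/lltP; exists a.
    by rewrite mvE // -!(inj_eq val_inj) /= (ltn_eqF az) (ltn_eqF aj) addn0.
  move=> l la; rewrite mvE // -!(inj_eq val_inj) /= (ltn_eqF (ltn_trans la az)).
  by rewrite (ltn_eqF (ltn_trans la aj)) addn0 h.
exists a; split=> //.
  by apply: nPmv => // Ea; rewrite ltn_predRL (leq_ltn_trans va) // nPE_lt.
have mva (l : 'I_n) : (l < a)%N -> mv a l = u l.
  move=> la; rewrite mvE // -!(inj_eq val_inj) /= (ltn_eqF (ltn_trans la az)) (ltn_eqF la) addn0.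
  exact: h.
have mvaa : mv a a = (v a).+1.
  by rewrite mvE // -(inj_eq val_inj) /= (ltn_eqF az) eqxx addn1.
move: va; rewrite leq_eqVlt => /predU1P[vua|va]; last first.
  by apply/orP; right; apply/lltP; exists a; rewrite ?mvaa.
apply/orP; left; rewrite eq_sym; apply/eqP/le_mdeg_eq; last first.
  have le : (U_(z) <= v)%MM by rewrite lep1mP -lt0n.
  by rewrite mdegD mdeg1 -dv -{1}(submK le) mdegD mdeg1.
apply/mnm_lepP => l; have [la|al|/val_inj ->] := ltngtP l a; first by rewrite mva.
  have [zl|lz] := leqP z l; first by rewrite (elimT (MonP _ _) Mu).
  rewrite mvE // -!(inj_eq val_inj) /= (ltn_eqF lz) (gtn_eqF al) addn0.
  have := no l; rewrite al lz /= negb_or -lt0n -leqNgt => /andP[El Ev].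
  by apply: leq_trans Ev; rewrite -ltnS prednK // nPE_lt.
by rewrite mvaa vua.
Qed.

(** If u is not in the compression, then by [cmp_down] all its members outside the powers are larger
    than u. So there are too few of them for u to be in the segment. *)
Lemma lexseg_cmp u : Mon z u -> (mdeg u <= D)%N -> lexseg z.+1 A u -> cmp u.
Proof.
move=> Mu du; have [Pu _|nPu] := boolP (PE u); first by rewrite /cmp Pu.
rewrite /lexseg (negbTE nPu) /= -cntN_cmp; apply: contraTT => ncu.
rewrite -leqNgt; apply: count_leq_in => v; rewrite mem_mons => /andP[/eqP dv Mv] /andP[cv nPv].
rewrite nPv; have [e|ne] := eqVneq u v; first by rewrite e cv in ncu.
have /orP[//|lt] := llt_total ne; case/negP: ncu.
by apply: cmp_down cv _; rewrite ?lt ?orbT.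
Qed.

(* The converse moves, available since u has the largest possible z-exponent. *)
Lemma cmp_up u v : (0 < E z)%N -> Mon z.+1 u -> u z = (E z).-1 -> (mdeg u <= D)%N -> ~~ PE u -> cmp u ->
  Mon z.+1 v -> mdeg v = mdeg u -> ~~ PE v -> (v == u) || llt u v -> cmp v.
Proof.
move=> E0 Mu uz du nPu cu.
elim: {v}((E z).-1 - v z)%N {-2}v (erefl ((E z).-1 - v z)%N) => [|s IH] v vs Mv dv nPv vu.
  have vz : v z = u z.
    apply/eqP; rewrite uz eqn_leq -ltnS prednK // nPE_lt //=.
    by move/eqP: vs; rewrite subn_eq0.
  case/predU1P: vu => [-> //|lt].
  by apply: cmp_lex cu.
have vz : (v z < u z)%N by rewrite uz -subn_gt0 vs.
have {vu} /lltP[a va h] : llt u v.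
  by case/orP: vu => // /eqP e; move: vz; rewrite e ltnn.
have az : (a < z)%N.
  rewrite ltnNge leq_eqVlt; apply/negP => /orP[/eqP/val_inj e|za].
    by move: va; rewrite -e ltnNge ltnW.
  by move: va; rewrite (elimT (MonP _ _) Mv).
pose mv (j : 'I_n) := (v - U_(j) + U_(z))%MM.
have mvE (j l : 'I_n) : (j < z)%N -> mv j l = if l == z then (v z).+1 else (v l - (l == j))%N.
  move=> jz; rewrite mnmDE mnmBE !mnm1E ![_ == l]eq_sym; case: (eqVneq l z) => [->|_].
    by rewrite -(inj_eq val_inj) /= (gtn_eqF jz) subn0 addn1.
  by rewrite addn0.
suff [j [jz vj lej]] : exists j : 'I_n, [/\ (j < z)%N, (0 < v j)%N & (mv j == u) || llt u (mv j)].
  have le : (U_(j) <= v)%MM by rewrite lep1mP -lt0n.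
  have Mj : Mon z.+1 (mv j).
    rewrite MonD Mon1 ltnS leqnn andbT.
    by move: Mv; rewrite -{1}(submK le) MonD => /andP[].
  have dj : mdeg (mv j) = mdeg u by rewrite mdegD mdeg1 -dv -{2}(submK le) mdegD mdeg1.
  have nPj : ~~ PE (mv j).
    apply/existsPn => l; rewrite negb_and -[~~ (E l <= _)%N]ltnNge mvE //.
    case: (posnP (E l)) => //= El; case: eqVneq => [e|lz].
      by rewrite e -ltn_predRL -uz.
    by apply: leq_ltn_trans (leq_subr _ _) _; apply: nPE_lt.
  have cj : cmp (mv j).
    apply: IH => //; rewrite mvE // eqxx subnS vs.
    by [].
  have -> : v = (mv j - U_(z) + U_(j))%MM by rewrite /mv addmK submK.
  apply: cmp_stable => //; first by rewrite dj.
  by rewrite mvE // eqxx.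
(* The factor to be turned into z is taken from a variable after the first difference a, or from a
   itself if v has no such variable before z. *)
have [/existsP[j /and3P[aj jz jv]]|/existsPn no] :=
    boolP [exists j : 'I_n, [&& (a < j)%N, (j < z)%N & (0 < v j)%N]].
  exists j; split=> //; apply/orP; right; apply/lltP; exists a.
    by rewrite mvE // -!(inj_eq val_inj) /= (ltn_eqF az) (ltn_eqF aj) subn0.
  move=> l la; rewrite mvE // -!(inj_eq val_inj) /= (ltn_eqF (ltn_trans la az)).
  by rewrite (ltn_eqF (ltn_trans la aj)) subn0 h.
have va0 : (0 < v a)%N by apply: leq_ltn_trans va.
exists a; split=> //.
have mva (l : 'I_n) : (l < a)%N -> mv a l = u l.
  move=> la; rewrite mvE // -!(inj_eq val_inj) /= (ltn_eqF (ltn_trans la az)) (ltn_eqF la) subn0.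
  by rewrite h.
have mvaa : mv a a = (v a).-1.
  by rewrite mvE // -(inj_eq val_inj) /= (ltn_eqF az) eqxx subn1.
have [lt|ge] := ltnP (u a) (v a).-1.
  by apply/orP; right; apply/lltP; exists a => [|l la]; rewrite ?mvaa ?mva.
apply/orP; left; apply/eqP/le_mdeg_eq; last first.
  have le : (U_(a) <= v)%MM by rewrite lep1mP -lt0n.
  by rewrite mdegD mdeg1 -dv -{2}(submK le) mdegD mdeg1.
apply/mnm_lepP => l; have [la|al|/val_inj ->] := ltngtP l a; first by rewrite mva.
  rewrite mvE //; case: eqVneq => [->|lz] //.
  have [zl|lz'] := leqP z l.
    by rewrite (elimT (MonP _ _) Mv) // ltn_neqAle zl eq_sym (inj_eq val_inj) lz.
  by have := no l; rewrite al lz' /= -eqn0Ngt => /eqP ->.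
by rewrite mvaa.
Qed.

(** By [cmp_up] the compression contains u and everything above u outside the powers, hence more
    elements than [above] counts. *)
Lemma cmp_lexseg u : (0 < E z)%N -> Mon z.+1 u -> u z = (E z).-1 -> (mdeg u <= D)%N -> ~~ PE u ->
  cmp u -> lexseg z.+1 A u.
Proof.
move=> E0 Mu uz du nPu cu; rewrite /lexseg -cntN_cmp; apply/orP; right.
have um : u \in mons n z.+1 (mdeg u) by rewrite mem_mons eqxx.
have /permP pe := perm_to_rem um; rewrite /above /cntN !pe /= llt_irr andbF cu nPu add0n add1n ltnS.
apply: count_leq_in => v /mem_rem; rewrite mem_mons => /andP[/eqP dv Mv] /andP[nPv uv].
by rewrite nPv andbT; apply: (cmp_up E0 Mu uz du) => //; rewrite uv orbT.
Qed.

(* The shadow of the lex segment is no larger than that of the compressed ideal, whose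
   slices in positive z-degree contain the shifted slices. *)
Lemma lexseg_upS u (i : 'I_n) : (i < z.+1)%N -> Mon z.+1 u -> (mdeg u < D)%N ->
  lexseg z.+1 A u -> lexseg z.+1 A (U_(i) + u)%MM.
Proof.
move=> iz Mu du Lu; set w := (_ + _)%MM; set L := lexseg z.+1 A; set d := mdeg u.
have dw : mdeg w = d.+1 by rewrite mdegD mdeg1.
have Mw : Mon z.+1 w by rewrite MonD Mon1 iz.
have [Pw|nPw] := boolP (PE w); first exact: lexseg_PE.
(* The shadow of L outside the powers. If w were not in L, the shadow would contain w and everything
   above it, by [llt_remove], and so be larger than the next degree of A allows. *)
pose Sh v := ~~ PE v && [exists l : 'I_n, (0 < v l)%N && L (v - U_(l))%MM].
have subl v (l : 'I_n) : (0 < v l)%N -> (U_(l) <= v)%MM by rewrite lep1mP -lt0n.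
have degl v (l : 'I_n) : (0 < v l)%N -> mdeg v = d.+1 -> mdeg (v - U_(l))%MM = d.
  by move=> /subl le dv; apply/eqP; rewrite -eqSS -dv -{2}(submK le) mdegD mdeg1 addn1.
have Monl p v (l : 'I_n) : (0 < v l)%N -> Mon p v -> Mon p (v - U_(l))%MM.
  by move=> /subl le; rewrite -{1}(submK le) MonD => /andP[].
have nPl v (l : 'I_n) : ~~ PE v -> ~~ PE (v - U_(l))%MM.
  by apply: contra; apply: PE_leq; apply: lem_subr.
apply: contraT => nLw.
have nLw' : (cntN z.+1 A d.+1 <= above E z.+1 w)%N.
  by move: nLw; rewrite /L /lexseg (negbTE nPw) dw -leqNgt.
have sh_big : (above E z.+1 w < count Sh (mons n z.+1 d.+1))%N.
  have wm : w \in mons n z.+1 d.+1 by rewrite mem_mons dw eqxx.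
  have /permP pe := perm_to_rem wm; rewrite /above dw !pe /= llt_irr andbF add0n.
  rewrite {1}/Sh nPw (_ : [exists l, _]) ?add1n ?ltnS; last first.
    by apply/existsP; exists i; rewrite mnmDE mnm1E eqxx add1n /w addmC addmK.
  apply: count_leq_in => v /mem_rem; rewrite mem_mons => /andP[/eqP dv Mv] /andP[nPv wv].
  have wi : (0 < w i)%N by rewrite mnmDE mnm1E eqxx.
  have [|l vl h] := @llt_remove n w v i _ wv wi; first by rewrite dw dv.
  rewrite /Sh nPv; apply/existsP; exists l; rewrite vl /=.
  have wiu : (w - U_(i))%MM = u by rewrite /w addmC addmK.
  case: h => [->|]; rewrite wiu // => lt.
  apply: (lexseg_up _ _ _ lt Lu); first exact: Monl.
    by rewrite degl.
  by rewrite -wiu nPl.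
suff sh_small : (count Sh (mons n z.+1 d.+1) <= cntN z.+1 A d.+1)%N.
  by move: (leq_trans sh_big (leq_trans sh_small nLw')); rewrite ltnn.
rewrite -cntN_cmp /cntN; set s := mons n z.+1 d.+1.
have split (Q : pred 'X_{1..n}) : count Q s =
    (count (fun v : 'X_{1..n} => Q v && (v z == 0%N)) s + count (fun v : 'X_{1..n} => Q v && (0 < v z)%N) s)%N.
  rewrite -!sum1_count (bigID (fun v : 'X_{1..n} => v z == 0%N)) /=; congr (_ + _)%N.
  by apply: eq_bigl => v; rewrite lt0n.
rewrite (split Sh) (split (fun v : 'X_{1..n} => cmp v && ~~ PE v)); apply: leq_add.
  (* For monomials free of z, [lexseg_cmp] reduces the claim to the lex segment of slice 0 in fewer
     variables. *)
  apply: count_leq_in => v; rewrite mem_mons => /andP[/eqP dv Mv].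
  case/andP => /andP[nPv /existsP[l /andP[vl Ll]]] /eqP vz; rewrite nPv vz !andbT.
  have Mvz : Mon z v.
    apply/MonP => l'; rewrite leq_eqVlt => /orP[/eqP/val_inj <- //|zl].
    by rewrite (elimT (MonP _ _) Mv).
  have lz : (l < z)%N by rewrite ltnNge; apply: contraL vl => zl; rewrite (elimT (MonP _ _) Mvz).
  have := lexseg_cmp (Monl _ _ _ vl Mvz) _ Ll; rewrite degl // => /(_ (ltnW du)).
  have vlz : (v - U_(l))%MM z = 0%N by rewrite mnmBE vz sub0n.
  have cutE (x : 'X_{1..n}) : x z = 0%N -> cut x = x by move=> xz; rewrite /cut xz mulm0n subm0.
  rewrite !cmpE ?nPl // vlz vz !cutE // => Lz.
  rewrite -(submK (subl _ _ vl)) addmC; apply: IHup Lz => //.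
  - exact: up_slice.
  - exact: contains_PE_slice.
  exact: Monl.
have zT : (mset [set z] : 'X_{1..n}) = U_(z)%MM.
  by apply/mnmP => l; rewrite msetE inE mnm1E eq_sym.
have pe : perm_eq [seq v : 'X_{1..n} <- s | (0 < v z)%N] [seq (v + U_(z))%MM | v <- mons n z.+1 d].
  have := @perm_mons_shift n z.+1 d.+1 [set z]; rewrite cards1 zT subn1 => h.
  apply: perm_trans (h _ _) => //; last by rewrite mem_mons mdeg1 Mon1 ltnS leqnn.
  by rewrite (@eq_filter _ _ (fun v : 'X_{1..n} => (U_(z) <= v)%MM)) // => v; rewrite lep1mP -lt0n.
have shift (Q : pred 'X_{1..n}) : count (fun v : 'X_{1..n} => Q v && (0 < v z)%N) s =
    count (fun v : 'X_{1..n} => Q (v + U_(z))%MM) (mons n z.+1 d).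
  by rewrite -count_filter (permP pe) count_map.
rewrite !shift.
(* A multiple v z in the shadow comes from v itself: if v z / x_l is in L, then so is v by
   stability. *)
apply: (@leq_trans (count (fun v : 'X_{1..n} => L v && ~~ PE (v + U_(z))%MM) (mons n z.+1 d))).
  apply: count_leq_in => v; rewrite mem_mons => /andP[/eqP dv Mv] /andP[nPv].
  case/existsP => l /andP[vl Ll]; rewrite nPv andbT.
  have [e|lz] := eqVneq l z; first by move: Ll; rewrite e addmK.
  have zl : (z == l) = false by rewrite eq_sym (negbTE lz).
  have vl' : (0 < v l)%N by move: vl; rewrite mnmDE mnm1E zl addn0.
  have Mvl : Mon z.+1 (v + U_(z) - U_(l))%MM by apply: Monl; rewrite // MonD Mv Mon1 ltnS leqnn.
  have ll : (l < z)%N.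
    rewrite ltn_neqAle (inj_eq val_inj) lz -ltnS ltnNge; apply: contraL vl' => h.
    by rewrite (elimT (MonP _ _) Mv).
  have vzl : (v + U_(z) - U_(l))%MM z = (v z).+1.
    by rewrite mnmBE mnmDE !mnm1E eqxx eq_sym zl subn0 addn1.
  have vzE : (0 < E z -> v z + 1 < E z)%N.
    by move=> E0; have := nPE_lt nPv E0; rewrite mnmDE mnm1E eqxx.
  have := @lexseg_zstable n E z.+1 z _ A erefl _ l Mvl (leqnn _) Ll.
  rewrite vzl => /(_ isT _ ll); rewrite -[(v z).+1]addn1 => /(_ vzE).
  rewrite (_ : (_ - U_(z) + U_(l))%MM = v) //; apply/mnmP => y.
  rewrite !(mnmDE, mnmBE, mnm1E); case: (eqVneq z y) => [<-|_].
    by rewrite (negbTE lz) subn0 addn0 addnK.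
  by rewrite addn0 subn0; case: eqVneq => [<-|_]; rewrite ?subn0 ?addn0 // subnK.
apply: (@leq_trans (count (fun v : 'X_{1..n} => cmp v && ~~ PE (v + U_(z))%MM) (mons n z.+1 d))); last first.
  apply: count_leq_in => v; rewrite mem_mons => /andP[_ Mv] /andP[cv ->].
  by rewrite cmp_incr.
have cE X : cntN z.+1 X d = (count (fun v : 'X_{1..n} => X v && ~~ PE (v + U_(z))%MM) (mons n z.+1 d) +
    count (fun v : 'X_{1..n} => [&& X v, ~~ PE v & PE (v + U_(z))%MM]) (mons n z.+1 d))%N.
  rewrite /cntN -!sum1_count (bigID (fun v : 'X_{1..n} => ~~ PE (v + U_(z))%MM)) /=; congr (_ + _)%N.
    apply: eq_bigl => v; rewrite -andbA; congr (_ && _); apply: andb_idl.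
    by apply: contra; apply: PE_leq; apply: lem_addr.
  by apply: eq_bigl => v; rewrite negbK -andbA.
have : cntN z.+1 L d = cntN z.+1 cmp d by rewrite cntN_cmp cntN_lexseg.
(* L and the compression have equal totals. The monomials v for which v z falls into the powers have
   z-exponent [(E z).-1], and there L has at least as many, by [cmp_lexseg]. *)
have cancel a b a' b' : (a + b = a' + b')%N -> (b' <= b)%N -> (a <= a')%N by lia.
rewrite !cE => /cancel; apply.
apply: count_leq_in => v; rewrite mem_mons => /andP[/eqP dv Mv].
move=> /and3P[cv nPv Pvz]; rewrite nPv Pvz !andbT.
have [E0 vz] : (0 < E z)%N /\ v z = (E z).-1.
  case/existsP: Pvz => l /andP[El]; rewrite mnmDE mnm1E; case: (eqVneq z l) El => [<-|_] El; last first.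
    by rewrite addn0 leqNgt nPE_lt.
  by have := nPE_lt nPv El; lia.
by apply: (cmp_lexseg E0 Mv vz _ nPv cv); rewrite dv ltnW.
Qed.

End Compression.

(** * Lex segments modulo powers: closure and minimal ranks *)

Section LexSegmentTheorem.
Variables (n : nat) (K : fieldType).
Hypothesis K_char0 : [pchar K] =i pred0.
Hypothesis K_roots : forall b, (0 < b)%N -> exists lambda : K, b.-primitive_root lambda.
Variables (E : 'I_n -> nat).
Hypothesis E_mono : forall i j : 'I_n, (i <= j)%N -> (0 < E j)%N -> (0 < E i <= E j)%N.
Implicit Types (A B : pred 'X_{1..n}) (u v : 'X_{1..n}).

Lemma eq_lexseg p A B u : (forall d, cntN E p A d = cntN E p B d) -> lexseg E p A u = lexseg E p B u.
Proof. by move=> e; rewrite /lexseg e. Qed.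

Lemma cnt_lexseg p A : contains_PE E p A -> forall d, cnt p (lexseg E p A) d = cnt p A d.
Proof.
move=> PA d; rewrite (cnt_cntN _ PA) (@cnt_cntN _ E) ?cntN_lexseg // => u _.
exact: lexseg_PE.
Qed.

(** The two claims share one induction on the number of variables, since compression uses the first
    claim for slices and [rank_step] uses the second. *)
Lemma lexseg_main p : (p <= n)%N -> forall A, up p A -> contains_PE E p A ->
  up p (lexseg E p A) /\ forall i j, (rk K p i (lexseg E p A) j <= rk K p i A j)%N.
Proof.
elim: p => [|p IH] pn A upA PA.
  split=> // i j; rewrite (eq_rk K (A' := A)) // => u Mu _.
  have u0 : u = 0%MM by apply/mnmP => l; rewrite (elimT (MonP _ _) Mu) // mnm0E.
  have nP0 : ~~ PE E 0%MM.
    by apply/existsPn => l; rewrite mnm0E leqn0 lt0n andNb.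
  have cnt0 B : count B (mons n 0 0) = B 0%MM.
    have pe : perm_eq (mons n 0 0) [:: 0%MM].
      apply: uniq_perm; rewrite ?mons_uniq // => v; rewrite mem_mons inE mdeg_eq0.
      by case: eqVneq => //= ->; apply/MonP => l _; rewrite mnm0E.
    by rewrite (permP pe) /= addn0.
  rewrite u0 /lexseg (negbTE nP0) /above /cntN mdeg0 !cnt0 llt_irr andbF nP0 andbT /=.
  by case: (A _).
pose z := Ordinal pn; have {}IH := IH (ltnW pn).
have IHup B : up z B -> contains_PE E z B -> up z (lexseg E z B) by move=> uB PB; case: (IH B).
(* A' depends on d but its lex segment does not, so d may be chosen to suit the degree at hand. *)
have stab d : exists A', [/\ up z.+1 A', contains_PE E z.+1 A', zstable E z.+1 z d A',
    forall e, cntN E z.+1 A' e = cntN E z.+1 A e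
    & forall i j, (rk K z.+1 i A' j <= rk K z.+1 i A j)%N].
  have [A' [upA' PA' stA' cA' rA']] := stabilize K_char0 K_roots E_mono d (erefl z.+1) upA PA.
  exists A'; split=> // e; have := cA' e; rewrite !(cnt_cntN (E := E)) //.
  by move/addIn.
split=> [u i ip Mu|i j].
  have [A' [upA' PA' stA' cA' _]] := stab (mdeg u).+1.
  rewrite -![lexseg E p.+1 A _](eq_lexseg _ cA').
  by apply: (lexseg_upS upA' PA' stA' IHup).
case: i => [|i]; first by rewrite !rk0.
have [A' [upA' PA' stA' cA' rA']] := stab j.
apply: leq_trans (rA' i.+1 j).
have uS t : up z (slice z A' t) by apply: up_slice.
have PS t : contains_PE E z (slice z A' t) by apply: contains_PE_slice.
rewrite (eq_rk K (A' := lexseg E z.+1 A')); last by move=> u _ _; rewrite (eq_lexseg _ cA').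
have du u : (mdeg u + i.+1)%N = j -> (mdeg u <= j)%N by move=> <-; apply: leq_addr.
apply: (rank_step (E := E) stA') => //.
- exact: lexseg_zstable.
- by move=> u _; apply: lexseg_PE.
- exact: cnt_lexseg.
(* Slice 0 of the lex segment lies inside the lex segment of slice 0, and ranks are monotone. *)
- have [_ r0] := IH _ (uS 0%N) (PS 0%N).
  rewrite [leqRHS](eq_rk K (A' := slice z A' 0%N)); last by move=> u _ _; rewrite slice0.
  apply: leq_trans (r0 i.+1 j); apply: rk_mono => u Mu /du dj Lu.
  have := lexseg_cmp upA' PA' stA' IHup Mu dj Lu; rewrite /cmp => /orP[|].
    exact: lexseg_PE.
  by rewrite (Mon_z Mu) /cut (Mon_z Mu) mulm0n subm0.
(* In slice E z - 1 the inclusion goes the other way, as [rank_step] demands. *)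
move=> E0; exists (lexseg E z (slice z A' (E z).-1)).
have [_ rS] := IH _ (uS (E z).-1) (PS (E z).-1).
split=> [||u Mu dj Lu]; [exact: rS|exact: cnt_lexseg|].
rewrite /slice; have Mu' : Mon z.+1 (u + U_(z) *+ (E z).-1)%MM by rewrite Mon_shift; apply: MonW Mu.
have [Pu|nPu] := boolP (PE E (u + U_(z) *+ (E z).-1)%MM); first exact: lexseg_PE.
have uz : (u + U_(z) *+ (E z).-1)%MM z = (E z).-1.
  by rewrite mnmDE mulmnE mnm1E eqxx mul1n (Mon_z Mu).
apply: (cmp_lexseg upA' PA' stA' IHup E0) => //.
  by rewrite mdegD mdegMn mdeg1 mul1n.
by rewrite cmpE // uz cut_shift.
Qed.

End LexSegmentTheorem.

(** * From regular sequences of monomials to pure powers *)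

Section PurePowers.
Variables (n : nat) (K : fieldType).
Hypothesis K_char0 : [pchar K] =i pred0.
Hypothesis K_roots : forall b, (0 < b)%N -> exists lambda : K, b.-primitive_root lambda.
Implicit Types (A B : pred 'X_{1..n}) (u v : 'X_{1..n}).

Definition degen A B : Prop :=
  [/\ up n B, forall d, cnt n B d = cnt n A d & forall i j, (rk K n i B j <= rk K n i A j)%N].

Lemma degen_refl A : up n A -> degen A A.
Proof. by []. Qed.

Lemma degen_trans A B C : degen A B -> degen B C -> degen A C.
Proof.
case=> _ cB rB [uC cC rC]; split=> // [d|i j]; first by rewrite cC.
exact: leq_trans (rC i j) (rB i j).
Qed.

Lemma degen_dstep A (x z : 'I_n) (lambda : K) : (x < z)%N -> up n A -> degen A (dstep x z lambda n A).
Proof.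
by move=> xz uA; split=> [|d|i j]; [apply: up_dstep|apply: cnt_dstep|apply: rk_dis].
Qed.

Lemma prim_root_neq0 b (lambda : K) : b.-primitive_root lambda -> lambda != 0.
Proof.
move=> prim; apply/eqP => l0; have := prim_expr_order prim.
rewrite l0 expr0n gtn_eqF ?(prim_order_gt0 prim) //.
by move/eqP; rewrite eq_sym oner_eq0.
Qed.

(** While some f i involves two variables x < z, distracting z into x replaces all its factors z by
    x. The other monomials are free of z and stay. The total size of the supports decreases. *)
Lemma degen_merge r (f : 'I_r -> 'X_{1..n}) A : up n A -> (forall i, A (f i)) ->
    (forall i j l, i != j -> f i l = 0%N \/ f j l = 0%N) -> (forall i, f i != 0%MM) ->
  exists B (s : 'I_r -> 'I_n), [/\ degen A B, injective s & forall i, B (U_(s i) *+ mdeg (f i))%MM].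
Proof.
have [m] := ubnP (\sum_i #|[set l | 0 < f i l]|)%N; elim: m A f => // m IH A f.
rewrite ltnS => lem uA Af dis f0.
have [/existsP[i /existsP[x /existsP[z /and3P[xz fx fz]]]]|no] :=
  boolP [exists i, exists x : 'I_n, exists z : 'I_n, [&& (x < z)%N, (0 < f i x)%N & (0 < f i z)%N]].
  pose g l := if l == i then xsh x z (f i) (f i z) else f l.
  have xz' : x != z by rewrite -(inj_eq val_inj) /= (ltn_eqF xz).
  have gi0 l : (f i l = 0%N -> xsh x z (f i) (f i z) l = 0%N).
    move=> fl; rewrite xshE fl; case: (eqVneq x l) => [e|_]; last by rewrite mul0n addn0.
    by rewrite e fl in fx.
  have df l : mdeg (g l) = mdeg (f l) by rewrite /g; case: eqP => [->|//]; rewrite mdeg_xsh.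
  have [||j|j k l jk|l|B [s [dB sI Bs]]] := IH (dstep x z (1 : K) n A) g.
  - apply: leq_trans lem; apply: (@ltn_sum_one _ _ _ i) => [j|].
      rewrite /g; case: eqP => [->|//]; apply: subset_leq_card; apply/subsetP => l.
      by rewrite !inE !lt0n; apply: contra_neq => /gi0.
    rewrite /g eqxx; apply: proper_card; apply/properP; split.
      by apply/subsetP => l; rewrite !inE !lt0n; apply: contra_neq => /gi0.
    by exists z; rewrite !inE // xsh_z // subnn.
  - exact: up_dstep.
  - rewrite /g; case: eqVneq => [_|ji]; first by apply: dstep_move; rewrite ?oner_neq0 ?Mon_full.
    apply: dstep_fix; rewrite ?oner_neq0 ?Mon_full //.
    by case: (dis j i z ji) => // e; rewrite e in fz.
  - rewrite /g; case: (eqVneq j i) jk => [->|ji] jk; last first.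
      by case: (eqVneq k i) => [_|_]; [case: (dis j i l ji) => [|/gi0]; [left|right]|apply: dis].
    rewrite eq_sym (negbTE jk); case: (dis i k l jk) => [/gi0|]; [left|right] => //.
  - by rewrite -mdeg_eq0 df mdeg_eq0.
  exists B, s; split=> // [|j]; last by rewrite -df.
  by apply: degen_trans dB; apply: degen_dstep.
have /fin_all_exists[s sP] i : exists x, (0 < f i x)%N.
  apply/existsP; apply: contraNT (f0 i); rewrite negb_exists => /forallP h.
  by apply/eqP/mnmP => l; rewrite mnm0E; apply/eqP; rewrite -leqn0 leqNgt h.
exists A, s; split=> [|i j e|i].
- exact: degen_refl.
- apply/eqP; apply: contraT => ij; case: (dis i j (s i) ij) => e'; first by have := sP i; rewrite e'.
  by have := sP j; rewrite -e e'.
have fs l : l != s i -> f i l = 0%N.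
  move=> ls; apply/eqP; rewrite -leqn0 leqNgt; apply: contra no => fl.
  apply/existsP; exists i; have := ls; rewrite -(inj_eq val_inj) neq_ltn => /orP[lt|lt].
    by apply/existsP; exists l; apply/existsP; exists (s i); rewrite lt fl sP.
  by apply/existsP; exists (s i); apply/existsP; exists l; rewrite lt fl sP.
suff <- : f i = (U_(s i) *+ mdeg (f i))%MM by [].
have e : mdeg (f i) = f i (s i).
  by rewrite mdegE (bigD1 (s i)) //= big1 ?addn0 // => l /fs.
apply/mnmP => l; rewrite mulmnE mnm1E e; case: (eqVneq (s i) l) => [<-|ne]; first by rewrite mul1n.
by rewrite mul0n fs // eq_sym.
Qed.

Lemma xsh_pow (x z : 'I_n) b : x != z -> xsh x z (U_(z) *+ b)%MM b = (U_(x) *+ b)%MM.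
Proof.
move=> xz; apply/mnmP => l; rewrite xshE !mulmnE !mnm1E.
by rewrite subnn add0n.
Qed.

Lemma pow_up A (x : 'I_n) a b : up n A -> (a <= b)%N -> A (U_(x) *+ a)%MM -> A (U_(x) *+ b)%MM.
Proof.
move=> uA ab Aa; have -> : (U_(x) *+ b = U_(x) *+ a + U_(x) *+ (b - a))%MM.
  by apply/mnmP => l; rewrite mnmDE !mulmnE -mulnDr subnKC.
by apply: (up_mulm uA); rewrite ?Mon_full.
Qed.

(** The positions are filled from the first variable on, each time by a distraction that acts on the
    exponents as a transposition of two variables. *)
Lemma degen_sort r (ler : (r <= n)%N) (e : 'I_r -> nat) (s : 'I_r -> 'I_n) A :
    (forall i : 'I_r, (0 < e i)%N) -> (forall i j : 'I_r, (i <= j)%N -> (e i <= e j)%N) ->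
    up n A -> injective s -> (forall i, A (U_(s i) *+ e i)%MM) ->
  exists2 B, degen A B & forall i, B (U_(widen_ord ler i) *+ e i)%MM.
Proof.
move=> e0 e_mono uA sI As.
suff /(_ r (leqnn r)) [B [t [dB _ tB tw]]] : forall m, (m <= r)%N -> exists B (t : 'I_r -> 'I_n),
    [/\ degen A B, injective t, forall i, B (U_(t i) *+ e i)%MM
      & forall i : 'I_r, (i < m)%N -> t i = widen_ord ler i].
  by exists B => // i; rewrite -tw.
elim=> [_|m IH mr]; first by exists A, s; split=> //; apply: degen_refl.
have [B [t [dB tI tB tw]]] := IH (ltnW mr); have uB : up n B by case: dB.
pose i0 := Ordinal mr; pose x := widen_ord ler i0; pose z := t i0.
have [tx|zx] := eqVneq z x.
  exists B, t; split=> // i; rewrite ltnS leq_eqVlt => /predU1P[im|/tw //].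
  by have -> : i = i0 by apply: val_inj.
(* The variables before x are already taken by the indices below m, so injectivity of t puts z after
   x. *)
have xz : (x < z)%N.
  rewrite ltn_neqAle (inj_eq val_inj) eq_sym zx /= leqNgt; apply/negP => zm.
  have zr : (z < r)%N := ltn_trans zm mr.
  have := tw (Ordinal zr) zm; have -> : widen_ord ler (Ordinal zr) = z by apply: val_inj.
  by move=> /tI /(congr1 val) /= e1; move: zm; rewrite /= e1 ltnn.
have xz' : x != z by rewrite eq_sym.
have key (lambda : K) : lambda != 0 ->
    (forall l, t l = x -> dstep x z lambda n B (U_(z) *+ e l)%MM) ->
    exists B (t : 'I_r -> 'I_n), [/\ degen A B, injective t, forall i, B (U_(t i) *+ e i)%MM
      & forall i : 'I_r, (i < m.+1)%N -> t i = widen_ord ler i].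
  move=> l0 hx; exists (dstep x z lambda n B), (fun i => tperm x z (t i)); split.
  - by apply: (degen_trans dB); apply: degen_dstep.
  - by move=> i j /perm_inj/tI.
  - move=> i; have [ti|ti] := eqVneq (t i) x; first by rewrite ti tpermL; apply: hx.
    have [tz|tz] := eqVneq (t i) z.
      rewrite tz tpermR -(xsh_pow (e i) xz').
      have := @dstep_move n K x z lambda n xz (ltn_ord z) B (U_(z) *+ e i)%MM l0.
      rewrite Mon_full -{1}tz => /(_ isT (tB i)).
      by rewrite mulmnE mnm1E eqxx mul1n.
    rewrite tpermD 1?eq_sym //; apply: dstep_fix; rewrite ?Mon_full //.
    by rewrite mulmnE mnm1E (negbTE tz).
  move=> i; rewrite ltnS leq_eqVlt => /predU1P[im|im].
    have -> : i = i0 by apply: val_inj.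
    by rewrite -/z tpermR.
  rewrite tw // tpermD //; apply/eqP => e1.
    by move: im; rewrite -[val i]/(val (widen_ord ler i)) -e1 /= ltnn.
  by move: e1; rewrite /z -(tw i im) => /tI e1; move: im; rewrite -e1 ltnn.
have [/existsP[l /eqP tl]|no] := boolP [exists l, t l == x]; last first.
  apply: (key (1 : K) (oner_neq0 _)) => l tl; case/negP: no; apply/existsP; exists l.
  by rewrite tl.
have ml : (m <= l)%N.
  rewrite leqNgt; apply/negP => lm; have := tw l lm; rewrite tl => /(congr1 val) /= e1.
  by rewrite e1 ltnn in lm.
(* Here x is occupied by its power of exponent [e l]. As m <= l, also z^(e l) is in B, and a
   primitive root of order [e l] lets it survive while z^(e m) becomes x^(e m): the two variables
   trade places. *)
have [lambda prim] := K_roots (e0 l).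
apply: (key lambda (prim_root_neq0 prim)) => l' tl'.
have -> : l' = l by apply: tI; rewrite tl.
apply: dstep_pow => //.
- by apply: (pow_up uB (e_mono i0 l ml)); apply: tB.
- by have := tB l; rewrite tl.
by move=> s0; apply: dcf_prim.
Qed.

End PurePowers.

(** * Regular sequences of monomials are pairwise coprime *)

Section RegularMonomials.
Variables (n : nat) (k : fieldType).
Local Notation S := {mpoly k[n]}.
Implicit Types (u v m : 'X_{1..n}) (A : pred 'X_{1..n}) (M : 'X_{1..n} -> Prop).

Lemma mono_sp_ideal A : up n A -> is_ideal (mono_sp (K := k) n A).
Proof.
move=> uA; have sM := subsp_mono k n A; split; first by case: sM.
  by move=> f g; apply: subspD.
move=> a f fA; elim/mpolyind: a => [|c m a _ _ IH]; first by rewrite mul0r; case: sM.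
rewrite mulrDl -scalerAl; apply: (subspD sM) => //; apply: (subspZ _ sM).
elim: {m}(mdeg m) {-2}m (erefl (mdeg m)) => [|d IHd] m dm.
  by move/eqP: dm; rewrite mdeg_eq0 => /eqP ->; rewrite mpolyX0 mul1r.
have [i mi] : exists i, (0 < m i)%N.
  apply/existsP; apply: contraT; rewrite negb_exists => /forallP h.
  by move: dm; rewrite mdegE big1 // => i _; apply/eqP; rewrite -leqn0 leqNgt h.
have le : (U_(i) <= m)%MM by rewrite lep1mP -lt0n.
rewrite -(submK le) addmC mpolyXD -mulrA; apply: mono_Xmul => //; apply: IHd.
by apply/eqP; rewrite -eqSS -dm -{2}(submK le) mdegD mdeg1 addn1.
Qed.

Lemma mono_spX A u : A u -> mono_sp (K := k) n A 'X_[u].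
Proof.
by move=> Au v; rewrite mcoeffX; case: (eqVneq u v) => [<-|_]; rewrite ?eqxx // Mon_full.
Qed.

Lemma ideal_gen_ideal (G : S -> Prop) : is_ideal (ideal_gen G).
Proof.
split=> [J [J0 _ _] _ //|f g hf hg J iJ GJ|a f hf J iJ GJ].
  by have [_ JD _] := iJ; apply: JD; [apply: hf | apply: hg].
by have [_ _ JM] := iJ; apply: JM; apply: hf.
Qed.

Lemma is_ideal_supp (I : S -> Prop) f : is_ideal I -> (forall u, f@_u != 0 -> I 'X_[u]) -> I f.
Proof.
move=> iI h; have sI := subsp_ideal iI; rewrite [f]mpolyE big_seq.
by apply: subsp_sum => // u; rewrite mcoeff_msupp => /h Iu; apply: subspZ.
Qed.

Lemma ideal_gen_monomials M f :
  ideal_gen (fun g : S => exists2 m, M m & g = 'X_[m]) f <->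
  mono_sp n (fun u => asb (exists2 m, M m & (m <= u)%MM)) f.
Proof.
split=> [h|h].
  apply: h; first apply: mono_sp_ideal.
    move=> u i _ _ /asbP[m Mm mu]; apply/asbP; exists m => //.
    by apply: lepm_trans mu _; apply: lem_addl.
  move=> _ [m Mm ->]; apply: mono_spX; apply/asbP; exists m => //.
  exact: lepm_refl.
apply: (is_ideal_supp (ideal_gen_ideal _)) => u /h/andP[_ /asbP[m Mm mu]].
have [_ _ GM] := ideal_gen_ideal (fun g : S => exists2 m, M m & g = 'X_[m]).
by rewrite -(submK mu) mpolyXD; apply: GM => J _; apply; exists m.
Qed.

(** If x_l divides f_i and f_j with i < j, then f_j times f_i / x_l is a multiple of f_i, so by
    regularity f_i / x_l is divisible by some f_s with s < j. Then s differs from i and f_s divides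
    f_i, against coprimality for smaller indices. *)
Lemma regular_coprime r (f : 'I_r -> 'X_{1..n}) : (forall i, f i != 0%MM) ->
    regular_sequence (fun i => 'X_[f i] : S) ->
  forall (i j : 'I_r) (l : 'I_n), i != j -> f i l = 0%N \/ f j l = 0%N.
Proof.
move=> f0 [reg _].
pose J (j : 'I_r) := mono_sp (K := k) n (fun u => asb (exists2 m, (exists2 i : 'I_r, (i < j)%N & m = f i) & (m <= u)%MM)).
have regJ (j : 'I_r) p : J j ('X_[f j] * p) -> J j p.
  have e q : J j q <-> ideal_gen (fun g => exists2 i : 'I_r, (i < j)%N & g = 'X_[f i]) q.
    rewrite /J -(ideal_gen_monomials (fun m => exists2 i : 'I_r, (i < j)%N & m = f i)).
    split=> h I iI GI; apply: h => // g.
      by case=> m [i ij ->] ->; apply: GI; exists i.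
    by case=> i ij ->; apply: GI; exists (f i) => //; exists i.
  by move/e/reg/e.
suff main (m : nat) (j i : 'I_r) (l : 'I_n) : (j <= m)%N -> (i < j)%N -> f i l = 0%N \/ f j l = 0%N.
  move=> i j l; rewrite -(inj_eq val_inj) neq_ltn => /orP[ij|ji]; first exact: (main j).
  by have [] := main i i j l (leqnn _) ji; [right|left].
elim: m j i l => [|m IH] j i l; first by rewrite leqn0 => /eqP ->.
move=> jm ij; have [|fi] := posnP (f i l); first by left.
have [|fj] := posnP (f j l); first by right.
have le_i : (U_(l) <= f i)%MM by rewrite lep1mP -lt0n.
have le_j : (U_(l) <= f j)%MM by rewrite lep1mP -lt0n.
have : J j 'X_[f i - U_(l)].
  apply: regJ; rewrite -mpolyXD.
  apply: mono_spX; apply/asbP; exists (f i); first by exists i.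
  apply/mnm_lepP => y; rewrite mnmDE mnmBE mnm1E.
  have := mnm_lepP le_j y; rewrite mnm1E; lia.
move=> /(_ (f i - U_(l))%MM); rewrite mcoeffX eqxx oner_eq0 => /(_ isT)/andP[_ /asbP[_ [s sj ->] le]].
have le_si : (f s <= f i)%MM by apply: lepm_trans le (lem_subr _ _).
have si : s != i.
  apply: contraTneq le => ->; apply/negP => /mnm_lepP/(_ l); rewrite mnmBE mnm1E eqxx.
  by move: fi; lia.
have [y fy] : exists y, (0 < f s y)%N.
  apply/existsP; apply: contraNT (f0 s); rewrite negb_exists => /forallP h.
  by apply/eqP/mnmP => y; rewrite mnm0E; apply/eqP; rewrite -leqn0 leqNgt h.
have fiy : (0 < f i y)%N := leq_trans fy (mnm_lepP le_si y).
have := si; rewrite -(inj_eq val_inj) neq_ltn => /orP[lt|lt].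
  have im : (i <= m)%N by rewrite -ltnS (leq_trans ij).
  by have [] := IH i s y im lt; move=> e; [rewrite e in fy|rewrite e in fiy].
have sm : (s <= m)%N by rewrite -ltnS (leq_trans sj).
by have [] := IH s i y sm lt; move=> e; [rewrite e in fiy|rewrite e in fy].
Qed.

End RegularMonomials.

(** * Lex segments as lex-plus-powers ideals *)

Section LexPlusPowers.
Variables (n : nat) (k : fieldType) (E : 'I_n -> nat).
Implicit Types (A L : pred 'X_{1..n}) (u v w m : 'X_{1..n}) (p : {mpoly k[n]}).

(** Repeated use of [llt_remove], stripping u down to w one variable at a time. This makes [lexhat]
    a lex ideal in all degrees above its generators. *)
Lemma llt_divisor u v w : mdeg u = mdeg v -> llt u v -> (w <= u)%MM ->
  exists w', [/\ (w' <= v)%MM, mdeg w' = mdeg w & w' = w \/ llt w w'].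
Proof.
elim: {u}(mdeg u) {-2}u (erefl (mdeg u)) v => [|d IH] u du v duv uv wu.
  have u0 : u = 0%MM by apply/eqP; rewrite -mdeg_eq0 du.
  have v0 : v = 0%MM by apply/eqP; rewrite -mdeg_eq0 -duv du.
  by rewrite u0 v0 llt_irr in uv.
have [e|wu'] := eqVneq w u; first by exists v; rewrite e lepm_refl; split=> //; right.
have [i wi] : exists i, (w i < u i)%N.
  apply/existsP; apply: contraT; rewrite negb_exists => /forallP h.
  case/eqP: wu'; apply/mnmP => i; apply/eqP; rewrite eqn_leq (mnm_lepP wu i).
  by rewrite leqNgt h.
have ui : (0 < u i)%N by apply: leq_ltn_trans wi.
have [l vl uv'] := llt_remove duv uv ui.
have wu1 : (w <= u - U_(i))%MM.
  apply/mnm_lepP => j; rewrite mnmBE mnm1E; have := mnm_lepP wu j.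
  by case: (eqVneq i j) => [<-|_]; lia.
have deg1 m j : (0 < m j)%N -> mdeg m = (mdeg (m - U_(j))%MM).+1.
  move=> mj; have le : (U_(j) <= m)%MM by rewrite lep1mP -lt0n.
  by rewrite -{1}(submK le) mdegD mdeg1 addn1.
have vv : (v - U_(l) <= v)%MM by apply: lem_subr.
case: uv' => [e|lt]; first by exists w; split; [rewrite -e in wu1; apply: lepm_trans vv| |left].
have [||w' [w'v dw' ww']] := IH _ _ _ _ lt wu1.
- by apply/eqP; rewrite -eqSS -deg1 ?du.
- by apply/eqP; rewrite -eqSS -!deg1 ?duv.
by exists w'; split=> //; apply: lepm_trans vv.
Qed.

(** The lex ideal generated by the part of L outside the powers. Elements of the powers cannot serve
    as starting points v, since larger monomials for lex may lie outside of L. *)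
Definition lexhat L : pred 'X_{1..n} := fun u => asb (exists w v,
  [/\ (w <= u)%MM, mdeg w = mdeg v, ~~ PE E v, L v & w = v \/ llt v w]).

Lemma lexhat_ideal L : lex_ideal (mono_sp (K := k) n (lexhat L)).
Proof.
split.
  exists (fun u => exists v, [/\ mdeg u = mdeg v, ~~ PE E v, L v & u = v \/ llt v u]) => p.
  rewrite ideal_gen_monomials; split=> h u /h /andP[Mu /asbP hu]; rewrite Mu; apply/asbP.
    by case: hu => w [v [wu ? ? ? ?]]; exists w => //; exists v; split.
  by case: hu => w [v [? ? ? ?]] wu; exists w, v; split.
move=> u v duv /lltP uv /(_ u); rewrite mcoeffX eqxx oner_eq0 => /(_ isT)/andP[_ /asbP[w [t [wu dw nt Lt wt]]]].
apply: mono_spX; apply/asbP; have [w' [w'v dw' ww']] := llt_divisor duv uv wu.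
exists w', t; split=> //; first by rewrite dw'.
case: ww' => [-> //|ww']; right; case: wt => [<- //|tw].
exact: llt_trans ww'.
Qed.

Lemma lexhat_sub A u : up n (lexseg E n A) -> lexhat (lexseg E n A) u -> lexseg E n A u.
Proof.
move=> uL /asbP[w [v [wu dw nPv Lv wv]]]; rewrite -(submK wu) addmC.
apply: (up_mulm uL); rewrite ?Mon_full //.
case: wv => [-> //|vw]; apply: lexseg_up vw Lv; rewrite ?Mon_full //.
Qed.

Lemma lex_plus_lexseg A (P : {mpoly k[n]} -> Prop) : up n (lexseg E n A) ->
    (forall p, P p <-> mono_sp n (PE E) p) -> lex_plus P (mono_sp n (lexseg E n A)).
Proof.
move=> uL PP; set L := lexseg E n A; have sL := subsp_mono k n L.
have PL p : P p -> mono_sp n L p.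
  by move=> /PP h u /h/andP[-> Pu]; apply: lexseg_PE.
split=> //; exists (mono_sp n (lexhat L)); first exact: lexhat_ideal.
move=> p; split=> [h|[a [b [ha /PL hb ->]]]]; last first.
  by apply: (subspD sL) => // u /ha/andP[-> hu]; apply: lexhat_sub.
pose q := \sum_(u <- msupp p | PE E u) p@_u *: 'X_[u].
pose g := \sum_(u <- msupp p | ~~ PE E u) p@_u *: 'X_[u].
exists g, q; split.
- rewrite /g big_seq_cond; apply: subsp_sum => [|u /andP[up nPu]]; first exact: subsp_mono.
  apply: (subspZ _ (subsp_mono _ _ _)); apply: mono_spX; apply/asbP; exists u, u.
  split=> //; [exact: lepm_refl| |by left].
  by move: up; rewrite mcoeff_msupp => /h/andP[].
- apply/PP; rewrite /q; apply: subsp_sum => [|u Pu]; first exact: subsp_mono.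
  by apply: (subspZ _ (subsp_mono _ _ _)); apply: mono_spX.
by rewrite {1}[p]mpolyE (bigID (PE E)) addrC.
Qed.

End LexPlusPowers.

Section Exponents.
Variables (n r : nat) (ler : (r <= n)%N) (e : 'I_r -> nat).

(** The default 0 marks the variables after the first r as having no power. *)
Definition exponent (l : 'I_n) : nat := oapp e 0%N (insub (val l)).

Lemma exponent_widen i : exponent (widen_ord ler i) = e i.
Proof. by rewrite /exponent /= valK. Qed.

Lemma exponent_gt0 l : (0 < exponent l)%N -> exists2 i, l = widen_ord ler i & exponent l = e i.
Proof.
rewrite /exponent; case: insubP => //= i _ il _; exists i => //.
by apply: val_inj; rewrite /= il.
Qed.

Lemma pure_powersE (k : fieldType) (p : {mpoly k[n]}) : (forall i, (0 < e i)%N) ->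
  pure_powers ler e p <-> mono_sp n (PE exponent) p.
Proof.
move=> e0; pose M m := exists i, m = (U_(widen_ord ler i) *+ e i)%MM.
have -> : pure_powers ler e p <-> ideal_gen (fun g => exists2 m, M m & g = 'X_[m]) p.
  split=> h J iJ GJ; apply: h => // g.
    by case=> i ->; apply: GJ; exists (U_(widen_ord ler i) *+ e i)%MM; [exists i|rewrite mpolyXn].
  by case=> _ [i ->] ->; apply: GJ; exists i; rewrite mpolyXn.
rewrite ideal_gen_monomials.
have E u : asb (exists2 m, M m & (m <= u)%MM) = PE exponent u.
  apply/asbP/existsP => [[_ [i ->] /mnm_lepP/(_ (widen_ord ler i))]|[l /andP[/exponent_gt0[i -> ->] ui]]].
    by rewrite mulmnE mnm1E eqxx mul1n => ui; exists (widen_ord ler i); rewrite exponent_widen e0.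
  exists (U_(widen_ord ler i) *+ e i)%MM; first by exists i.
  by apply/mnm_lepP => j; rewrite mulmnE mnm1E; case: eqP => [<-|_]; rewrite ?mul1n.
by split=> h u /h; rewrite E.
Qed.

End Exponents.

Lemma initialX n (k : fieldType) (I : {mpoly k[n]} -> Prop) u : I 'X_[u] -> initial n I u.
Proof.
move=> Iu; apply/asbP; exists 'X_[u]; first by rewrite mcoeffX eqxx oner_neq0.
move=> v; rewrite mcoeffX; case: (eqVneq u v) => [<-|_]; last by rewrite eqxx.
by rewrite mem_mons Mon_full !eqxx.
Qed.

Theorem theorem3p1 (k : fieldType) (k_char0 : [pchar k] =i pred0)
    (n r : nat) (ler : (r <= n)%N) (e : 'I_r -> nat)
    (e_ge2 : forall i : 'I_r, (2 <= e i)%N)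
    (e_mono : forall i j : 'I_r, (i <= j)%N -> (e i <= e j)%N)
    (f : 'I_r -> 'X_{1..n})
    (f_deg : forall i : 'I_r, mdeg (f i) = e i)
    (f_reg : regular_sequence (fun i : 'I_r => 'X_[f i] : {mpoly k[n]}))
    (I : {mpoly k[n]} -> Prop) (I_homog : homogeneous_ideal I)
    (I_F : forall i : 'I_r, I 'X_[f i]) :
  exists L : {mpoly k[n]} -> Prop,
    [/\ lex_plus (pure_powers ler e) L,
        forall d : nat, hilbert I d = hilbert L d
      & forall i j : nat, (betti I i j <= betti L i j)%N].
Proof.
have [iI _] := I_homog.
have C0 : [pchar algC] =i pred0 := Num.Theory.pchar_num algC.
have C_roots b : (0 < b)%N -> exists lambda : algC, b.-primitive_root lambda.
  by move=> /C_prim_root_exists[lambda]; exists lambda.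
have e0 i : (0 < e i)%N by apply: ltnW.
have f0 i : f i != 0%MM by rewrite -mdeg_eq0 f_deg -lt0n.
pose A := initial n I.
have uA : up n A by apply: up_initial => g i _; have [_ _] := iI; apply.
have Af i : A (f i) by apply: initialX.
have [B [s [[uB cB rB] sI Bs]]] :=
  degen_merge algC uA Af (fun i j l => @regular_coprime _ _ _ _ f0 f_reg i j l) f0.
have Bs' i : B (U_(s i) *+ e i)%MM by rewrite -f_deg.
have [C [uC cC rC] Ce] := degen_sort C_roots ler e0 e_mono uB sI Bs'.
pose E := exponent e (n := n).
have E_mono (i j : 'I_n) : (i <= j)%N -> (0 < E j)%N -> (0 < E i <= E j)%N.
  move=> ij /(exponent_gt0 ler)[j' jE ej]; have ir : (i < r)%N.
    by apply: leq_ltn_trans ij _; rewrite jE /= ltn_ord.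
  have -> : i = widen_ord ler (Ordinal ir) by apply: val_inj.
  rewrite /E ej exponent_widen e0 e_mono //.
  by move: ij; rewrite jE.
have PC : contains_PE E n C.
  by apply: contains_PEP => // l _ /(exponent_gt0 ler)[i lE]; rewrite /E => ->; rewrite lE.
have [uL rL] := lexseg_main C0 C_roots E_mono (leqnn n) uC PC.
pose L := lexseg E n C; have iL := mono_sp_ideal k uL.
have cL d : cnt n L d = cnt n A d by rewrite cnt_lexseg // cC cB.
have initL u : initial n (mono_sp (K := k) n L) u = L u by rewrite initial_mono ?Mon_full.
exists (mono_sp n L); split=> [|d|i j].
- by apply: lex_plus_lexseg => // p; apply: pure_powersE.
- rewrite !hilbert_initial // -cL; apply: eq_count => u.
  by rewrite initL.
have r_le l : (rk k n l L j <= rk k n l A j)%N.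
  (* A was obtained over k, but as a set of monomials it could be degenerated over [algC]. Only the
     ranks have to be carried back to k. *)
  rewrite !(rk_char0 n l _ j k_char0 C0).
  by apply: leq_trans (rL l j) _; apply: leq_trans (rC l j) (rB l j).
have [s0 hI0 le0] := hd_im_dK n i j (subsp_ideal iI).
have [s1 hI1 le1] := hd_im_dK n i.+1 j (subsp_ideal iI).
(* The two instances of [betti_rank] have equal right-hand sides, so the Betti numbers gain what the
   ranks lose. *)
have := betti_rank iI hI0 hI1.
have := betti_rank iL (hd_im_dK_mono k n L i j) (hd_im_dK_mono k n L i.+1 j).
rewrite (eq_cfam (A' := L)) => [|u _ _]; last exact: initL.
rewrite (eq_cfam_cnt _ (A' := A)) => [|d _]; last exact: cL.
have := leq_trans (r_le i) le0; have := leq_trans (r_le i.+1) le1.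
by rewrite -/L -/A; lia.
Qed.
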